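(* Let $n=2k$ be a positive even integer. There is a unique operator-valued matrix $R\in(\mathrm{End}\,V)\otimes U_q[osp(2|n)]^+$ of the form $$R=q^{\sum_a \pi(\tilde h_a)\otimes\tilde h^a}\Bigl[I\otimes I+(q-q^{-1})\sum_{\varepsilon_a<\varepsilon_b}(-1)^{[b]}E^a_b\otimes\hat\sigma_{ba}\Bigr]$$ satisfying $R\,(\pi\otimes\mathrm{id})\Delta(e_c)=(\pi\otimes\mathrm{id})\Delta^T(e_c)\,R$ for all raising generators $e_c$. The simple operators for that matrix are given by \begin{align*} &\hat\sigma_{\mu(\mu+1)}=\hat\sigma_{(\overline{\mu+1})\,\overline{\mu}}=q^{-\frac12}e_\mu q^{\frac12h_\mu},\qquad 1\le\mu<k,\\ &\hat\sigma_{(\mu=k)(i=1)}=(-1)^kq\,\hat\sigma_{(i=\overline1)(\overline\mu=\overline k)}=q^{\frac12}e_sq^{\frac12h_s},\\ &\hat\sigma_{(\mu=k)(i=\overline1)}=(-1)^kq\,\hat\sigma_{(i=1)(\overline\mu=\overline k)}=q^{\frac12}e_tq^{\frac12h_t},\\ &\hat\sigma_{(i=1)(i=\overline1)}=0, \end{align*} and the remaining values can be calculated using (i) the $q$-commutation relations $$q^{(\alpha_c,\varepsilon_b)}\hat\sigma_{ba}e_cq^{\frac12h_c}-(-1)^{([a]+[b])[c]}q^{-(\alpha_c,\varepsilon_a)}e_cq^{\frac12h_c}\hat\sigma_{ba}=0,\qquad\varepsilon_b>\varepsilon_a,$$ where neither $\varepsilon_a-\alpha_c$ nor $\varepsilon_b+\alpha_c$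 equals any $\varepsilon_x$; and (ii) the induction relations $$\hat\sigma_{ba}=q^{-(\varepsilon_b,\varepsilon_a)}\hat\sigma_{bc}\hat\sigma_{ca}-q^{-(\varepsilon_c,\varepsilon_c)}(-1)^{([b]+[c])([a]+[c])}\hat\sigma_{ca}\hat\sigma_{bc},\qquad\varepsilon_b>\varepsilon_c>\varepsilon_a,$$ where $c\ne\overline b$ and $c\neq\overline a$.
   Context: **Indices and weights.** $n=2k$. $V$ is a $\mathbb Z_2$-graded vector space of dimension $n+2$ with basis indexed by even indices $i\in\{1,2\}$ ($[i]=0$) and odd indices $\mu\in\{1,\dots,n\}$ ($[\mu]=1$). A subscript such as $(i=1)$ means the even index $1$, and $(\mu=k)$ means the odd index $k$. Put $\overline i=3-i$ for even indices (so $(i=\overline 1)$ is the even index $2$) and $\overline\mu=n+1-\mu$ for odd indices. The weight of an index $a$ is written generically $\varepsilon_a$: it is $\varepsilon_1$ or $\varepsilon_2=-\varepsilon_1$ for the even indices, and $\delta_\mu$ for the odd index $\mu$, with $\delta_{\overline\mu}=-\delta_\mu$. The bilinear form is $(\varepsilon_1,\varepsilon_1)=1$, $(\delta_\mu,\delta_\nu)=-\delta^\mu_\nu$, $(\varepsilon_1,\delta_\mu)=0$ for $1\le\mu,\nu\le k$. Weights are ordered by $\delta_1>\dots>\delta_k>\varepsilon_1>-\varepsilon_1>-\delta_k>\dots>-\delta_1$; equivalently, $\varepsilon_b>\varepsilon_a$ iff $\varepsilon_b-\varepsilon_a$ is a positive root of $osp(2|n)$ or equals $2\varepsilon_1$.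 Simple roots: $\alpha_\mu=\delta_\mu-\delta_{\mu+1}$ ($1\le\mu<k$, even), $\alpha_s=\delta_k-\varepsilon_1$ and $\alpha_t=\delta_k+\varepsilon_1$ (both odd). For a generator label $c$, $[c]$ is the parity of $\alpha_c$. **The quantum superalgebra.** $q$ is real, with $q$ and $q^{1/2}$ such that all formulas make sense ($q>0$, $q\ne1$). $[A,B]=AB-(-1)^{[A][B]}BA$ and $(A\otimes B)(C\otimes D)=(-1)^{[B][C]}AC\otimes BD$. $U_q[osp(2|n)]$ is generated by $e_c,f_c,h_c$ (and $q^{\pm h_c/2}$), $c\in\{1,\dots,k-1,s,t\}$, where $e_c,f_c$ have parity $[c]$ and $h_c$ is even, subject to $[h_a,e_b]=(\alpha_a,\alpha_b)e_b$, $[h_a,f_b]=-(\alpha_a,\alpha_b)f_b$, $[h_a,h_b]=0$, $[e_a,f_b]=\delta^a_b\frac{q^{h_a}-q^{-h_a}}{q-q^{-1}}$, $[e_a,e_a]=[f_a,f_a]=0$ if $(\alpha_a,\alpha_a)=0$, and, for $b\ne c$ with $(\alpha_b,\alpha_b)\ne0$, $(\mathrm{ad}\,e_b\circ)^{1-a_{bc}}e_c=0$ and $(\mathrm{ad}\,f_b\circ)^{1-a_{bc}}f_c=0$, where $a_{bc}=2(\alpha_b,\alpha_c)/(\alpha_b,\alpha_b)$, together with Yamane's extra $q$-Serre relations. For raising generators these are, with $E_c=e_cq^{h_c/2}$ and $[x,y]_q=\mathrm{ad}\,x\circ y$ (which for $x=E_c$ and $y$ of weight $\beta$ equals $E_cy-(-1)^{[c][y]}q^{(\alpha_c,\beta)}yE_c$),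 when $k\ge2$: $[E_{k-1},[E_s,E_t]_q]_q=(q+q^{-1})[E_s,[E_{k-1},E_t]_q]_q$, $[E_{k-1},[E_t,E_s]_q]_q=(q+q^{-1})[E_t,[E_{k-1},E_s]_q]_q$, $[E_s,[E_t,E_{k-1}]_q]_q=[E_t,[E_s,E_{k-1}]_q]_q$; those for lowering generators are the images of these under the graded conjugation $\dagger$ given by $e_a^\dagger=f_a$, $f_a^\dagger=(-1)^{[a]}e_a$, $h_a^\dagger=h_a$, $(AB)^\dagger=(-1)^{[A][B]}B^\dagger A^\dagger$. The coproduct is the algebra homomorphism with $\Delta(e_a)=q^{h_a/2}\otimes e_a+e_a\otimes q^{-h_a/2}$, $\Delta(f_a)=q^{h_a/2}\otimes f_a+f_a\otimes q^{-h_a/2}$, $\Delta(q^{\pm h_a/2})=q^{\pm h_a/2}\otimes q^{\pm h_a/2}$; the antipode is the graded antihomomorphism with $S(e_a)=-q^{-(\alpha_a,\alpha_a)/2}e_a$, $S(f_a)=-q^{(\alpha_a,\alpha_a)/2}f_a$, $S(q^{\pm h_a})=q^{\mp h_a}$; the adjoint action is $\mathrm{ad}\,a\circ b=\sum_{(a)}(-1)^{[b][a^{(2)}]}a^{(1)}bS(a^{(2)})$, where $\Delta(a)=\sum a^{(1)}\otimes a^{(2)}$. $T(A\otimes B)=(-1)^{[A][B]}B\otimes A$ and $\Delta^T=T\circ\Delta$. $U_q[osp(2|n)]^+$ is the Hopf subsuperalgebra generated by the raising generators $e_c$ and the Cartan elements. **Vector representation.** $E^a_b$ is the elementary matrix with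 $1$ in position $(a,b)$ and $0$ elsewhere, of parity $[a]+[b]$. $\pi:U_q[osp(2|n)]\to\mathrm{End}\,V$ is given by $\pi(e_\mu)=E^\mu_{\mu+1}+E^{\overline{\mu+1}}_{\overline\mu}$, $\pi(f_\mu)=E^{\mu+1}_\mu+E^{\overline\mu}_{\overline{\mu+1}}$ ($1\le\mu<k$); $\pi(e_s)=E^{\mu=k}_{i=1}+(-1)^kE^{i=\overline1}_{\overline\mu=\overline k}$, $\pi(f_s)=-E^{i=1}_{\mu=k}+(-1)^kE^{\overline\mu=\overline k}_{i=\overline1}$; $\pi(e_t)=E^{\mu=k}_{i=\overline1}+(-1)^kE^{i=1}_{\overline\mu=\overline k}$, $\pi(f_t)=-E^{i=\overline1}_{\mu=k}+(-1)^kE^{\overline\mu=\overline k}_{i=1}$; and $\pi(h_c)=\sum_a(\alpha_c,\varepsilon_a)E^a_a$. **Cartan factor.** $\{\tilde h_a\}$ is a basis of the Cartan subalgebra and $\{\tilde h^a\}$ the dual basis, so that $q^{\sum_a\pi(\tilde h_a)\otimes\tilde h^a}=\sum_aE^a_a\otimes q^{h_{\varepsilon_a}}$, where $\lambda\mapsto h_\lambda$ is linear with $h_{\alpha_c}=h_c$. **Unknown operators.** The $\hat\sigma_{ba}$ ($\varepsilon_b>\varepsilon_a$) are elements of $U_q[osp(2|n)]^+$; $R$ is even and weightless, i.e. $\hat\sigma_{ba}$ has parity $[a]+[b]$ and weight $\varepsilon_b-\varepsilon_a$.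
   Formalization: The q-Serre relations (ad e_b)^{1-a_bc} e_c = 0 and those for f are imposed with E_c = e_c q^{h_c/2} and F_c = f_c q^{h_c/2} in place of e_c and f_c; taken literally they are incompatible with the stated coproduct when k ≥ 2. *)

(* Defs.v *)
From HB Require Import structures.
From mathcomp Require Import all_boot all_order all_algebra.
From mathcomp Require Import zify ring.
From mathcomp Require Import finmap.
From mathcomp.multinomials Require Import monalg.
From mathcomp Require Import boolp.

Set Implicit Arguments.
Unset Strict Implicit.
Unset Printing Implicit Defensive.

Import GRing.Theory Num.Theory.
Local Open Scope ring_scope.
Local Open Scope quotient_scope.

Section Indices.
Variable k : nat.

(* The basis of V (n = k.*2) is listed in decreasing order of weight,
     delta_1, .., delta_k, epsilon_1, -epsilon_1, -delta_k, .., -delta_1,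
   at positions 0, .., 2k+1.  So the order of the weights is the reversed order
   of the positions, and rev_ord is the bar involution on even and on odd
   indices alike. *)
Definition idx := 'I_k.*2.+2.

(* od mu, for 1 <= mu <= 2k, and ev i, for i = 1, 2, are the odd index mu and
   the even index i in the numbering that starts at 1. *)
Definition od (mu : nat) : idx := inord (if (mu <= k)%N then mu.-1 else mu.+1).
Definition ev (i : nat) : idx := inord (k + i.-1).
Definition bar (a : idx) : idx := rev_ord a.

Definition par (a : idx) : bool := (a != ev 1) && (a != ev 2).

(* epsilon_b > epsilon_a *)
Definition wgt_gt (b a : idx) : bool := (b < a)%N.

(* Weights in the coordinates (delta_1, .., delta_k, epsilon_1). *)
Definition wgt := 'rV[int]_k.+1.

Definition eps (a : idx) : wgt :=
  if (a <= k)%N then delta_mx 0 (inord a) else - delta_mx 0 (inord (bar a)).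

Definition form (u v : wgt) : int :=
  u 0 ord_max * v 0 ord_max - \sum_(j < k.+1 | (j < k)%N) u 0 j * v 0 j.

(* Labels of the simple roots: inl m stands for mu = m.+1, so 1 <= mu < k. *)
Definition label := ('I_k.-1 + bool)%type.
Definition lab_s : label := inr false.
Definition lab_t : label := inr true.

Definition alpha (c : label) : wgt :=
  match c with
  | inl m => eps (od m.+1) - eps (od m.+2)
  | inr false => eps (od k) - eps (ev 1)
  | inr true => eps (od k) + eps (ev 1)
  end.

Definition lpar (c : label) : bool := if c is inr _ then true else false.

(* 2 lambda = \sum_c halfcoef lambda c alpha_c, see halfcoefP. *)
Definition halfcoef (lambda : wgt) (c : label) : int :=
  match c with
  | inl m => 2 * \sum_(j < k.+1 | (j <= m)%N) lambda 0 j
  | inr false => \sum_(j < k.+1 | (j < k)%N) lambda 0 j - lambda 0 ord_max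
  | inr true => \sum_(j < k.+1 | (j < k)%N) lambda 0 j + lambda 0 ord_max
  end.

(* gK c and gKi c are q^(h_c/2) and q^(-h_c/2). *)
Inductive gen :=
  gE of label | gF of label | gH of label | gK of label | gKi of label.

Definition gen_code (g : gen) : 'I_5 * label :=
  match g with
  | gE c => (inord 0, c) | gF c => (inord 1, c) | gH c => (inord 2, c)
  | gK c => (inord 3, c) | gKi c => (inord 4, c)
  end.

Definition gen_decode (x : 'I_5 * label) : gen :=
  match val x.1 with
  | 0 => gE x.2 | 1 => gF x.2 | 2 => gH x.2 | 3 => gK x.2 | _ => gKi x.2
  end.

Lemma gen_codeK : cancel gen_code gen_decode.
Proof. by case=> c; rewrite /gen_decode /= inordK. Qed.

HB.instance Definition _ := Countable.copy gen (can_type gen_codeK).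

Definition gpar (g : gen) : bool :=
  match g with gE c | gF c => lpar c | _ => false end.

Definition gcar (g : gen) : bool :=
  match g with gK _ | gKi _ => true | _ => false end.

Definition word := {fmonom gen}.
Definition wpar (w : seq gen) : bool := odd (count gpar w).

End Indices.

Arguments lab_s {k}.
Arguments lab_t {k}.
Arguments ev {k}.
Arguments od {k}.
Arguments bar {k}.

Section WeightLemmas.
Variable k : nat.

Lemma val_ev1 : (ev 1 : idx k) = k :> nat.
Proof. by rewrite inordK ?addn0 // -addnn; lia. Qed.

Lemma val_od mu : (0 < mu <= k)%N -> (od mu : idx k) = mu.-1 :> nat.
Proof. by case/andP=> h1 h2; rewrite /od h2 inordK // -addnn; lia. Qed.

Lemma eps_bar (a : idx k) : eps (bar a) = - eps a.
Proof.
have E i : (i < k.*2.+2)%N -> (k.*2.+2 - i.+1 <= k)%N = ~~ (i <= k)%N.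
  by rewrite -addnn; lia.
rewrite /eps /bar rev_ordK /= E ?ltn_ord //.
by case: leqP; rewrite /= ?opprK.
Qed.

Let d (m : nat) : wgt k := delta_mx 0 (inord m).

Lemma eps_od mu : (0 < mu <= k)%N -> eps (od mu) = d mu.-1.
Proof. by move=> h; rewrite /eps val_od // ifT //; lia. Qed.

Lemma eps_ev1 : eps (ev 1) = d k.
Proof. by rewrite /eps val_ev1 leqnn. Qed.

Lemma halfcoefP (lambda : wgt k) : (0 < k)%N ->
  \sum_(c : label k) halfcoef lambda c *: alpha c = lambda *+ 2.
Proof.
move=> k0; pose L m := lambda 0 (inord m).
pose p n := \sum_(0 <= m < n.+1) L m.
have pE n : (n <= k)%N -> \sum_(j < k.+1 | (j <= n)%N) lambda 0 j = p n.
  move=> hn; rewrite /p big_mkord (big_ord_widen k.+1 L) //.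
  by apply: eq_bigr => j _; rewrite /L inord_val.
have pk : \sum_(j < k.+1 | (j < k)%N) lambda 0 j = p k.-1.
  rewrite -pE; last by lia.
  by apply: eq_bigl => j; apply/idP/idP; lia.
have abel n : \sum_(0 <= m < n) p m *: (d m - d m.+1) + p n *: d n =
    \sum_(0 <= m < n.+1) L m *: d m.
  elim: n => [|n IH]; first by rewrite big_nil add0r /p !big_nat1.
  rewrite [RHS]big_nat_recr //= -IH big_nat_recr //= scalerBr.
  have -> : p n.+1 = p n + L n.+1 by rewrite /p big_nat_recr.
  by rewrite scalerDl !addrA subrK.
have Lk : lambda 0 ord_max = L k.
  by congr (lambda 0 _); apply: val_inj; rewrite /= inordK.
have lambdaE : lambda = \sum_(0 <= m < k) L m *: d m + L k *: d k.
  rewrite -(big_nat_recr k 0 (fun m => L m *: d m)) //= big_mkord.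
  rewrite [LHS]row_sum_delta; apply: eq_bigr => j _.
  by rewrite /L /d inord_val.
rewrite big_sumType /= big_bool /= pk Lk.
rewrite eps_od ?k0 ?leqnn // eps_ev1.
have -> : \sum_(i < k.-1) (2 * \sum_(j < k.+1 | (j <= i)%N) lambda 0 j) *:
      (eps (od i.+1) - eps (od i.+2)) =
    (\sum_(0 <= m < k.-1) p m *: (d m - d m.+1)) *+ 2.
  rewrite big_mkord -sumrMnl; apply: eq_bigr => m _.
  have hm := ltn_ord m; rewrite pE; last by lia.
  by rewrite !eps_od; [rewrite -scalerA mulr2n scalerDl !scale1r| lia..].
have -> : (p k.-1 + L k) *: (d k.-1 + d k) + (p k.-1 - L k) *: (d k.-1 - d k)
   = (p k.-1 *: d k.-1) *+ 2 + (L k *: d k) *+ 2.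
  by apply/rowP => j; rewrite !mulr2n !mxE; ring.
rewrite addrA -mulrnDl abel (prednK k0) -mulrnDl.
by rewrite -lambdaE.
Qed.

End WeightLemmas.

Section Lext.
Variables (K : choiceType) (F : numFieldType) (V : lmodType F) (h : K -> V).

(* The linear extension of h to formal linear combinations. *)
Definition lext (x : {malg F[K]}) : V := \sum_(w <- msupp x) x@_w *: h w.

Lemma lextEw (d : {fset K}) x : fsubset (msupp x) d ->
  lext x = \sum_(w <- d) x@_w *: h w.
Proof.
move=> le; rewrite /lext (big_fset_incl _ le) //= => w _ /mcoeff_outdom ->.
by rewrite scale0r.
Qed.

Lemma lextU c w : lext << c *g w >> = c *: h w.
Proof. by rewrite (lextEw msuppU_le) big_seq_fset1 mcoeffUU. Qed.

Lemma lext1 w : lext << w >> = h w.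
Proof. by rewrite lextU scale1r. Qed.

Lemma lext_is_linear : linear lext.
Proof.
move=> c x y; pose d := (msupp x `|` msupp y)%fset.
have sx : fsubset (msupp x) d by apply: fsubsetUl.
have sy : fsubset (msupp y) d by apply: fsubsetUr.
have sxy : fsubset (msupp (c *: x + y)) d.
  apply: fsubset_trans (msuppD_le _ _) _.
  by apply: fsetSU; apply: msuppZ_le.
rewrite (lextEw sx) (lextEw sy) (lextEw sxy) scaler_sumr -big_split /=.
by apply: eq_bigr => w _; rewrite mcoeffD mcoeffZ scalerDl scalerA.
Qed.

HB.instance Definition _ :=
  GRing.isLinear.Build F {malg F[K]} V *:%R lext lext_is_linear.

Lemma lextD x y : lext (x + y) = lext x + lext y.
Proof. exact: linearD. Qed.

Lemma lextZ c x : lext (c *: x) = c *: lext x.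
Proof. exact: linearZ. Qed.

End Lext.

Lemma eq_lext (K : choiceType) (F : numFieldType) (V : lmodType F)
    (h h' : K -> V) (x : {malg F[K]}) : h =1 h' -> lext h x = lext h' x.
Proof. by move=> e; apply: eq_bigr => w _; rewrite e. Qed.

Lemma lextDh (K : choiceType) (F : numFieldType) (V : lmodType F)
    (h h' : K -> V) (x : {malg F[K]}) :
  lext (fun w => h w + h' w) x = lext h x + lext h' x.
Proof.
by rewrite /lext -big_split; apply: eq_bigr => w _; rewrite scalerDr.
Qed.

Lemma lext_comp (K : choiceType) (F : numFieldType) (V W : lmodType F)
    (f : {linear V -> W}) (h : K -> V) (x : {malg F[K]}) :
  f (lext h x) = lext (fun w => f (h w)) x.
Proof.
by rewrite /lext linear_sum; apply: eq_bigr => w _; rewrite linearZ.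
Qed.

Section MalgGeneric.
Variables (K : monomType) (F : numFieldType).
Implicit Types (x y u v : {malg F[K]}).

Lemma malg_ind (P : {malg F[K]} -> Prop) :
  P 0 -> (forall c w x, P x -> P (c *: << w >> + x)) -> forall x, P x.
Proof.
move=> P0 PD x; rewrite [x]monalgE; elim: (msupp x : seq _) => [|w s IH].
  by rewrite big_nil.
rewrite big_cons; have -> : << x@_w *g w >> = x@_w *: << w >> :> {malg F[K]}.
  by rewrite -mul_malgC malgM_def fgmulUU mulr1 mul1m.
exact: PD.
Qed.

Lemma malg_scalerAr (c : F) x y : c *: (x * y) = x * (c *: y).
Proof.
rewrite -(mul_malgC c (x * y)) -(mul_malgC c y) mulrA [RHS]mulrA.
congr (_ * y); rewrite !malgM_def fgmulUg fgmulgU; apply: eq_bigr => w _.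
by rewrite mul1m mulm1 mulrC.
Qed.

Lemma malg_ZMM c u x v : u * (c *: x) * v = c *: (u * x * v).
Proof. by rewrite -malg_scalerAr -scalerAl. Qed.

Lemma malg_mulA5 u u' x v' v : u * (u' * x * v') * v = u * u' * x * (v' * v).
Proof. by rewrite !mulrA. Qed.

Lemma malg_UM (m m' : K) : << m >> * << m' >> = << mmul m m' >> :> {malg F[K]}.
Proof. by rewrite malgM_def fgmulUU mulr1. Qed.

Lemma lext_morph (A : lalgType F) (h : K -> A) :
  (forall c (u v : A), c *: (u * v) = u * (c *: v)) -> h mone = 1 ->
  {morph h : m n / mmul m n >-> m * n} ->
  monoid_morphism (lext h).
Proof.
move=> hA h1 hM; split=> [|x y]; first by rewrite [LHS]lext1.
have L0 : lext h 0 = 0 by apply: linear0.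
elim/malg_ind: x => [|c w x IH]; first by rewrite L0 !mul0r.
rewrite mulrDl !lextD mulrDl IH; congr (_ + _).
rewrite -scalerAl !lextZ -scalerAl; congr (_ *: _).
elim/malg_ind: y {IH} => [|d v y IH]; first by rewrite mulr0 L0 mulr0.
rewrite mulrDr !lextD mulrDr IH; congr (_ + _).
rewrite -malg_scalerAr !lextZ -hA; congr (_ *: _).
by rewrite malg_UM !lext1 hM.
Qed.

End MalgGeneric.

Section FreeAlgebra.
Variables (k : nat) (F : numFieldType) (qh : F).

Notation label := (label k).
Notation gen := (gen k).
Notation word := (word k).

(* q^(m/2) and q^m, where qh is q^(1/2). *)
Definition hpow (m : int) : F := qh ^ m.
Definition qpow (m : int) : F := qh ^ (2 * m).

Notation falg := {malg F[word]}.

Definition wgen (g : gen) : word := fmu g.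
Definition fgen (g : gen) : falg := << wgen g >>.

(* theta, the antipode, the coproduct and ad are defined on the free algebra,
   where they are determined by their values on the generators. *)

Definition ftheta : falg -> falg :=
  lext (fun w : word => (-1) ^+ wpar w *: (<< w >> : falg)).
Definition fsgn (p : bool) (x : falg) : falg := if p then ftheta x else x.

Fixpoint antiw (phi : gen -> falg) (w : seq gen) : falg :=
  if w is g :: w' then
    (-1) ^+ (gpar g && wpar w') *: (antiw phi w' * phi g)
  else 1.

Definition antipode_gen (g : gen) : falg :=
  match g with
  | gE c => - hpow (- form (alpha c) (alpha c)) *: fgen (gE c)
  | gF c => - hpow (form (alpha c) (alpha c)) *: fgen (gF c)
  | gH c => - fgen (gH c)
  | gK c => fgen (gKi c)
  | gKi c => fgen (gK c)
  end.

Definition dagger_gen (g : gen) : falg :=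
  match g with
  | gE c => fgen (gF c)
  | gF c => (-1) ^+ lpar c *: fgen (gE c)
  | _ => fgen g
  end.

Definition antipode : falg -> falg :=
  lext (fun w : word => antiw antipode_gen w).
Definition dagger : falg -> falg :=
  lext (fun w : word => antiw dagger_gen w).

Notation falg2 := {malg F[(word * word)%type]}.

Definition tens (u v : word) : falg2 := << (u, v) >>.

Definition tmul (x y : falg2) : falg2 :=
  lext (fun p : word * word =>
    lext (fun r : word * word =>
      (-1) ^+ (wpar p.2 && wpar r.1) *:
        tens (mmul p.1 r.1) (mmul p.2 r.2)) y) x.

Definition Delta_gen (g : gen) : falg2 :=
  match g with
  | gE c | gF c =>
      tens (wgen (gK c)) (wgen g) + tens (wgen g) (wgen (gKi c))
  | gH c => tens (wgen g) mone + tens mone (wgen g)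
  | gK c | gKi c => tens (wgen g) (wgen g)
  end.

Definition Delta_word (w : seq gen) : falg2 :=
  foldr (fun g x => tmul (Delta_gen g) x) (tens mone mone) w.

Definition Delta : falg -> falg2 := lext (fun w : word => Delta_word w).

Definition twist : falg2 -> falg2 :=
  lext (fun p : word * word =>
    (-1) ^+ (wpar p.1 && wpar p.2) *: tens p.2 p.1).

Definition ad (x y : falg) : falg :=
  lext (fun p : word * word =>
    << p.1 >> * fsgn (wpar p.2) y * antipode << p.2 >>) (Delta x).

(* E_c = e_c q^(h_c/2), and likewise for the lowering generators. *)
Definition bigE (c : label) : falg := fgen (gE c) * fgen (gK c).
Definition bigF (c : label) : falg := fgen (gF c) * fgen (gK c).

Definition scomm (p p' : bool) (x y : falg) : falg :=
  x * y - (-1) ^+ (p && p') *: (y * x).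

(* 1 - a_bc; the division is exact. *)
Definition serre_exp (b c : label) : nat :=
  `|1 - (2 * form (alpha b) (alpha c) %/ form (alpha b) (alpha b))%Z|%N.

(* The extra relations, for the label m of the even simple root k - 1. *)
Inductive yamane : falg -> Prop :=
| yamane1 (m : 'I_k.-1) of (m.+2 = k)%N :
    yamane (ad (bigE (inl m)) (ad (bigE lab_s) (bigE lab_t))
            - (qpow 1 + qpow (-1)) *:
              ad (bigE lab_s) (ad (bigE (inl m)) (bigE lab_t)))
| yamane2 (m : 'I_k.-1) of (m.+2 = k)%N :
    yamane (ad (bigE (inl m)) (ad (bigE lab_t) (bigE lab_s))
            - (qpow 1 + qpow (-1)) *:
              ad (bigE lab_t) (ad (bigE (inl m)) (bigE lab_s)))
| yamane3 (m : 'I_k.-1) of (m.+2 = k)%N :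
    yamane (ad (bigE lab_s) (ad (bigE lab_t) (bigE (inl m)))
            - ad (bigE lab_t) (ad (bigE lab_s) (bigE (inl m)))).

(* The elements of the free algebra that vanish in U_q[osp(2|n)].  As
   q^(h_a/2) is a generator here, its commutation with e_b and f_b is imposed
   along with that of h_a.
   In the q-Serre relations ad is taken between the E_c, as in the extra ones,
   which gives E_b^2 E_c - (q + q^-1) E_b E_c E_b + E_c E_b^2 = 0 when
   a_bc = -1.  With e_b and e_c in place of E_b and E_c the coefficients would
   be q^(-1/2) (q + q^-1) and q^-1, and the bracket with f_c would then make
   the product of e_b^2 and a nonzero Cartan element vanish. *)
Inductive relator : falg -> Prop :=
| rel_KKi c : relator (fgen (gK c) * fgen (gKi c) - 1)
| rel_KiK c : relator (fgen (gKi c) * fgen (gK c) - 1)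
| rel_KK a b : relator (scomm false false (fgen (gK a)) (fgen (gK b)))
| rel_KH a b : relator (scomm false false (fgen (gK a)) (fgen (gH b)))
| rel_KE a b :
    relator (fgen (gK a) * fgen (gE b)
             - hpow (form (alpha a) (alpha b)) *: (fgen (gE b) * fgen (gK a)))
| rel_KF a b :
    relator (fgen (gK a) * fgen (gF b)
             - hpow (- form (alpha a) (alpha b)) *: (fgen (gF b) * fgen (gK a)))
| rel_HH a b : relator (scomm false false (fgen (gH a)) (fgen (gH b)))
| rel_HE a b :
    relator (scomm false (lpar b) (fgen (gH a)) (fgen (gE b))
             - (form (alpha a) (alpha b))%:~R *: fgen (gE b))
| rel_HF a b :
    relator (scomm false (lpar b) (fgen (gH a)) (fgen (gF b))
             + (form (alpha a) (alpha b))%:~R *: fgen (gF b))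
| rel_EF a b :
    relator (scomm (lpar a) (lpar b) (fgen (gE a)) (fgen (gF b))
             - (a == b)%:R *: ((qpow 1 - qpow (-1))^-1 *:
                 (fgen (gK a) ^+ 2 - fgen (gKi a) ^+ 2)))
| rel_EE a of form (alpha a) (alpha a) = 0 :
    relator (scomm (lpar a) (lpar a) (fgen (gE a)) (fgen (gE a)))
| rel_FF a of form (alpha a) (alpha a) = 0 :
    relator (scomm (lpar a) (lpar a) (fgen (gF a)) (fgen (gF a)))
| rel_serreE b c of b != c & form (alpha b) (alpha b) != 0 :
    relator (iter (serre_exp b c) (ad (bigE b)) (bigE c))
| rel_serreF b c of b != c & form (alpha b) (alpha b) != 0 :
    relator (iter (serre_exp b c) (ad (bigF b)) (bigF c))
| rel_yamaneE x of yamane x : relator x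
| rel_yamaneF x of yamane x : relator (dagger x).

Inductive ideal : falg -> Prop :=
| ideal0 : ideal 0
| idealD x y of ideal x & ideal y : ideal (x + y)
| ideal_rel u x v of relator x : ideal (u * x * v).

Lemma wparM (u v : word) : wpar (mmul u v : word) = wpar u (+) wpar v.
Proof. by rewrite /wpar fmM count_cat oddD. Qed.

Lemma wpar1 : wpar (mone : word) = false.
Proof. by rewrite /wpar fm1. Qed.

Lemma wpar_gen g : wpar (wgen g) = gpar g.
Proof. by rewrite /wpar fmU /= addn0; case: gpar. Qed.

Lemma ftheta_morph : monoid_morphism ftheta.
Proof.
apply: lext_morph => [||u v]; first exact: malg_scalerAr.
  by rewrite wpar1 scale1r.
by rewrite wparM signr_addb -scalerA -malg_UM malg_scalerAr scalerAl.
Qed.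

Lemma ftheta_gen g : ftheta (fgen g) = (-1) ^+ gpar g *: fgen g.
Proof. by rewrite [LHS]lext1 wpar_gen. Qed.

Lemma tmulDl x y z : tmul (x + y) z = tmul x z + tmul y z.
Proof. exact: lextD. Qed.

Lemma tmulDr x y z : tmul x (y + z) = tmul x y + tmul x z.
Proof.
by rewrite /tmul -lextDh; apply: eq_lext => p; apply: lextD.
Qed.

Lemma tmulU (u v u' v' : word) :
  tmul (tens u v) (tens u' v') =
  (-1) ^+ (wpar v && wpar u') *: tens (mmul u u') (mmul v v').
Proof. by rewrite [LHS]lext1 [LHS]lext1. Qed.

Lemma Delta_gen_word g : Delta (fgen g) = Delta_gen g.
Proof.
rewrite [LHS]lext1 /Delta_word fmU /=.
have E (u v : word) : tmul (tens u v) (tens mone mone) = tens u v.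
  by rewrite tmulU wpar1 andbF scale1r !mulm1.
case: g => c; [| | | exact: E | exact: E].
all: by rewrite [LHS]tmulDl; congr (_ + _); apply: E.
Qed.

Lemma Delta_gen2 g g' :
  Delta (fgen g * fgen g') = tmul (Delta_gen g) (Delta_gen g').
Proof.
rewrite malg_UM [LHS]lext1 /Delta_word fmM !fmU /=; congr (tmul _ _).
by rewrite -[RHS]Delta_gen_word [RHS]lext1 /Delta_word fmU.
Qed.

Lemma antipode_gen1 g : antipode << wgen g >> = antipode_gen g.
Proof. by rewrite [LHS]lext1 fmU /= andbF scale1r mul1r. Qed.

Lemma antipode_gen2 g g' :
  antipode << mmul (wgen g) (wgen g') >> =
  (-1) ^+ (gpar g && gpar g') *: (antipode_gen g' * antipode_gen g).
Proof.
rewrite [LHS]lext1 fmM !fmU /= andbF scale1r mul1r.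
by rewrite /wpar /= addn0; case: (gpar g').
Qed.

Lemma adU (x y : falg) (u v u' v' : word) : Delta x = tens u v + tens u' v' ->
  ad x y = << u >> * fsgn (wpar v) y * antipode << v >> +
           << u' >> * fsgn (wpar v') y * antipode << v' >>.
Proof.
by move=> Dx; rewrite /ad Dx [LHS]lextD; congr (_ + _); apply: lext1.
Qed.

Lemma ad_gK g c y :
  Delta_gen g = tens (wgen (gK c)) (wgen g) + tens (wgen g) (wgen (gKi c)) ->
  ad (fgen g * fgen (gK c)) y =
  fgen g * fgen (gK c) * y * (fgen (gKi c) * fgen (gK c)) +
  fgen (gK c) * fgen (gK c) * fsgn (gpar g) y *
    (fgen (gKi c) * antipode_gen g).
Proof.
move=> Dg; have D : Delta (fgen g * fgen (gK c)) =
    tens (mmul (wgen (gK c)) (wgen (gK c))) (mmul (wgen g) (wgen (gK c))) +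
    tens (mmul (wgen g) (wgen (gK c))) (mmul (wgen (gKi c)) (wgen (gK c))).
  rewrite [LHS]Delta_gen2 Dg [LHS]tmulDl; congr (_ + _); rewrite [LHS]tmulU.
    by rewrite wpar_gen wpar_gen andbF scale1r.
  by rewrite wpar_gen wpar_gen andbF scale1r.
have S1 : antipode << mmul (wgen g) (wgen (gK c)) >> =
    fgen (gKi c) * antipode_gen g.
  by rewrite [LHS]antipode_gen2 andbF scale1r.
have S2 : antipode << mmul (wgen (gKi c)) (wgen (gK c)) >> =
    fgen (gKi c) * fgen (gK c).
  by rewrite [LHS]antipode_gen2; apply: scale1r.
have P1 : wpar (mmul (wgen g) (wgen (gK c)) : word) = gpar g.
  by rewrite wparM 2!wpar_gen; apply: addbF.
have P2 : wpar (mmul (wgen (gKi c)) (wgen (gK c)) : word) = false.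
  by rewrite wparM 2!wpar_gen.
have U1 : << mmul (wgen g) (wgen (gK c)) >> = fgen g * fgen (gK c).
  by rewrite [RHS]malg_UM.
have U2 : << mmul (wgen (gK c)) (wgen (gK c)) >> = fgen (gK c) * fgen (gK c).
  by rewrite [RHS]malg_UM.
by rewrite (adU y D) P1 P2 S1 S2 U1 U2 [LHS]addrC.
Qed.

Lemma ad_bigE c y :
  ad (bigE c) y =
  fgen (gE c) * fgen (gK c) * y * (fgen (gKi c) * fgen (gK c)) +
  fgen (gK c) * fgen (gK c) * fsgn (lpar c) y *
    (fgen (gKi c) * antipode_gen (gE c)).
Proof. exact: ad_gK. Qed.

Lemma ad_bigF c y :
  ad (bigF c) y =
  fgen (gF c) * fgen (gK c) * y * (fgen (gKi c) * fgen (gK c)) +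
  fgen (gK c) * fgen (gK c) * fsgn (lpar c) y *
    (fgen (gKi c) * antipode_gen (gF c)).
Proof. exact: ad_gK. Qed.

Definition fhom (p : bool) (x : falg) : Prop := ftheta x = (-1) ^+ p *: x.

Lemma fthetaD x y : ftheta (x + y) = ftheta x + ftheta y.
Proof. exact: lextD. Qed.

Lemma fthetaZ c x : ftheta (c *: x) = c *: ftheta x.
Proof. exact: lextZ. Qed.

Lemma fthetaM x y : ftheta (x * y) = ftheta x * ftheta y.
Proof. exact: ftheta_morph.2. Qed.

Lemma fhomD p x y : fhom p x -> fhom p y -> fhom p (x + y).
Proof. by rewrite /fhom fthetaD scalerDr => -> ->. Qed.

Lemma fhomZ p c x : fhom p x -> fhom p (c *: x).
Proof. by rewrite /fhom fthetaZ => ->; rewrite scalerA mulrC -scalerA. Qed.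

Lemma fhomN p x : fhom p x -> fhom p (- x).
Proof. by move=> h; rewrite -scaleN1r; apply: fhomZ. Qed.

Lemma fhomM p p' x y : fhom p x -> fhom p' y -> fhom (p (+) p') (x * y).
Proof.
rewrite /fhom fthetaM => -> ->.
by rewrite -malg_scalerAr -scalerAl scalerA signr_addb mulrC.
Qed.

Lemma fhom1 : fhom false 1.
Proof. by rewrite /fhom scale1r; apply: ftheta_morph.1. Qed.

Lemma fhom_gen g : fhom (gpar g) (fgen g).
Proof. exact: ftheta_gen. Qed.

Lemma fhom_sgn p p' x : fhom p x -> fhom p (fsgn p' x).
Proof.
case: p' => [h|]; last exact.
by rewrite /= (h : ftheta x = _); exact: (fhomZ _ h).
Qed.

Lemma fhom_antipode_gen g : fhom (gpar g) (antipode_gen g).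
Proof.
case: g => c; [apply: fhomZ | apply: fhomZ | apply: fhomN | |];
  exact: fhom_gen.
Qed.

Lemma fhom_dagger_gen g : fhom (gpar g) (dagger_gen g).
Proof.
case: g => c; [exact: (fhom_gen (gF c)) | | exact: fhom_gen ..].
by apply: fhomZ; exact: (fhom_gen (gE c)).
Qed.

Lemma fhom_big g c y p : fhom p y ->
  fhom (gpar g (+) p)
   (fgen g * fgen (gK c) * y * (fgen (gKi c) * fgen (gK c)) +
    fgen (gK c) * fgen (gK c) * fsgn (gpar g) y *
    (fgen (gKi c) * antipode_gen g)).
Proof.
move=> hy; have hg := fhom_gen; apply: fhomD.
  have -> : gpar g (+) p = gpar g (+) false (+) p (+) (false (+) false).
    by rewrite !addbF.
  exact (fhomM (fhomM (fhomM (hg g) (hg (gK c))) hy)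
               (fhomM (hg (gKi c)) (hg (gK c)))).
have -> : gpar g (+) p = false (+) false (+) p (+) (false (+) gpar g).
  by rewrite addbC.
exact (fhomM (fhomM (fhomM (hg (gK c)) (hg (gK c))) (fhom_sgn _ hy))
             (fhomM (hg (gKi c)) (fhom_antipode_gen g))).
Qed.

Lemma fhom_adE c y p : fhom p y -> fhom (lpar c (+) p) (ad (bigE c) y).
Proof. by move=> hy; rewrite ad_bigE; apply: (fhom_big (gE c)). Qed.

Lemma fhom_adF c y p : fhom p y -> fhom (lpar c (+) p) (ad (bigF c) y).
Proof. by move=> hy; rewrite ad_bigF; apply: (fhom_big (gF c)). Qed.

Lemma fhom_antiw phi (w : seq gen) :
  (forall g, fhom (gpar g) (phi g)) -> fhom (wpar w) (antiw phi w).
Proof.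
move=> hphi; elim: w => [|g w IH]; first exact: fhom1.
have -> : wpar (g :: w) = wpar w (+) gpar g by rewrite /wpar /= oddD addbC oddb.
exact (fhomZ _ (fhomM IH (hphi g))).
Qed.

Lemma ftheta_dagger x : ftheta (dagger x) = dagger (ftheta x).
Proof.
transitivity (lext (fun w : word => ftheta (antiw dagger_gen w)) x).
  exact: lext_comp.
transitivity (lext (fun w : word => dagger ((-1) ^+ wpar w *: << w >>)) x).
  apply: eq_lext => w; rewrite [LHS](fhom_antiw w fhom_dagger_gen) [RHS]lextZ.
  by congr (_ *: _); rewrite [RHS]lext1.
by symmetry; apply: lext_comp.
Qed.

Lemma fhom_dagger p x : fhom p x -> fhom p (dagger x).
Proof. by rewrite /fhom ftheta_dagger => ->; apply: lextZ. Qed.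

Lemma fhom_yamane x : yamane x -> exists p, fhom p x.
Proof.
have hE c : fhom (lpar c) (bigE c).
  by rewrite -[lpar c]addbF; apply: fhomM; apply: fhom_gen.
case=> m _; exists false; apply: fhomD.
- by apply: (@fhom_adE _ _ false); apply: (@fhom_adE _ _ true); apply: hE.
- by apply: fhomN; apply: fhomZ; do 2!apply: (@fhom_adE _ _ true);
  apply: hE.
- by apply: (@fhom_adE _ _ false); apply: (@fhom_adE _ _ true); apply: hE.
- by apply: fhomN; apply: fhomZ; do 2!apply: (@fhom_adE _ _ true);
  apply: hE.
- by apply: (@fhom_adE _ _ true); apply: (@fhom_adE _ _ false); apply: hE.
- by apply: fhomN; apply: (@fhom_adE _ _ true);
  apply: (@fhom_adE _ _ false); apply: hE.
Qed.

Lemma fhom_scomm p p' x y : fhom p x -> fhom p' y ->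
  fhom (p (+) p') (scomm p p' x y).
Proof.
move=> hx hy; apply: fhomD; first exact: fhomM.
by apply: fhomN; apply: fhomZ; rewrite addbC; apply: fhomM.
Qed.

Lemma fhom_relator x : relator x -> exists p, fhom p x.
Proof.
have hg := fhom_gen.
have hE c : fhom (lpar c) (bigE c).
  by rewrite -[lpar c]addbF; apply: fhomM; apply: fhom_gen.
have hF c : fhom (lpar c) (bigF c).
  by rewrite -[lpar c]addbF; apply: fhomM; apply: fhom_gen.
case=> [c|c|a b|a b|a b|a b|a b|a b|a b|a b|a _|a _|b c _ _|b c _ _
  |{}x hx|{}x hx].
- exists false; apply: fhomD; last by apply: fhomN; apply: fhom1.
  by apply: (@fhomM false false); apply: hg.
- exists false; apply: fhomD; last by apply: fhomN; apply: fhom1.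
  by apply: (@fhomM false false); apply: hg.
- by exists false; apply: fhom_scomm; apply: hg.
- by exists false; apply: fhom_scomm; apply: hg.
- exists (lpar b); apply: fhomD; first by apply: (@fhomM false); apply: hg.
  apply: fhomN; apply: fhomZ; rewrite -[lpar b]addbF; apply: fhomM; apply: hg.
- exists (lpar b); apply: fhomD; first by apply: (@fhomM false); apply: hg.
  apply: fhomN; apply: fhomZ; rewrite -[lpar b]addbF; apply: fhomM; apply: hg.
- by exists false; apply: fhom_scomm; apply: hg.
- exists (lpar b); apply: fhomD; first by apply: fhom_scomm; apply: hg.
  by apply: fhomN; apply: fhomZ; apply: hg.
- exists (lpar b); apply: fhomD; first by apply: fhom_scomm; apply: hg.
  by apply: fhomZ; apply: hg.
- exists (lpar a (+) lpar b); apply: fhomD.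
    by apply: fhom_scomm; apply: hg.
  apply: fhomN; case: (eqVneq a b) => [->|_]; last first.
    by rewrite scale0r /fhom -[0](scale0r (1 : falg)) fthetaZ !scale0r scaler0.
  rewrite addbb; apply: fhomZ; apply: fhomZ; rewrite !expr2.
  apply: fhomD; last apply: fhomN; by apply: (@fhomM false false); apply: hg.
- by exists (lpar a (+) lpar a); apply: fhom_scomm; apply: hg.
- by exists (lpar a (+) lpar a); apply: fhom_scomm; apply: hg.
- elim: serre_exp => [|n [p IH]]; first by exists (lpar c); apply: hE.
  by exists (lpar b (+) p); apply: fhom_adE.
- elim: serre_exp => [|n [p IH]]; first by exists (lpar c); apply: hF.
  by exists (lpar b (+) p); apply: fhom_adF.
- exact: fhom_yamane.
- by have [p hp] := fhom_yamane hx; exists p; apply: fhom_dagger.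
Qed.

Lemma idealZ c x : ideal x -> ideal (c *: x).
Proof.
elim=> [|y z _ hy _ hz|u y v hy]; first by rewrite scaler0; apply: ideal0.
  by rewrite scalerDr; apply: idealD.
by rewrite [c *: _]scalerAl [c *: _]scalerAl; apply: ideal_rel.
Qed.

Lemma idealM u v x : ideal x -> ideal (u * x * v).
Proof.
elim=> [|y z _ hy _ hz|u' y v' hy]; first by rewrite mulr0 mul0r; apply: ideal0.
  by rewrite mulrDr mulrDl; apply: idealD.
by rewrite malg_mulA5; apply: ideal_rel.
Qed.

Lemma ideal_theta x : ideal x -> ideal (ftheta x).
Proof.
elim=> [|y z _ hy _ hz|u y v hy].
- by rewrite [ftheta 0]linear0; apply: ideal0.
- by rewrite fthetaD; apply: idealD.
have [p hp] := fhom_relator hy.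
rewrite fthetaM fthetaM (hp : ftheta y = _) malg_ZMM; apply: idealZ.
exact: ideal_rel.
Qed.

Definition counit : falg -> F^o :=
  lext (fun w : word => (all (@gcar k) w)%:R : F^o).

Lemma counit_morph : monoid_morphism counit.
Proof.
apply: lext_morph => [c u v||u v].
- by rewrite /GRing.scale /= mulrCA.
- by rewrite fm1.
- by rewrite fmM all_cat -mulnb natrM.
Qed.

Lemma counitM x y : counit (x * y) = counit x * counit y.
Proof. exact: counit_morph.2. Qed.

Lemma counitD x y : counit (x + y) = counit x + counit y.
Proof. exact: lextD. Qed.

Lemma counitZ c x : counit (c *: x) = c *: counit x.
Proof. exact: lextZ. Qed.

Lemma counitN x : counit (- x) = - counit x.
Proof. exact: linearN. Qed.

Lemma counit_gen g : counit (fgen g) = (gcar g)%:R.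
Proof. by rewrite [LHS]lext1 fmU /= andbT. Qed.

Lemma counitM0 x y : counit x = 0 -> counit (x * y) = 0.
Proof. by rewrite counitM => ->; apply: mul0r. Qed.

Lemma counit0M x y : counit y = 0 -> counit (x * y) = 0.
Proof. by rewrite counitM => ->; apply: mulr0. Qed.

Lemma counit0Z c x : counit x = 0 -> counit (c *: x) = 0.
Proof. by rewrite counitZ => ->; apply: scaler0. Qed.

Lemma counit0D x y : counit x = 0 -> counit y = 0 -> counit (x + y) = 0.
Proof. by rewrite counitD => -> ->; apply: addr0. Qed.

Lemma counit0N x : counit x = 0 -> counit (- x) = 0.
Proof. by rewrite counitN => ->; apply: oppr0. Qed.

Lemma counit0_gen g : ~~ gcar g -> counit (fgen g) = 0.
Proof. by rewrite counit_gen => /negbTE->. Qed.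

Lemma counit_adE c y : counit (ad (bigE c) y) = 0.
Proof.
have e0 := @counit0_gen (gE c) isT; rewrite ad_bigE; apply: counit0D.
  by do 3!apply: counitM0.
by apply: counit0M; apply: counit0M; apply: (counit0Z _ e0).
Qed.

Lemma counit_adF c y : counit (ad (bigF c) y) = 0.
Proof.
have e0 := @counit0_gen (gF c) isT; rewrite ad_bigF; apply: counit0D.
  by do 3!apply: counitM0.
by apply: counit0M; apply: counit0M; apply: (counit0Z _ e0).
Qed.

Lemma counit_dagger x : counit (dagger x) = counit x.
Proof.
transitivity (lext (fun w : word => counit (antiw dagger_gen w)) x).
  exact: lext_comp.
apply: eq_lext => w /=; elim: (w : seq gen) => [|g s IH].
  exact: counit_morph.1.
have E : counit (dagger_gen g) = (gcar g)%:R.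
  case: g => c; try exact: counit_gen.
  exact: (counit0Z _ (counit0_gen _)).
rewrite [LHS]counitZ counitM IH E /=.
have zero (a b : F) : a * (b * 0) = 0 by rewrite !mulr0.
have one (b : F) : 1 * (b * 1) = b by rewrite mulr1 mul1r.
by case: g {E} => c; [exact: zero | exact: zero | exact: zero | exact: one ..].
Qed.

Lemma counit_yamane x : yamane x -> counit x = 0.
Proof.
by case=> m _; apply: counit0D; try apply: counit0N; try apply: counit0Z;
  first [exact: counit_adE | apply: counit0Z; exact: counit_adE].
Qed.

Lemma counit_scomm p p' x y : counit y = 0 -> counit (scomm p p' x y) = 0.
Proof.
move=> y0; apply: counit0D; first exact: counit0M.
by apply: counit0N; apply: counit0Z; apply: counitM0.
Qed.

Lemma counit_swap x y : counit (x * y - 1 *: (y * x)) = 0.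
Proof.
rewrite (scale1r (y * x)) (counitD (x * y)) (counitN (y * x)).
transitivity (counit x * counit y - counit y * counit x).
  by congr (_ - _); apply: counitM.
by rewrite (mulrC (counit y)); apply: subrr.
Qed.

Lemma counit_sub11 x y : counit x = 1 -> counit y = 1 -> counit (x - y) = 0.
Proof. by rewrite counitD counitN => -> ->; apply: subrr. Qed.

Lemma counit_relator x : relator x -> counit x = 0.
Proof.
have e0 c := @counit0_gen (gE c) isT; have f0 c := @counit0_gen (gF c) isT.
have h0 c := @counit0_gen (gH c) isT.
have K1 c : counit (fgen (gK c)) = 1 by apply: counit_gen.
have Ki1 c : counit (fgen (gKi c)) = 1 by apply: counit_gen.
have c1 : counit 1 = 1 by apply: counit_morph.1.
case=> [c|c|a b|a b|a b|a b|a b|a b|a b|a b|a _|a _|b c bc _|b c bc _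
  |{}x hx|{}x hx].
- by rewrite counitD counitM K1 Ki1 counitN c1 mul1r subrr.
- by rewrite counitD counitM K1 Ki1 counitN c1 mul1r subrr.
- exact: counit_swap.
- exact: (counit_scomm _ _ _ (h0 b)).
- apply: counit0D; first exact: (counit0M _ (e0 b)).
  exact: (counit0N (counit0Z _ (counitM0 _ (e0 b)))).
- apply: counit0D; first exact: (counit0M _ (f0 b)).
  exact: (counit0N (counit0Z _ (counitM0 _ (f0 b)))).
- exact: (counit_scomm _ _ _ (h0 b)).
- apply: counit0D; first exact: (counit_scomm _ _ _ (e0 b)).
  exact: (counit0N (counit0Z _ (e0 b))).
- apply: counit0D; first exact: (counit_scomm _ _ _ (f0 b)).
  exact: (counit0Z _ (f0 b)).
- apply: counit0D; first exact: (counit_scomm _ _ _ (f0 b)).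
  apply: counit0N; apply: counit0Z; apply: counit0Z.
  apply: counit_sub11.
    by rewrite (counitM (fgen (gK a)) (fgen (gK a))) K1; apply: mulr1.
  by rewrite (counitM (fgen (gKi a)) (fgen (gKi a))) Ki1; apply: mulr1.
- exact: (counit_scomm _ _ _ (e0 a)).
- exact: (counit_scomm _ _ _ (f0 a)).
- case: serre_exp => [|n]; [exact: (counitM0 _ (e0 c)) | exact: counit_adE].
- case: serre_exp => [|n]; [exact: (counitM0 _ (f0 c)) | exact: counit_adF].
- exact: counit_yamane.
- by rewrite counit_dagger; apply: counit_yamane.
Qed.

Lemma counit_ideal x : ideal x -> counit x = 0.
Proof.
elim=> [|y z _ hy _ hz|u y v hy]; first exact: linear0.
  exact: counit0D.
by apply: counitM0; apply: counit0M; apply: counit_relator.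
Qed.

Lemma ideal1 : ~ ideal 1.
Proof.
move=> /counit_ideal h; have : counit 1 = 1 by apply: counit_morph.1.
by rewrite h => /esym/eqP; rewrite oner_eq0.
Qed.

Definition relI : {pred falg} := [pred x | `[< ideal x >]].

Lemma relIP x : reflect (ideal x) (x \in relI).
Proof. exact: asboolP. Qed.

Lemma relI_zmod : zmod_closed relI.
Proof.
split=> [|x y /relIP hx /relIP hy]; first by apply/relIP; apply: ideal0.
by apply/relIP; apply: idealD => //; rewrite -scaleN1r; apply: idealZ.
Qed.

HB.instance Definition _ := GRing.isZmodClosed.Build falg relI relI_zmod.

Definition Uq := {ideal_quot relI}.
HB.instance Definition _ := GRing.Zmodule.on Uq.

Definition toU (x : falg) : Uq := \pi x.

Lemma toU_eq x y : toU x = toU y <-> ideal (x - y).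
Proof.
rewrite /toU; split=> [/eqP|/relIP h].
  by rewrite -Quotient.idealrBE => /relIP.
by apply/eqP; rewrite -Quotient.idealrBE.
Qed.

Lemma toUK x : toU (repr x) = x.
Proof. exact: reprK. Qed.

Lemma toUP (P : Uq -> Prop) : (forall x, P (toU x)) -> forall u, P u.
Proof. by move=> h u; rewrite -[u]toUK. Qed.

Lemma toUD x y : toU (x + y) = toU x + toU y.
Proof. by rewrite /toU !piE. Qed.

Definition Umul (u v : Uq) : Uq := toU (repr u * repr v).
Definition Uscale (c : F) (u : Uq) : Uq := toU (c *: repr u).

(* The parity automorphism: u |-> (-1)^[u] u on homogeneous u. *)
Definition theta (u : Uq) : Uq := toU (ftheta (repr u)).

Lemma repr_toU x : ideal (repr (toU x) - x).
Proof. by apply/toU_eq; apply: toUK. Qed.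

Lemma toUM x y : toU (x * y) = Umul (toU x) (toU y).
Proof.
apply/esym/toU_eq; set x' := repr _; set y' := repr _.
have -> : x' * y' - x * y = 1 * (x' - x) * y' + x * (y' - y) * 1.
  by rewrite mul1r mulr1 mulrBl mulrBr addrA subrK.
by apply: idealD; apply: idealM; apply: repr_toU.
Qed.

Lemma toUZ c x : toU (c *: x) = Uscale c (toU x).
Proof. by apply/esym/toU_eq; rewrite -scalerBr; apply/idealZ/repr_toU. Qed.

Lemma toU_theta x : toU (ftheta x) = theta (toU x).
Proof.
apply/esym/toU_eq; rewrite -[X in ideal X]linearB; apply: ideal_theta.
exact: repr_toU.
Qed.

Let U1 : Uq := toU 1.

Lemma UmulA : associative Umul.
Proof.
by elim/toUP=> x; elim/toUP=> y; elim/toUP=> z; rewrite -!toUM mulrA.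
Qed.

Lemma Umul1l : left_id U1 Umul.
Proof. by elim/toUP=> x; rewrite -toUM mul1r. Qed.

Lemma Umul1r : right_id U1 Umul.
Proof. by elim/toUP=> x; rewrite -toUM mulr1. Qed.

Lemma UmulDl : left_distributive Umul +%R.
Proof.
elim/toUP=> x; elim/toUP=> y; elim/toUP=> z.
by rewrite -toUD -!toUM -toUD mulrDl.
Qed.

Lemma UmulDr : right_distributive Umul +%R.
Proof.
elim/toUP=> x; elim/toUP=> y; elim/toUP=> z.
by rewrite -toUD -!toUM -toUD mulrDr.
Qed.

Lemma U1_neq0 : U1 != 0.
Proof.
apply/eqP; have -> : (0 : Uq) = toU 0 by rewrite /toU !piE.
by move/toU_eq; rewrite subr0; apply: ideal1.
Qed.

HB.instance Definition _ := GRing.Zmodule_isNzRing.Build Uq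
  UmulA Umul1l Umul1r UmulDl UmulDr U1_neq0.

Lemma UscaleA c d u : Uscale c (Uscale d u) = Uscale (c * d) u.
Proof. by elim/toUP: u => x; rewrite -!toUZ scalerA. Qed.

Lemma Uscale1 : left_id 1 Uscale.
Proof. by elim/toUP=> x; rewrite -toUZ scale1r. Qed.

Lemma UscaleDr : right_distributive Uscale +%R.
Proof.
move=> c; elim/toUP=> x; elim/toUP=> y.
by rewrite -toUD -!toUZ -toUD scalerDr.
Qed.

Lemma UscaleDl u : {morph Uscale^~ u : c d / c + d}.
Proof. by elim/toUP: u => x c d; rewrite -!toUZ -toUD scalerDl. Qed.

HB.instance Definition _ := GRing.Zmodule_isLmodule.Build F Uq
  UscaleA Uscale1 UscaleDr UscaleDl.

Lemma UscaleAl c (u v : Uq) : c *: (u * v) = (c *: u) * v.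
Proof.
elim/toUP: u => x; elim/toUP: v => y.
by rewrite /GRing.scale /GRing.mul /= -!(toUM, toUZ) scalerAl.
Qed.

HB.instance Definition _ := GRing.Lmodule_isLalgebra.Build F Uq UscaleAl.

Lemma UscaleAr c (u v : Uq) : c *: (u * v) = u * (c *: v).
Proof.
elim/toUP: u => x; elim/toUP: v => y.
by rewrite /GRing.scale /GRing.mul /= -!(toUM, toUZ) malg_scalerAr.
Qed.

HB.instance Definition _ := GRing.Lalgebra_isAlgebra.Build F Uq UscaleAr.

Lemma toU_is_linear : linear toU.
Proof. by move=> c x y; rewrite toUD toUZ. Qed.

Lemma toU_is_morph : monoid_morphism toU.
Proof. by split; last exact: toUM. Qed.

HB.instance Definition _ :=
  GRing.isLinear.Build F falg Uq *:%R toU toU_is_linear.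
HB.instance Definition _ :=
  GRing.isMonoidMorphism.Build falg Uq toU toU_is_morph.

Lemma theta_is_linear : linear theta.
Proof.
move=> c; elim/toUP=> x; elim/toUP=> y.
rewrite -[X in theta X]linearP -!toU_theta [ftheta _]lextD lextZ.
exact: linearP.
Qed.

Lemma theta_is_morph : monoid_morphism theta.
Proof.
split.
  have -> : (1 : Uq) = toU 1 by rewrite rmorph1.
  by rewrite -toU_theta ftheta_morph.1.
elim/toUP=> x; elim/toUP=> y.
by rewrite -rmorphM -!toU_theta fthetaM rmorphM.
Qed.

HB.instance Definition _ :=
  GRing.isLinear.Build F Uq Uq *:%R theta theta_is_linear.
HB.instance Definition _ :=
  GRing.isMonoidMorphism.Build Uq Uq theta theta_is_morph.

Definition Ugen (g : gen) : Uq := toU (fgen g).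

Lemma theta_gen g : theta (Ugen g) = (-1) ^+ gpar g *: Ugen g.
Proof. by rewrite -toU_theta ftheta_gen linearZ. Qed.

Lemma Urel x : relator x -> toU x = 0.
Proof.
move=> hx; have -> : (0 : Uq) = toU 0 by rewrite linear0.
apply/toU_eq; rewrite subr0 -[x]mulr1 -[x]mul1r; exact: ideal_rel.
Qed.

End FreeAlgebra.

Section RMatrix.
Variables (k : nat) (F : numFieldType) (qh : F).

Notation label := (label k).
Notation gen := (gen k).
Notation word := (word k).
Notation idx := (idx k).
Notation U := (Uq k qh).
Notation mxU := 'M[U]_k.*2.+2.
Notation falg2 := {malg F[(word * word)%type]}.

Definition Ue (c : label) : U := Ugen qh (gE c).
Definition Uh (c : label) : U := Ugen qh (gH c).
Definition UK (c : label) : U := Ugen qh (gK c).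
Definition UKi (c : label) : U := Ugen qh (gKi c).

(* The subalgebra generated by the e_c and the Cartan elements; it is closed
   under the coproduct and the antipode. *)
Inductive Uplus : U -> Prop :=
| Uplus_e c : Uplus (Ue c)
| Uplus_h c : Uplus (Uh c)
| Uplus_K c : Uplus (UK c)
| Uplus_Ki c : Uplus (UKi c)
| Uplus1 : Uplus 1
| UplusD u v of Uplus u & Uplus v : Uplus (u + v)
| UplusM u v of Uplus u & Uplus v : Uplus (u * v)
| UplusZ (x : F) u of Uplus u : Uplus (x *: u).

Definition has_parity (p : bool) (u : U) : Prop := theta u = (-1) ^+ p *: u.

Definition has_weight (lambda : wgt k) (u : U) : Prop :=
  forall c, Uh c * u - u * Uh c = (form (alpha c) lambda)%:~R *: u.

(* q^(m h_c / 2) and q^(h_lambda). *)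
Definition UKpow (c : label) (m : int) : U :=
  match m with Posz p => UK c ^+ p | Negz p => UKi c ^+ p.+1 end.

Definition Uqh (lambda : wgt k) : U :=
  \prod_(c : label) UKpow c (halfcoef lambda c).

Notation E a b := (delta_mx a b : 'M[F]_k.*2.+2).

Definition pi_gen (g : gen) : 'M[F]_k.*2.+2 :=
  match g with
  | gE (inl m) =>
      E (od m.+1) (od m.+2) + E (bar (od m.+2)) (bar (od m.+1))
  | gF (inl m) =>
      E (od m.+2) (od m.+1) + E (bar (od m.+1)) (bar (od m.+2))
  | gE (inr false) =>
      E (od k) (ev 1) + (-1) ^+ k *: E (bar (ev 1)) (bar (od k))
  | gF (inr false) =>
      - E (ev 1) (od k) + (-1) ^+ k *: E (bar (od k)) (bar (ev 1))
  | gE (inr true) =>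
      E (od k) (bar (ev 1)) + (-1) ^+ k *: E (ev 1) (bar (od k))
  | gF (inr true) =>
      - E (bar (ev 1)) (od k) + (-1) ^+ k *: E (bar (od k)) (ev 1)
  | gH c => \sum_a (form (alpha c) (eps a))%:~R *: E a a
  | gK c => \sum_a hpow qh (form (alpha c) (eps a)) *: E a a
  | gKi c => \sum_a hpow qh (- form (alpha c) (eps a)) *: E a a
  end.

Definition pi_word (w : seq gen) : 'M[F]_k.*2.+2 := \prod_(g <- w) pi_gen g.

(* The matrix (x_ab) over U stands for \sum_(a, b) E^a_b (x) x_ab in the graded
   tensor product (End V) (x) U, where
   (E^a_b (x) x) (E^b_d (x) y) = (-1)^([x]([b] + [d])) E^a_d (x) xy. *)
Definition gtens (M : 'M[F]_k.*2.+2) (u : U) : mxU :=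
  \matrix_(a, b) (M a b *: u).

Definition gmul (X Y : mxU) : mxU :=
  \matrix_(a, d) \sum_b
    (if par b (+) par d then theta (X a b) else X a b) * Y b d.

Definition pi_id (x : falg2) : mxU :=
  \sum_(p <- msupp x) gtens (x@_p *: pi_word p.1) (toU qh << p.2 >>).

Definition cartan_factor : mxU := \sum_a gtens (E a a) (Uqh (eps a)).

Definition Rmx (sigma : idx -> idx -> U) : mxU :=
  gmul cartan_factor
    (gtens 1%:M 1 +
     \sum_b \sum_(a | wgt_gt b a)
       gtens (((qpow qh 1 - qpow qh (-1)) * (-1) ^+ par b) *: E a b)
             (sigma b a)).

Definition admissible (sigma : idx -> idx -> U) : Prop :=
  forall b a, wgt_gt b a ->
    [/\ Uplus (sigma b a), has_parity (par a (+) par b) (sigma b a) &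
        has_weight (eps b - eps a) (sigma b a)].

Definition has_form (R : mxU) : Prop :=
  exists2 sigma, admissible sigma & R = Rmx sigma.

Definition intertwines (R : mxU) : Prop :=
  forall c, gmul R (pi_id (Delta (fgen F (gE c)))) =
            gmul (pi_id (twist (Delta (fgen F (gE c))))) R.

Definition simple_values (sigma : idx -> idx -> U) : Prop :=
  [/\ forall m : 'I_k.-1,
        sigma (od m.+1) (od m.+2) = hpow qh (-1) *: (Ue (inl m) * UK (inl m)) /\
        sigma (bar (od m.+2)) (bar (od m.+1)) =
          hpow qh (-1) *: (Ue (inl m) * UK (inl m)),
      sigma (od k) (ev 1) = hpow qh 1 *: (Ue lab_s * UK lab_s) /\
      ((-1) ^+ k * qpow qh 1) *: sigma (bar (ev 1)) (bar (od k)) =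
        hpow qh 1 *: (Ue lab_s * UK lab_s),
      sigma (od k) (bar (ev 1)) = hpow qh 1 *: (Ue lab_t * UK lab_t) /\
      ((-1) ^+ k * qpow qh 1) *: sigma (ev 1) (bar (od k)) =
        hpow qh 1 *: (Ue lab_t * UK lab_t) &
      sigma (ev 1) (bar (ev 1)) = 0].

Definition q_commutation (sigma : idx -> idx -> U) : Prop :=
  forall (b a : idx) (c : label), wgt_gt b a ->
    (forall x : idx, eps a - alpha c != eps x) ->
    (forall x : idx, eps b + alpha c != eps x) ->
    qpow qh (form (alpha c) (eps b)) *: (sigma b a * Ue c * UK c) -
    ((-1) ^+ ((par a (+) par b) && lpar c) *
       qpow qh (- form (alpha c) (eps a))) *:
      (Ue c * UK c * sigma b a) = 0.

Definition induction_relations (sigma : idx -> idx -> U) : Prop :=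
  forall b c a : idx, wgt_gt b c -> wgt_gt c a -> c != bar b -> c != bar a ->
    sigma b a =
      qpow qh (- form (eps b) (eps a)) *: (sigma b c * sigma c a) -
      (qpow qh (- form (eps c) (eps c)) *
         (-1) ^+ ((par b (+) par c) && (par a (+) par c))) *:
        (sigma c a * sigma b c).

Lemma pi_idE (x : falg2) a b :
  pi_id x a b =
  lext (fun p : word * word => pi_word p.1 a b *: toU qh << p.2 >>) x.
Proof.
rewrite /pi_id summxE; apply: eq_bigr => p _.
by rewrite !mxE scalerA.
Qed.

Lemma pi_id_tens2 (x : falg2) (u v u' v' : word) :
  x = tens F u v + tens F u' v' ->
  pi_id x = gtens (pi_word u) (toU qh << v >>) +
            gtens (pi_word u') (toU qh << v' >>).
Proof.
move=> ->; apply/matrixP => a b; rewrite pi_idE [LHS]lextD [RHS]mxE.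
by congr (_ + _); rewrite [LHS]lext1 mxE.
Qed.

Lemma pi_word_gen g : pi_word (wgen g) = pi_gen g.
Proof. by rewrite /pi_word fmU big_seq1. Qed.

Lemma pi_id_Delta c :
  pi_id (Delta (fgen F (gE c))) =
  gtens (pi_gen (gK c)) (Ue c) + gtens (pi_gen (gE c)) (UKi c).
Proof.
have D : Delta (fgen F (gE c)) = tens F (wgen (gK c)) (wgen (gE c)) +
    tens F (wgen (gE c)) (wgen (gKi c)) by exact: Delta_gen_word.
by rewrite (pi_id_tens2 D) !pi_word_gen.
Qed.

Lemma pi_id_DeltaT c :
  pi_id (twist (Delta (fgen F (gE c)))) =
  gtens (pi_gen (gE c)) (UK c) + gtens (pi_gen (gKi c)) (Ue c).
Proof.
rewrite (_ : twist _ = tens F (wgen (gE c)) (wgen (gK c)) +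
                       tens F (wgen (gKi c)) (wgen (gE c))).
  by rewrite (pi_id_tens2 erefl) !pi_word_gen.
rewrite Delta_gen_word [LHS]lextD; congr (_ + _); rewrite [LHS]lext1.
  by rewrite wpar_gen; apply: scale1r.
by rewrite [wpar _ in X in _ && X]wpar_gen andbF; apply: scale1r.
Qed.

End RMatrix.

(* Main.v *)
(* Write q = qh^2, E_c = e_c q^(h_c/2) and R_ab = q^(h_(eps_a)) N_ab, so that N
   is lower unitriangular with entries (q - q^-1) (-1)^[b] sigma_ba below the
   diagonal.  For every nonzero entry (a, j) of pi(e_c) (an edge), the
   intertwining property expresses the row j of N through the row a and E_c.

   Existence: the property says that, up to a scalar, N_j = T_c N_a for an
   operator T_c on rows, a sum of three operators (right multiplication by E_c,
   pi(e_c), left multiplication by E_c) each of which satisfies the q-Serre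
   relations and which commute with one another up to the braiding.  Hence the
   T_c satisfy the q-Serre relations too, and the first row (1, 0, .., 0), for
   the weight delta_1, is annihilated by enough of them to generate a copy of
   the vector representation; the images of the first row are the rows of N.

   The simple values and the q-commutation relations are entries of the
   intertwining property.  The induction relation for (b, c, a) follows by
   induction on a - b: an edge a' -> a, or b -> b', along which c is not moved
   carries the relation for (b, c, a'), or (b', c, a), to the one for (b, c, a).

   Uniqueness: the first row of R is forced and the others follow along the
   edges.  The simple values and the induction relations determine all the
   sigma_ba, as every pair b < a which is not simple has an admissible c. *)

(* The intertwining property concerns every pair of a row [a] and a label [c], also when row [a] of
   pi(e_c) is zero. Defining the rows along one path of weights settles the edges on that path; what
   is left is that [T_c] kills [N_a] when [c] has no edge out of [a], and that the two ways from
   delta_k through the even weights to -delta_k give the same row. The cubic relations give the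
   first, the extra ones give the rest. For k = 1 there is no extra relation, and the square is
   computed by hand on the first row.

   The obstacle is that the sign and the power of q in the left multiplication by [E_c] depend on
   the weight of the entry, while the Serre relations need operators on all rows. Conjugation by
   [K_c] squared, combined with the parity automorphism for odd [c], produces the same scalar on
   weight vectors and is linear everywhere.

   In the induction relations the delicate case is an edge whose mirror image under bar has the same
   label and touches the other end of the pair: an additional instance of the relation then enters.

   The inequalities used for q are that q, q + 1/q and q - 1/q are nonzero. *)
Require Import Defs.
From mathcomp Require Import all_boot all_order all_algebra.
From mathcomp Require Import zify ring.
From mathcomp.multinomials Require Import monalg.
Import Defs.

Set Implicit Arguments.
Unset Strict Implicit.
Unset Printing Implicit Defensive.

Import GRing.Theory Num.Theory.
Local Open Scope ring_scope.

(** * Linear arithmetic in a module *)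

(** Reified module expressions. The scalars are not reified: they remain terms of [F], so that the
    coefficients of the atoms can be left to [ring] or [field]. *)
Inductive lexp (F : Type) :=
| LAtom of nat | LZero | LAdd of lexp F & lexp F | LOpp of lexp F
| LScale of F & lexp F.
Arguments LAtom {F}.
Arguments LZero {F}.

Fixpoint leval (F : fieldType) (V : lmodType F) (env : seq V) (e : lexp F) : V :=
  match e with
  | LAtom i => nth 0 env i
  | LZero => 0
  | LAdd a b => leval env a + leval env b
  | LOpp a => - leval env a
  | LScale c a => c *: leval env a
  end.

Fixpoint lcoef (F : fieldType) (e : lexp F) (j : nat) : F :=
  match e with
  | LAtom i => if eqn i j then 1 else 0
  | LZero => 0
  | LAdd a b => lcoef a j + lcoef b j
  | LOpp a => - lcoef a j
  | LScale c a => c * lcoef a j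
  end.

(** Recursion on [n] instead of a quantifier over [j]: on a concrete expression it computes to one
    scalar equation per atom. *)
Fixpoint lcoef0 (F : fieldType) (e : lexp F) (n : nat) : Prop :=
  if n is n'.+1 then lcoef0 e n' /\ lcoef e n' = 0 else True.

Lemma leval_sum (F : fieldType) (V : lmodType F) (env : seq V) (e : lexp F) :
  leval env e = \sum_(j < size env) lcoef e j *: env`_j.
Proof.
elim: e => [i||a IHa b IHb|a IH|c a IH] /=.
- have [lt_i|le_i] := ltnP i (size env); last first.
    rewrite nth_default // big1 // => j _.
    case: eqnP => [ij|_]; last by rewrite scale0r.
    by have := ltn_ord j; rewrite -ij ltnNge le_i.
  rewrite (bigD1 (Ordinal lt_i)) //= big1 => [|j ji].
    by rewrite (introT eqnP erefl) scale1r addr0.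
  case: eqnP => [ij|_]; last by rewrite scale0r.
  by rewrite -val_eqE /= ij eqxx in ji.
- by rewrite big1 // => j _; rewrite scale0r.
- by rewrite IHa IHb -big_split; apply: eq_bigr => j _; rewrite scalerDl.
- by rewrite IH -sumrN; apply: eq_bigr => j _; rewrite scaleNr.
- by rewrite IH scaler_sumr; apply: eq_bigr => j _; rewrite scalerA.
Qed.

Lemma leval_eq0 (F : fieldType) (V : lmodType F) (env : seq V) (e : lexp F) :
  lcoef0 e (size env) -> leval env e = 0.
Proof.
rewrite leval_sum; elim: (size env) => [|n IH] /=; first by rewrite big_ord0.
by case=> /IH h c0; rewrite big_ord_recr /= h c0 scale0r addr0.
Qed.

Ltac lfind x env :=
  match env with
  | ?y :: _ => let _ := match goal with _ => unify x y end in constr:(O)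
  | _ :: ?t => let n := lfind x t in constr:(S n)
  end.
Ltac latoms env t :=
  lazymatch t with
  | (?a + ?b)%R => let e := latoms env a in latoms e b
  | (- ?a)%R => latoms env a
  | (_ *: ?a)%R => latoms env a
  | 0%R => env
  | _ => match env with
         | _ => let _ := lfind t env in env
         | _ => constr:(t :: env)
         end
  end.
Ltac lreify F env t :=
  lazymatch t with
  | (?a + ?b)%R =>
      let x := lreify F env a in let y := lreify F env b in
      constr:(@LAdd F x y)
  | (- ?a)%R => let x := lreify F env a in constr:(@LOpp F x)
  | (?c *: ?a)%R => let x := lreify F env a in constr:(@LScale F c x)
  | 0%R => constr:(@LZero F)
  | _ => let n := lfind t env in constr:(@LAtom F n)
  end.
(* Reduces an equality in an F-module to the equalities of the coefficients
   of the atoms. *)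
Ltac lmod F :=
  apply/eqP; rewrite -subr_eq0; apply/eqP;
  lazymatch goal with
  | |- @eq ?T ?t _ =>
      let env := latoms (@nil T) t in
      let e := lreify F env t in
      change (leval env e = 0); apply: leval_eq0;
      cbn [lcoef0 lcoef size eqn]; repeat split
  end.

(** * Indices and weights *)

Section Form.
Variable k : nat.
Implicit Types u v w : wgt k.

Lemma formC u v : form u v = form v u.
Proof.
by rewrite /form mulrC; congr (_ - _); apply: eq_bigr => j _; rewrite mulrC.
Qed.

Lemma formDl u v w : form (u + v) w = form u w + form v w.
Proof.
rewrite /form mxE mulrDl addrACA -opprD -big_split; congr (_ + _ - _).
by apply: eq_bigr => j _; rewrite mxE mulrDl.
Qed.

Lemma formZl (a : int) u v : form (a *: u) v = a * form u v.
Proof.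
rewrite /form mxE -mulrA mulrBr mulr_sumr; congr (_ - _).
by apply: eq_bigr => j _; rewrite mxE mulrA.
Qed.

Lemma formNl u v : form (- u) v = - form u v.
Proof. by rewrite -scaleN1r formZl mulN1r. Qed.

Lemma formDr u v w : form u (v + w) = form u v + form u w.
Proof. by rewrite formC formDl !(formC u). Qed.

Lemma formNr u v : form u (- v) = - form u v.
Proof. by rewrite formC formNl formC. Qed.

Lemma form0l v : form 0 v = 0.
Proof. by rewrite -(addrN 0) formDl formNl addrN. Qed.

Lemma form_delta (i j : 'I_k.+1) : form (delta_mx 0 i) (delta_mx 0 j : wgt k) =
  (i == j)%:R * (-1) ^+ (i < k)%N.
Proof.
have ek : (i == ord_max) = ~~ (i < k)%N.
  by rewrite -val_eqE /=; have := ltn_ord i; lia.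
rewrite /form !mxE eqxx /= (eq_sym ord_max) (eq_sym ord_max) ek.
have [-> | nij] := eqVneq i j.
  have [jk | kj] := ltnP j k; last first.
    rewrite big1 => [|h hk]; first by rewrite -val_eqE /=; have := ltn_ord j; lia.
    by rewrite !mxE /= -val_eqE /=; case: eqP => [|_]; [lia | rewrite mul0r].
  rewrite (bigD1 j) //= big1 => [|h /andP[_ hj]].
    by rewrite !mxE !eqxx /=; case: (j == _); lia.
  by rewrite !mxE /= (negPf hj) mul0r.
rewrite big1 => [|h _].
  case: ltnP => h; rewrite ?mul0r //= mul1r subr0; apply/eqP.
  rewrite pnatr_eq0 eqb0; apply: contraNneq nij => ->.
  by rewrite -val_eqE /=; have := ltn_ord i; lia.
rewrite !mxE /=; case: eqVneq => [->|_]; last by rewrite mul0r.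
by rewrite (negPf nij) mulr0.
Qed.

End Form.

Section Indices.
Variable k : nat.
Hypothesis k_gt0 : (0 < k)%N.
Implicit Types (a b : idx k) (c d : label k).

Lemma val_bar a : bar a = (k.*2.+1 - a)%N :> nat.
Proof. by rewrite /= subSS. Qed.

Lemma barK : involutive (@bar k).
Proof. exact: rev_ordK. Qed.

Lemma bar_inj : injective (@bar k).
Proof. exact: inv_inj barK. Qed.

Lemma bar_eq a b : (bar a == b) = (a == bar b).
Proof. by rewrite -(inj_eq bar_inj) barK. Qed.

Lemma val_ev2 : (ev 2 : idx k) = k.+1 :> nat.
Proof. by rewrite inordK /=; lia. Qed.

Lemma bar_ev1 : bar (ev 1 : idx k) = ev 2.
Proof. by apply: ord_inj; rewrite val_bar val_ev1 val_ev2; lia. Qed.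

Lemma parE a : par a = (a != k :> nat) && (a != k.+1 :> nat).
Proof. by rewrite /par -!(inj_eq (@ord_inj _)) val_ev1 val_ev2. Qed.

Lemma par_bar a : par (bar a) = par a.
Proof. by rewrite !parE val_bar; have := ltn_ord a; lia. Qed.

(** Only the upper half, where [eps] is a coordinate vector, needs a computation; the rest follows
    from [eps (bar a) = - eps a]. *)
Lemma form_eps a b : form (eps a) (eps b) =
  (-1) ^+ par a * ((a == b)%:R - (a == bar b)%:R).
Proof.
have low (x y : idx k) : (x <= k)%N -> (y <= k)%N ->
    form (eps x) (eps y) = (-1) ^+ par x * ((x == y)%:R - (x == bar y)%:R).
  move=> xk yk; rewrite /eps xk yk form_delta.
  have -> : (x == bar y) = false.
    by apply/eqP => e; have := val_bar y; rewrite -e; lia.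
  have -> : (inord x == inord y :> 'I_k.+1) = (x == y).
    by rewrite -val_eqE /= !inordK.
  rewrite subr0 mulrC inordK //; congr ((-1) ^+ nat_of_bool _ * _).
  by rewrite parE; lia.
have epsN x : eps x = - eps (bar x) :> wgt k by rewrite eps_bar opprK.
have lowbar (x : idx k) : (k < x)%N -> (bar x <= k)%N by rewrite val_bar; lia.
have [ak | ka] := leqP a k; have [bk | kb] := leqP b k.
- exact: low.
- by rewrite (epsN b) formNr low ?lowbar // -mulrN opprB barK.
- by rewrite (epsN a) formNl low ?lowbar // par_bar -mulrN opprB !bar_eq barK.
- rewrite (epsN a) (epsN b) formNl formNr opprK low ?lowbar // par_bar.
  by rewrite !bar_eq !barK.
Qed.

(** The matrix of [e_c] has two nonzero entries, [(src c, dst c)] and its mirror image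
    [(bar (dst c), bar (src c))]; in both, the row weight minus the column weight is [alpha c]. *)
Definition src c : idx k :=
  match c with inl m => od m.+1 | inr _ => od k end.
Definition dst c : idx k :=
  match c with inl m => od m.+2 | inr false => ev 1 | inr true => bar (ev 1) end.

Lemma val_src c :
  src c = match c with inl m => m : nat | inr _ => k.-1 end :> nat.
Proof.
by case: c => [m|b]; rewrite /= val_od //; have := k_gt0; try have := ltn_ord m; lia.
Qed.

Lemma val_dst c : dst c =
  match c with inl m => m.+1 | inr false => k | inr true => k.+1 end :> nat.
Proof.
case: c => [m|[]].
- by rewrite /= val_od //; have := ltn_ord m; lia.
- by rewrite [dst _]bar_ev1 val_ev2.
- exact: val_ev1.
Qed.

Lemma alphaE c : alpha c = eps (src c) - eps (dst c).
Proof. by case: c => [m|[]] //=; rewrite eps_bar opprK. Qed.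

Lemma src_lt_dst c : (src c < dst c)%N.
Proof.
rewrite val_src val_dst; case: c => [m|[]]; have := k_gt0; lia.
Qed.

Lemma par_src c : par (src c).
Proof.
by rewrite parE val_src; case: c => [m|b]; have := k_gt0; try have := ltn_ord m; lia.
Qed.

Lemma par_dst c : par (dst c) = ~~ lpar c.
Proof.
by rewrite parE val_dst; case: c => [m|[]] /=; try have := ltn_ord m; lia.
Qed.

Lemma form_alpha_eps c b : form (alpha c) (eps b) =
  (bar (src c) == b)%:R - (src c == b)%:R +
  (-1) ^+ lpar c * ((dst c == b)%:R - (bar (dst c) == b)%:R).
Proof.
rewrite alphaE formDl formNl !form_eps par_src par_dst.
rewrite !bar_eq.
by case: lpar => /=; ring.
Qed.

Lemma form_alpha c d : form (alpha c) (alpha d) =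
  form (alpha c) (eps (src d)) - form (alpha c) (eps (dst d)).
Proof. by rewrite [alpha d]alphaE formDr formNr. Qed.

Ltac idx_lia :=
  rewrite -!(inj_eq (@ord_inj _)) !(val_bar, val_src, val_dst) /=;
  repeat (case: eqP => ?; first [by exfalso; lia | idtac]);
  rewrite ?natz /=; lia.

(** The form is negative on the deltas, so the signs are opposite to the usual ones of type A:
    adjacent roots pair to [1], and [form = 1] is the adjacency condition in the cubic relations. *)
Lemma form_inl (m m' : 'I_k.-1) :
  form (alpha (inl m)) (alpha (inl m' : label k)) =
  if m == m' :> nat then -2 else ((m.+1 == m' :> nat) || (m'.+1 == m :> nat))%:R.
Proof.
have hm := ltn_ord m; have hm' := ltn_ord m'.
rewrite form_alpha !form_alpha_eps.
case: ifP; idx_lia.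
Qed.

Lemma form_adj (m m' : 'I_k.-1) :
  (m.+1 == m' :> nat) || (m'.+1 == m :> nat) ->
  form (alpha (inl m)) (alpha (inl m' : label k)) = 1.
Proof. by move=> mm'; rewrite form_inl mm' ifF //; lia. Qed.

Lemma form_far (m m' : 'I_k.-1) :
  m != m' :> nat -> m.+1 != m' :> nat -> m'.+1 != m :> nat ->
  form (alpha (inl m)) (alpha (inl m' : label k)) = 0.
Proof. by rewrite form_inl => /negPf-> /negPf-> /negPf->. Qed.

Lemma form_inlr (m : 'I_k.-1) (b : bool) :
  form (alpha (inl m)) (alpha (inr b : label k)) = (m.+2 == k :> nat)%:R.
Proof.
have hm := ltn_ord m; rewrite form_alpha !form_alpha_eps.
case: b; idx_lia.
Qed.

Lemma form_inr (b b' : bool) :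
  form (alpha (inr b)) (alpha (inr b' : label k)) = if b == b' then 0 else -2.
Proof.
rewrite form_alpha !form_alpha_eps.
case: b; case: b'; idx_lia.
Qed.

Lemma form_alpha_src c : form (alpha c) (eps (src c)) = -1.
Proof.
rewrite form_alpha_eps; case: c => [m|[]]; try have hm := ltn_ord m; idx_lia.
Qed.

Lemma form_alpha_dst c : form (alpha c) (eps (dst c)) = (-1) ^+ lpar c.
Proof.
rewrite form_alpha_eps; case: c => [m|[]]; try have hm := ltn_ord m; idx_lia.
Qed.

Lemma form_eps_bar (u : wgt k) a : form u (eps (bar a)) = - form u (eps a).
Proof. by rewrite eps_bar formNr. Qed.

Lemma form_alpha_other c b : b != src c -> b != dst c -> b != bar (src c) ->
  b != bar (dst c) -> form (alpha c) (eps b) = 0.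
Proof.
rewrite form_alpha_eps 4!(eq_sym b) => /negPf-> /negPf-> /negPf-> /negPf->.
by case: lpar.
Qed.

End Indices.

(** * Families of operators satisfying the Serre relations *)

Section LinearFunction.
Variables (F : fieldType) (U V : lmodType F) (f : U -> V).
Hypothesis flin : linear f.

Lemma linearfD u v : f (u + v) = f u + f v.
Proof. by have := flin 1 u v; rewrite !scale1r. Qed.

Lemma linearf0 : f 0 = 0.
Proof. by apply: (addIr (f 0)); rewrite -linearfD !add0r. Qed.

Lemma linearfZ a u : f (a *: u) = a *: f u.
Proof. by have := flin a u 0; rewrite !addr0 linearf0 addr0. Qed.

End LinearFunction.

Section Serre.
Variables (k : nat) (F : numFieldType) (q : F).
Hypotheses (k_gt0 : (0 < k)%N) (q0 : q != 0).

(* The last clause is the common form of the three extra relations, which are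
   proportional to one another. *)
Definition serre (M : lmodType F) (X : label k -> M -> M) : Prop :=
  [/\ forall (m : 'I_k.-1) c v, form (alpha (inl m)) (alpha c) = 0 ->
        X (inl m) (X c v) = X c (X (inl m) v),
      forall (m : 'I_k.-1) c v, form (alpha (inl m)) (alpha c) = 1 ->
        X (inl m) (X (inl m) (X c v)) -
        (q + q^-1) *: X (inl m) (X c (X (inl m) v)) +
        X c (X (inl m) (X (inl m) v)) = 0,
      forall b v, X (inr b) (X (inr b) v) = 0 &
      forall (m : 'I_k.-1) v, m.+2 = k ->
        X (inl m) (X lab_s (X lab_t v)) - X (inl m) (X lab_t (X lab_s v)) +
        X lab_s (X lab_t (X (inl m) v)) - X lab_t (X lab_s (X (inl m) v)) -
        (q + q^-1) *: (X lab_s (X (inl m) (X lab_t v)) -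
                       X lab_t (X (inl m) (X lab_s v))) = 0].

(** The super sign times the power of [q] by which generators of weights [alpha c] and [alpha d] are
    exchanged in a braided tensor product. *)
Definition braid (c d : label k) : F :=
  (-1) ^+ (lpar c && lpar d) * q ^ form (alpha c) (alpha d).

Lemma braidC c d : braid c d = braid d c.
Proof. by rewrite /braid andbC formC. Qed.

Lemma braid_m m c :
  braid (inl m) c = q ^ form (alpha (inl m)) (alpha c).
Proof. by rewrite /braid mul1r. Qed.

(* A sum of two Serre families which commute up to the braiding is again one:
   this is what makes the coproduct compatible with the Serre relations. *)
Lemma serre_sum (M : lmodType F) (X Y Z : label k -> M -> M) :
  (forall c, linear (X c)) -> (forall c, linear (Y c)) ->
  serre X -> serre Y ->
  (forall c d v, X c (Y d v) = braid c d *: Y d (X c v)) ->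
  (forall c v, Z c v = X c v + Y c v) -> serre Z.
Proof.
move=> Xlin Ylin [X1 X2 X3 X4] [Y1 Y2 Y3 Y4] XY Zdef.
have q1 : q ^ (1 : int) = q by rewrite expr1z.
have qm2 : q ^ (-2 : int) = q^-1 * q^-1.
  by rewrite -[-2]/(- (2%:Z)) -exprnN expr2 invfM.
have wmm (m : 'I_k.-1) : braid (inl m) (inl m) = q^-1 * q^-1.
  by rewrite braid_m form_inl // eqxx.
have wst : braid lab_s lab_t = - (q^-1 * q^-1).
  by rewrite /braid form_inr // qm2 /= expr1 mulN1r.
have wts : braid lab_t lab_s = - (q^-1 * q^-1) by rewrite braidC.
have XD c := linearfD (Xlin c); have XZ c := linearfZ (Xlin c).
have YD c := linearfD (Ylin c); have YZ c := linearfZ (Ylin c).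
have Z2 c d v : Z c (Z d v) =
    X c (X d v) + braid c d *: Y d (X c v) + Y c (X d v) + Y c (Y d v).
  by rewrite !Zdef XD YD XY !addrA.
(* Each of the eight words is brought to the form with every [Y] outside every [X]. *)
have Z3 b c d v : Z b (Z c (Z d v)) =
    X b (X c (X d v)) +
    (braid b d * braid c d) *: Y d (X b (X c v)) +
    braid b c *: Y c (X b (X d v)) + Y b (X c (X d v)) +
    (braid b c * braid b d) *: Y c (Y d (X b v)) +
    braid c d *: Y b (Y d (X c v)) + Y b (Y c (X d v)) + Y b (Y c (Y d v)).
  rewrite [LHS]Zdef Z2 !XD !YD !XZ !YZ !XY !YZ !scalerA.
  by lmod F; ring.
split.
- move=> m c v mc0.
  have w1 : braid (inl m) c = 1 by rewrite braid_m mc0 expr0z.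
  rewrite !Z2 [braid c _]braidC w1 X1 // Y1 // !scale1r.
  by lmod F; ring.
- move=> m c v mc1.
  have w1 : braid (inl m) c = q by rewrite braid_m mc1.
  rewrite !Z3 [braid c _]braidC w1 wmm.
  (* One zero is the relation for [X], the other the one for [Y]. The mixed words remain, and their
     coefficients vanish for the braiding scalars [q] and [q^-2]. *)
  transitivity (0 + 0 : M); last by rewrite addr0.
  rewrite -{1}(X2 m c v mc1) -(Y2 m c v mc1).
  by lmod F; field.
- move=> b v; have w1 : braid (inr b) (inr b) = -1.
    by rewrite /braid form_inr // eqxx andbb expr0z mulr1.
  by rewrite Z2 w1 X3 Y3; lmod F; ring.
- move=> m v mk.
  have wm b : braid (inl m) (inr b) = q by rewrite braid_m form_inlr // mk eqxx.
  have wm' b : braid (inr b) (inl m) = q by rewrite braidC.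
  rewrite !Z3 /lab_s /lab_t !wm !wm' wst wts.
  transitivity (0 + 0 : M); last by rewrite addr0.
  rewrite -{1}(X4 m v mk) -(Y4 m v mk) /lab_s /lab_t.
  by lmod F; field.
Qed.

Section SerreVanishing.
Variables (M : lmodType F) (T : label k -> M -> M).
Hypotheses (Tlin : forall c, linear (T c)) (Tserre : serre T).
Hypothesis q2 : q + q^-1 != 0.

Lemma serre_kill_mmc (m : 'I_k.-1) c v :
  form (alpha (inl m)) (alpha c) = 1 -> T (inl m) v = 0 ->
  T (inl m) (T (inl m) (T c v)) = 0.
Proof.
have T0 c' : T c' 0 = 0 by apply: linearf0.
case: Tserre => _ S2 _ _ mc1 v0; have := S2 m c v mc1.
by rewrite v0 !T0 scaler0 subr0 addr0.
Qed.

(** Here the middle term is the one that survives, and its coefficient [q + q^-1] has to be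
    cancelled. *)
Lemma serre_kill_mcm (m : 'I_k.-1) c v :
  form (alpha (inl m)) (alpha c) = 1 -> T c v = 0 ->
  T (inl m) (T (inl m) v) = 0 -> T (inl m) (T c (T (inl m) v)) = 0.
Proof.
have T0 c' : T c' 0 = 0 by apply: linearf0.
case: Tserre => _ S2 _ _ mc1 v0 v1; have := S2 m c v mc1.
rewrite v0 v1 !T0 sub0r addr0 => /eqP.
by rewrite oppr_eq0 scaler_eq0 (negPf q2) => /eqP.
Qed.

Lemma serre_comm0 (m : 'I_k.-1) c v :
  form (alpha (inl m)) (alpha c) = 0 -> T c v = 0 -> T c (T (inl m) v) = 0.
Proof.
by case: Tserre => S1 _ _ _ mc0 v0; rewrite -S1 // v0; apply: linearf0.
Qed.

Lemma serre_comm0' (m : 'I_k.-1) c v :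
  form (alpha (inl m)) (alpha c) = 0 -> T (inl m) v = 0 ->
  T (inl m) (T c v) = 0.
Proof.
by case: Tserre => S1 _ _ _ mc0 v0; rewrite S1 // v0; apply: linearf0.
Qed.

(** Five of the six words in the extra relation contain one of the three vanishing vectors; the
    sixth has coefficient [q + q^-1] up to sign. *)
Lemma serre_kill_bmb (m : 'I_k.-1) b v : m.+2 = k ->
  T (inl m) v = 0 -> T (inr b) v = 0 -> T (inr b) (T (inr (~~ b)) v) = 0 ->
  T (inr b) (T (inl m) (T (inr (~~ b)) v)) = 0.
Proof.
have T0 c' : T c' 0 = 0 by apply: linearf0.
case: Tserre => _ _ _ S4 mk m0 b0 bb0; have := S4 m v mk.
rewrite /lab_s /lab_t; case: b b0 bb0 => /= -> ->; rewrite m0 !T0 => /eqP;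
  rewrite ?(addr0, subr0, sub0r, add0r) oppr_eq0 scaler_eq0 (negPf q2) ?oppr_eq0.
all: by move/eqP.
Qed.

End SerreVanishing.

(** * The vector representation as a cyclic module *)

Section Path.
Variables (M : lmodType F) (T : label k -> M -> M).
Hypotheses (Tlin : forall c, linear (T c)) (Tserre : serre T).
Hypothesis q2 : q + q^-1 != 0.
Variables (h z : F) (r0 : M).
Hypotheses (h0 : h != 0) (zz : z * z = 1).
Hypothesis r0_src : forall c, src c != 0%N :> nat -> T c r0 = 0.
Hypothesis r0_sq : forall m : 'I_k.-1, m = 0%N :> nat ->
  T (inl m) (T (inl m) r0) = 0.
Hypothesis r0_st : k = 1%N -> T lab_s (T lab_t r0) = T lab_t (T lab_s r0).

Let T0 c : T c 0 = 0.
Proof. exact: linearf0. Qed.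
Let TZ c a v : T c (a *: v) = a *: T c v.
Proof. exact: linearfZ. Qed.

(** The default [lab_s] is a filler: the rows in use only involve [j < k.-1]. *)
Definition chain (j : nat) : label k :=
  if insub j is Some m then inl m else lab_s.

Lemma chain_inl (m : 'I_k.-1) : chain m = inl m.
Proof. by rewrite /chain valK. Qed.

Fixpoint upper (j : nat) : M :=
  if j is i.+1 then h^-1 *: T (chain i) (upper i) else r0.

Let v := upper k.-1.
Let w := T lab_t (T lab_s v).

Fixpoint lower (i : nat) : M :=
  if i is j.+1 then h^-1 *: T (chain (k.-2 - j)) (lower j) else z *: w.

(** The normalisations are forced: an edge of [e_c] into the weight [eps b] must contribute its
    matrix entry times [h] to the power [(alpha_c, eps b)], which is [-1] for the steps into the two
    even weights and [1] for all others. The sign [z] is the entry of pi(e_t) on the step into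
    -delta_k. *)
Definition pathrow (a : idx k) : M :=
  if (a < k)%N then upper a
  else if a == k :> nat then h *: T lab_s v
  else if a == k.+1 :> nat then h *: T lab_t v
  else lower (a - k.+2).

(** The new row is the image of row [j] under the even label [j]. Labels orthogonal to it commute
    with it. The label [j] itself and the label [j - 1] are covered by the two consequences of the
    cubic relation, once row [j] is in turn written as an image of row [j - 1]. *)
Lemma upper_kill j c : (j < k)%N -> src c != j :> nat -> T c (upper j) = 0.
Proof.
elim/ltn_ind: j c => -[|j] IH c jk; first exact: r0_src.
have jk1 : (j < k.-1)%N by lia.
rewrite val_src // => cj; rewrite /= TZ (_ : chain j = inl (Ordinal jk1)); last first.
  exact: (chain_inl (Ordinal jk1)).
set o := Ordinal jk1; have oE : o = j :> nat by [].
apply/eqP; rewrite scaler_eq0; apply/orP; right; apply/eqP.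
have far c' : form (alpha (inl o)) (alpha c') = 0 -> src c' != j :> nat ->
    T c' (T (inl o) (upper j)) = 0.
  by move=> f0 hc'; apply: serre_comm0 => //; apply: IH => //; lia.
case: c cj => [m|b] cj; last first.
  by apply: far; rewrite ?form_inlr ?val_src //; move: cj; lia.
have [mj|mj] := eqVneq (m : nat) j.
  have -> : m = o by apply: ord_inj.
  (* The first row is not an image of an earlier one, so its square has to be a hypothesis. *)
  case: (posnP j) => [j0|j_gt0].
    by rewrite [in upper _]j0; apply: r0_sq.
  have jk2 : (j.-1 < k.-1)%N by lia.
  have -> : upper j = h^-1 *: T (inl (Ordinal jk2)) (upper j.-1).
    by rewrite -(chain_inl (Ordinal jk2)) /= -{1}(prednK j_gt0).
  rewrite !TZ serre_kill_mmc ?scaler0 //.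
    by apply: form_adj => //=; lia.
  by apply: IH; rewrite ?val_src //=; lia.
have [mj1|mj1] := eqVneq m.+1 j.
  have -> : upper j = h^-1 *: T (inl m) (upper m).
    by rewrite -mj1 /= chain_inl.
  rewrite !TZ serre_kill_mcm ?scaler0 //.
  - by apply: form_adj => //=; lia.
  - by apply: IH; rewrite ?val_src //=; lia.
  have : T (inl m) (upper m.+1) = 0 by apply: IH; rewrite ?val_src //=; lia.
  rewrite /= chain_inl TZ => /eqP; rewrite scaler_eq0 invr_eq0 (negPf h0).
  by move/eqP.
by apply: far; rewrite ?val_src //; apply: form_far => //=; move: cj mj mj1; lia.
Qed.

Let v_kill (m : 'I_k.-1) : T (inl m) v = 0.
Proof. by apply: upper_kill; rewrite ?val_src //; have := ltn_ord m; lia. Qed.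

Let v_last (m : 'I_k.-1) : m.+2 = k -> v = h^-1 *: T (inl m) (upper m).
Proof. by move=> mk; rewrite /v -{1}mk /= chain_inl. Qed.

Lemma middle_kill (m : 'I_k.-1) b : T (inl m) (T (inr b) v) = 0.
Proof.
have [mk|mk] := eqVneq m.+2 k; last first.
  by apply: serre_comm0' => //; rewrite form_inlr // (negPf mk).
have u0 b' : T (inr b') (upper m) = 0.
  by apply: upper_kill; rewrite ?val_src //=; lia.
rewrite (v_last mk) !TZ serre_kill_mcm ?scaler0 //.
  by rewrite form_inlr // mk eqxx.
have := v_kill m; rewrite (v_last mk) TZ => /eqP.
by rewrite scaler_eq0 invr_eq0 (negPf h0) => /eqP.
Qed.

(** The square from delta_k through the even weights to -delta_k. For [k > 1] this is the extra
    relation on the row of delta_(k-1), where all its other words vanish; for [k = 1] no such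
    relation exists, hence [r0_st]. *)
Lemma middle_st : T lab_s (T lab_t v) = T lab_t (T lab_s v).
Proof.
have [k1|k1] := eqVneq k 1%N.
  by rewrite /v (_ : k.-1 = 0%N) ?k1 //; apply: r0_st.
have mk : (k.-2 < k.-1)%N by lia.
pose m := Ordinal mk; have mE : m.+2 = k by rewrite /=; lia.
have u0 b' : T (inr b') (upper m) = 0.
  by apply: upper_kill; rewrite ?val_src //=; lia.
case: Tserre => _ _ _ /(_ m (upper m) mE).
rewrite /lab_s /lab_t !u0 !T0 !subr0 scaler0 subr0 add0r => /eqP.
by rewrite subr_eq0 (v_last mE) !TZ => /eqP ->.
Qed.

Let w_b b : T (inr b) w = 0.
Proof.
case: Tserre => _ _ S3 _; rewrite /w; case: b; first exact: S3.
by rewrite -middle_st; apply: S3.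
Qed.

Let w_m (m : 'I_k.-1) : m.+2 != k -> T (inl m) w = 0.
Proof.
move=> mk; rewrite /w /lab_t; apply: serre_comm0' => //; last exact: middle_kill.
by rewrite form_inlr // (negPf mk).
Qed.

Let w_mm (m : 'I_k.-1) : m.+2 = k -> T (inl m) (T (inl m) w) = 0.
Proof.
move=> mk; apply: serre_kill_mmc => //; last exact: middle_kill.
by rewrite form_inlr // mk eqxx.
Qed.

(** The extra relation is used on [T (inr b) v], which both [inl m] and [inr b] kill, and which the
    other odd label sends to [w]. *)
Let w_bm (m : 'I_k.-1) b : m.+2 = k -> T (inr b) (T (inl m) w) = 0.
Proof.
move=> mk; have S3 : T (inr b) (T (inr b) v) = 0 by case: Tserre => _ _ S3 _.
have wE : T (inr (~~ b)) (T (inr b) v) = w.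
  by case: b {S3}; rewrite ?middle_st.
rewrite -wE; apply: serre_kill_bmb => //; first exact: middle_kill.
by rewrite wE; apply: w_b.
Qed.

Let lower_step (m : 'I_k.-1) i : (m + i.+2)%N = k ->
  lower i.+1 = h^-1 *: T (inl m) (lower i).
Proof.
by move=> mi; rewrite /= (_ : (k.-2 - i)%N = m); [rewrite chain_inl | lia].
Qed.

(** Mirror image of [upper_kill]. The first two rows are separate: their vanishing rests on the
    facts about [w], which involve the odd labels. *)
Lemma lower_kill i c : (i < k)%N ->
  (forall m : 'I_k.-1, c = inl m -> (m + i.+2)%N != k) -> T c (lower i) = 0.
Proof.
elim/ltn_ind: i c => -[|i] IH c ik hc.
  rewrite /= TZ; case: c hc => [m|b] hc; last by rewrite w_b scaler0.
  by rewrite w_m ?scaler0 //; have := hc m erefl; lia.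
have jk : (k.-2 - i < k.-1)%N by lia.
pose j := Ordinal jk; have jE : (j + i.+2)%N = k by rewrite /=; lia.
rewrite (lower_step jE) TZ.
apply/eqP; rewrite scaler_eq0; apply/orP; right; apply/eqP.
case: i IH ik hc jk @j jE => [|i] IH ik hc jk j jE.
  have jE2 : j.+2 = k by lia.
  rewrite /= !TZ; case: c hc => [m|b] hc; last by rewrite w_bm ?scaler0.
  have [mj|mj] := eqVneq (m : nat) j.
    by rewrite (_ : m = j) ?w_mm ?scaler0 //; apply: ord_inj.
  rewrite serre_comm0 ?scaler0 //; last by apply: w_m; lia.
  by apply: form_far; have := hc m erefl; have := ltn_ord m; lia.
have j1k : (j.+1 < k.-1)%N by lia.
pose j' := Ordinal j1k.
have kill c' : (forall m : 'I_k.-1, c' = inl m -> m != j) -> T c' (lower i.+1) = 0.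
  move=> hc'; apply: IH => //; first lia.
  by move=> m /hc'; rewrite -(inj_eq (@ord_inj _)); lia.
have kill_j : T (inl j) (lower i) = 0.
  by apply: IH => [||m [<-]]; lia.
have step : lower i.+1 = h^-1 *: T (inl j') (lower i).
  by apply: lower_step; rewrite /=; lia.
case: c hc => [m|b] hc; last first.
  apply: serre_comm0 => //; last exact: kill.
  by rewrite form_inlr //; case: eqP => //; lia.
have {}hc := hc m erefl.
have [mj|mj] := eqVneq (m : nat) j.
  rewrite (_ : m = j); last exact: ord_inj.
  by rewrite step !TZ serre_kill_mmc ?scaler0 //; apply: form_adj => /=; lia.
have [mj1|mj1] := eqVneq (m : nat) j.+1.
  rewrite (_ : m = j'); last exact: ord_inj.
  rewrite step !TZ serre_kill_mcm ?scaler0 //.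
    by apply: form_adj => /=; lia.
  have : T (inl j') (lower i.+1) = 0.
    by apply: kill => m' [<-]; rewrite -(inj_eq (@ord_inj _)) /=; lia.
  by rewrite step TZ => /eqP; rewrite scaler_eq0 invr_eq0 (negPf h0) => /eqP.
apply: serre_comm0 => //; first by apply: form_far => //; lia.
apply: kill => m' [<-]; rewrite -(inj_eq (@ord_inj _)); exact: mj.
Qed.

Lemma pathrow_src c : T c (pathrow (src c)) =
  (if lpar c then h^-1 else h) *: pathrow (dst c).
Proof.
rewrite /pathrow val_src // val_dst //; case: c => [m|[]] /=.
- have mk := ltn_ord m; rewrite !ifT; [|lia..].
  by rewrite chain_inl scalerA divff // scale1r.
- rewrite ifT ?ltnNge ?leqnSn ?leqnn /=; last lia.
  by rewrite ifN ?eqxx ?scalerA ?mulVf ?scale1r //; lia.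
- rewrite ifT; last lia.
  by rewrite ltnn eqxx scalerA mulVf // scale1r.
Qed.

Lemma pathrow_bar c : T c (pathrow (bar (dst c))) =
  ((if lpar c then z else 1) * h) *: pathrow (bar (src c)).
Proof.
rewrite /pathrow !val_bar val_src // val_dst //; case: c => [m|b].
  have mk := ltn_ord m; rewrite !ifN; [|lia..].
  rewrite (_ : (k.*2.+1 - m - k.+2)%N = (k - m.+2).+1); last lia.
  rewrite (@lower_step m); last lia.
  rewrite (_ : (k.*2.+1 - m.+1 - k.+2)%N = (k - m.+2)%N); last lia.
  by rewrite /= scalerA mulfK // scale1r.
rewrite (_ : (k.*2.+1 - k.-1)%N = k.+2); last lia.
rewrite [in RHS]ifN; last lia.
rewrite [in RHS]ifN; last lia.
rewrite [in RHS]ifN; last lia.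
rewrite subnn; case: b.
  rewrite (_ : (k.*2.+1 - k.+1)%N = k); last lia.
  by rewrite ltnn eqxx TZ scalerA mulrAC zz mul1r.
rewrite (_ : (k.*2.+1 - k)%N = k.+1); last lia.
have -> : (k.+1 < k)%N = false by lia.
have -> : (k.+1 == k) = false by lia.
by rewrite eqxx TZ middle_st scalerA mulrAC zz mul1r.
Qed.

Lemma pathrow_kill c a : a != src c -> a != bar (dst c) -> T c (pathrow a) = 0.
Proof.
rewrite -!(inj_eq (@ord_inj _)) val_bar val_dst // val_src // => a1 a2.
have ak := ltn_ord a; rewrite /pathrow; case: ltnP => ka.
  by apply: upper_kill; rewrite // val_src // eq_sym.
have S3 b := let: And4 _ _ S3 _ := Tserre in S3 b v.
case: eqP => ak0.
  rewrite TZ; case: c a1 a2 => [m|[]] a1 a2; rewrite ?middle_kill ?scaler0 //.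
    by exfalso; lia.
  by rewrite S3 scaler0.
case: eqP => ak1.
  rewrite TZ; case: c a1 a2 => [m|[]] a1 a2; rewrite ?middle_kill ?scaler0 //.
    by rewrite S3 scaler0.
  by exfalso; lia.
apply: lower_kill; first lia.
by move=> m cm; rewrite cm in a1 a2; lia.
Qed.

End Path.
End Serre.

(** * Powers of q, weight vectors and q-commutators *)

Section Powers.
Variables (F : numFieldType) (qh : F).
Hypothesis qh0 : qh != 0.

Lemma hpowD m n : hpow qh (m + n) = hpow qh m * hpow qh n.
Proof. exact: expfzDr. Qed.

Lemma hpow0 : hpow qh 0 = 1. Proof. exact: expr0z. Qed.
Lemma hpow1 : hpow qh 1 = qh. Proof. exact: expr1z. Qed.
Lemma hpowN m : hpow qh (- m) = (hpow qh m)^-1.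
Proof. by rewrite /hpow invr_expz. Qed.
Lemma hpow_neq0 m : hpow qh m != 0. Proof. exact: expfz_neq0. Qed.
Lemma qpow_hpow m : qpow qh m = hpow qh m * hpow qh m.
Proof. by rewrite /qpow mulr2n mulrDl mul1r -hpowD. Qed.
Lemma qpowD m n : qpow qh (m + n) = qpow qh m * qpow qh n.
Proof. by rewrite /qpow mulrDr; apply: expfzDr. Qed.
Lemma qpow0 : qpow qh 0 = 1. Proof. by rewrite qpow_hpow hpow0 mulr1. Qed.
Lemma qpowN m : qpow qh (- m) = (qpow qh m)^-1.
Proof. by rewrite /qpow mulrN invr_expz. Qed.
Lemma qpow_neq0 m : qpow qh m != 0. Proof. exact: expfz_neq0. Qed.
Lemma qpow_exp m : qpow qh m = qpow qh 1 ^ m.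
Proof. by rewrite /qpow mulr1 exprz_exp. Qed.
Lemma qpow1 : qpow qh 1 = qh * qh.
Proof. by rewrite qpow_hpow hpow1. Qed.

End Powers.

Section Weights.
Variables (k : nat) (F : numFieldType) (qh : F) (A : algType F).
Variables (K : label k -> A) (th : A -> A).
Hypotheses (qh0 : qh != 0) (thlin : linear th) (thM : {morph th : u v / u * v}).

(* Weight vectors of parity p for the conjugation by the q^(h_c/2). *)
Definition khom (beta : wgt k) (p : bool) (u : A) : Prop :=
  th u = (-1) ^+ p *: u /\
  forall c, K c * u = hpow qh (form (alpha c) beta) *: (u * K c).

Lemma khomM beta gamma p p' u v :
  khom beta p u -> khom gamma p' v -> khom (beta + gamma) (p (+) p') (u * v).
Proof.
move=> [up uK] [vp vK]; split=> [|c].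
  rewrite thM up vp -scalerAr -scalerAl scalerA signr_addb; congr (_ *: _).
  exact: mulrC.
rewrite mulrA uK -scalerAl -[u * K c * v]mulrA vK -scalerAr scalerA mulrA.
by rewrite formDr hpowD.
Qed.

Lemma khomZ beta p a u : khom beta p u -> khom beta p (a *: u).
Proof.
move=> [up uK]; split=> [|c].
  rewrite (linearfZ thlin) up !scalerA; congr (_ *: _); exact: mulrC.
by rewrite -scalerAr uK -scalerAl !scalerA; congr (_ *: _); apply: mulrC.
Qed.

Lemma khomD beta p u v : khom beta p u -> khom beta p v -> khom beta p (u + v).
Proof.
move=> [up uK] [vp vK]; split=> [|c].
  by rewrite (linearfD thlin) up vp scalerDr.
by rewrite mulrDr uK vK mulrDl scalerDr.
Qed.

Lemma khomN beta p u : khom beta p u -> khom beta p (- u).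
Proof. by move=> h; rewrite -scaleN1r; apply: khomZ. Qed.

(** The left side has the shape in which [ad_bigE] gives the adjoint action. On a weight vector the
    Cartan elements cancel, and the factor [q^(-(alpha_c, alpha_c)/2)] of the antipode is absorbed
    by moving [K c] past [e c]; a q-commutator is left. *)
Lemma ad_khom (Ki e : label k -> A) c beta p u :
  K c * Ki c = 1 -> Ki c * K c = 1 -> khom (alpha c) (lpar c) (e c) ->
  khom beta p u ->
  e c * K c * u * (Ki c * K c) +
  K c * K c * ((-1) ^+ (lpar c && p) *: u) *
    (Ki c * (- hpow qh (- form (alpha c) (alpha c)) *: e c)) =
  e c * K c * u - ((-1) ^+ (lpar c && p) * qpow qh (form (alpha c) beta)) *:
    (u * (e c * K c)).
Proof.
move=> KKi KiK [_ eK] [_ uK]; rewrite KiK mulr1; congr (_ + _).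
have KKu : K c * K c * u = qpow qh (form (alpha c) beta) *: (u * K c * K c).
  by rewrite -mulrA uK -scalerAr mulrA uK -scalerAl scalerA -qpow_hpow.
have KKe : K c * (Ki c * (- hpow qh (- form (alpha c) (alpha c)) *: e c)) =
    - hpow qh (- form (alpha c) (alpha c)) *: e c by rewrite mulrA KKi mul1r.
rewrite -[_ * (_ *: u)]scalerAr KKu scalerA -scalerAl -[u * K c * K c * _]mulrA.
rewrite KKe -[u * K c * _]mulrA -[K c * (_ *: _)]scalerAr eK -scaleNr.
rewrite scalerA -[u * (_ *: _)]scalerAr scalerA; congr (_ *: _).
by rewrite mulNr hpowN // mulVf ?hpow_neq0 // mulrN1.
Qed.

End Weights.

Section AlgebraIdentities.
Variables (F : numFieldType) (A : algType F) (q : F).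
Hypothesis q0 : q != 0.

Lemma scaled_comm (x y : A) : x * y - (1 : F) *: (y * x) = 0 -> x * y = y * x.
Proof. by rewrite scale1r => /eqP; rewrite subr_eq0 => /eqP. Qed.

(** The graded commutator of an odd element with itself is twice its square, and [2] is invertible
    in [F]. *)
Lemma sq_eq0_of_opp (x : A) : x * x = (-1) ^+ true *: (x * x) -> x * x = 0.
Proof.
rewrite scaleN1r => /eqP; rewrite -subr_eq0 opprK -mulr2n -scaler_nat.
by rewrite scaler_eq0 pnatr_eq0 => /eqP.
Qed.

Lemma mul_sq_eq0 (x y : A) (a : F) :
  y * x = a *: (x * y) -> x * x = 0 -> (x * y) * (x * y) = 0.
Proof.
move=> yx xx; rewrite -mulrA [y * _]mulrA yx -!scalerAl -scalerAr !mulrA xx.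
by rewrite !mul0r scaler0.
Qed.

Lemma comm_mul (x y v : A) : x * y = y * x -> x * (y * v) = y * (x * v).
Proof. by rewrite !mulrA => ->. Qed.

Lemma sq_mul (x v : A) : x * x = 0 -> x * (x * v) = 0.
Proof. by rewrite mulrA => ->; rewrite mul0r. Qed.

(** The coefficients [q] and [q^-1] are the powers for [(alpha_m, alpha_c) = 1] and
    [(alpha_m, alpha_m + alpha_c) = -1]; expanding the nested q-commutator gives the middle
    coefficient [q + q^-1]. *)
Lemma cubic_serre (x y v : A) :
  x * (x * y - q *: (y * x)) - q^-1 *: ((x * y - q *: (y * x)) * x) = 0 ->
  x * (x * (y * v)) - (q + q^-1) *: (x * (y * (x * v))) + y * (x * (x * v)) = 0.
Proof.
move=> h; have {h}: (x * (x * y - q *: (y * x)) -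
    q^-1 *: ((x * y - q *: (y * x)) * x)) * v = 0 by rewrite h mul0r.
rewrite !(mulrBl, mulrBr) -!(scalerAl, scalerAr) -!mulrA => <-.
rewrite !(mulrBl, mulrBr) -!(scalerAl, scalerAr) -!mulrA.
by lmod F; field.
Qed.

(** The coefficients are super signs times powers of [q]: [-q^-2] for the pair s, t, [q] for m, t,
    [q^2] for m against s + t, and [-q^-1] for s against m + t. After expansion they combine to the
    symmetric form required by [serre]. *)
Lemma extra_serre (m s t v : A) :
  let st := s * t - (- (q^-1 * q^-1)) *: (t * s) in
  let mt := m * t - q *: (t * m) in
  m * st - (q * q) *: (st * m) -
  (q + q^-1) *: (s * mt - (- q^-1) *: (mt * s)) = 0 ->
  m * (s * (t * v)) - m * (t * (s * v)) + s * (t * (m * v)) -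
  t * (s * (m * v)) -
  (q + q^-1) *: (s * (m * (t * v)) - t * (m * (s * v))) = 0.
Proof.
move=> st mt h; have {h}: (m * st - (q * q) *: (st * m) -
  (q + q^-1) *: (s * mt - (- q^-1) *: (mt * s))) * v = 0 by rewrite h mul0r.
rewrite /st /mt => <-.
do 3!rewrite ?(mulrBl, mulrBr) -?(scalerAl, scalerAr).
rewrite -!mulrA.
by lmod F; field.
Qed.

End AlgebraIdentities.

Section Morphism.
Variables (F : numFieldType) (B : lalgType F) (A : algType F) (f : B -> A).
Hypotheses (fD : forall x y, f (x + y) = f x + f y).
Hypotheses (fM : forall x y, f (x * y) = f x * f y).
Hypotheses (fZ : forall a x, f (a *: x) = a *: f x).

Lemma morphB x y : f (x - y) = f x - f y.
Proof. by rewrite fD -scaleN1r fZ scaleN1r. Qed.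

Lemma morph_eqM (x y z w : B) a :
  f (x * y - a *: (z * w)) = 0 -> f x * f y = a *: (f z * f w).
Proof. by rewrite morphB fZ !fM => /eqP; rewrite subr_eq0 => /eqP. Qed.

Lemma morph_eqM1 (x y : B) : f 1 = 1 -> f (x * y - 1) = 0 -> f x * f y = 1.
Proof. by move=> f1; rewrite morphB f1 fM => /eqP; rewrite subr_eq0 => /eqP. Qed.

Lemma morphBZ (x y : B) u v a :
  f x = u -> f y = v -> f (x - a *: y) = 0 -> u - a *: v = 0.
Proof. by rewrite morphB fZ => -> ->. Qed.

Lemma morph_adshape (x1 x2 x3 x4 x5 y1 y2 y3 y4 y5 : B) a :
  f (x1 * x2 * x3 * (x4 * x5) + y1 * y2 * y3 * (y4 * (a *: y5))) =
  f x1 * f x2 * f x3 * (f x4 * f x5) + f y1 * f y2 * f y3 * (f y4 * (a *: f y5)).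
Proof. by rewrite fD !fM fZ. Qed.

End Morphism.

(** * The Serre relations in U_q[osp(2|n)] *)

Section Quantum.
Variables (k : nat) (F : numFieldType) (qh : F).
Hypotheses (k_gt0 : (0 < k)%N) (qh0 : qh != 0).

Notation label := (label k).
Notation U := (Uq k qh).
Notation K := (@UK k F qh).
Notation Ki := (@UKi k F qh).
Notation e := (@Ue k F qh).
Notation khom := (@khom k F qh (Uq k qh) (@UK k F qh) (@theta k F qh)).

Lemma toU_D (x y : {malg F[word k]}) : toU qh (x + y) = toU qh x + toU qh y.
Proof. exact: toUD. Qed.
Lemma toU_M (x y : {malg F[word k]}) : toU qh (x * y) = toU qh x * toU qh y.
Proof. exact: toUM. Qed.
Lemma toU_Z a (x : {malg F[word k]}) : toU qh (a *: x) = a *: toU qh x.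
Proof. exact: toUZ. Qed.
Lemma toU_1 : toU qh (1 : {malg F[word k]}) = 1.
Proof. by []. Qed.

Lemma theta_lin : linear (@theta k F qh).
Proof. exact: theta_is_linear. Qed.
Lemma theta_mul : {morph @theta k F qh : u v / u * v}.
Proof. exact: (@theta_is_morph k F qh).2. Qed.

Definition toU_eqM := @morph_eqM F {malg F[word k]} U (toU qh) toU_D toU_M toU_Z.

Lemma toU_eqM1 (x y : {malg F[word k]}) :
  toU qh (x * y - 1) = 0 -> toU qh x * toU qh y = 1.
Proof. exact: (@morph_eqM1 F {malg F[word k]} U (toU qh) toU_D toU_M toU_Z _ _ toU_1). Qed.

Lemma UK_Ki c : K c * Ki c = 1.
Proof. exact: toU_eqM1 (Urel (rel_KKi qh c)). Qed.

Lemma UKi_K c : Ki c * K c = 1.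
Proof. exact: toU_eqM1 (Urel (rel_KiK qh c)). Qed.

Lemma UK_comm c d : K c * K d = K d * K c.
Proof. by rewrite (toU_eqM (Urel (rel_KK qh c d))) scale1r. Qed.

Lemma theta_e c : theta (e c) = (-1) ^+ lpar c *: e c.
Proof. exact: theta_gen. Qed.

Lemma theta_K c : theta (K c) = K c.
Proof. by rewrite [LHS]theta_gen scale1r. Qed.

Lemma theta_Ki c : theta (Ki c) = Ki c.
Proof. by rewrite [LHS]theta_gen scale1r. Qed.

Lemma khom_e c : khom (alpha c) (lpar c) (e c).
Proof.
split=> [|d]; first exact: theta_e.
exact: toU_eqM (Urel (rel_KE qh d c)).
Qed.

Lemma khom_K c : khom 0 false (K c).
Proof.
split=> [|d]; first by rewrite theta_K scale1r.
by rewrite formC form0l hpow0 scale1r UK_comm.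
Qed.

Definition UE c : U := e c * K c.
Notation E := UE.

Lemma khom_E c : khom (alpha c) (lpar c) (E c).
Proof.
rewrite -[alpha c]addr0 -[lpar c]addbF.
exact: (khomM qh0 theta_mul (khom_e c) (khom_K c)).
Qed.

(** The adjoint action of [E_c]. Parity and weight of [u] are arguments, as they cannot be read off
    from the element. *)
Definition adE c (p : bool) (beta : wgt k) (u : U) : U :=
  E c * u - ((-1) ^+ (lpar c && p) * qpow qh (form (alpha c) beta)) *:
    (u * E c).

Lemma adE_m (m : 'I_k.-1) p beta u : adE (inl m) p beta u =
  E (inl m) * u - qpow qh (form (alpha (inl m)) beta) *: (u * E (inl m)).
Proof. by rewrite /adE mul1r. Qed.

Lemma khom_adE c beta p u : khom beta p u ->
  khom (alpha c + beta) (lpar c (+) p) (adE c p beta u).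
Proof.
move=> hu; apply: (khomD theta_lin).
  exact: (khomM qh0 theta_mul (khom_E c) hu).
apply: (khomN theta_lin); apply: (khomZ theta_lin).
rewrite addrC addbC; exact: (khomM qh0 theta_mul hu (khom_E c)).
Qed.

Lemma toU_ad c (y : {malg F[word k]}) beta p : khom beta p (toU qh y) ->
  toU qh (ad qh (bigE F c) y) = adE c p beta (toU qh y).
Proof.
move=> hy; rewrite /adE -(ad_khom qh0 (UK_Ki c) (UKi_K c) (khom_e c) hy).
have sgnE : toU qh (fsgn (lpar c) y) = (-1) ^+ (lpar c && p) *: toU qh y.
  case: (lpar c); last by rewrite scale1r.
  by rewrite [LHS]toU_theta hy.1.
rewrite -sgnE; apply: etrans (congr1 _ (ad_bigE qh c y)) _.
exact: (@morph_adshape F {malg F[word k]} U (toU qh) toU_D toU_M toU_Z).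
Qed.

Lemma toU_bigE c : toU qh (bigE F c) = E c.
Proof. exact: toU_M. Qed.

Lemma khom_bigE c : khom (alpha c) (lpar c) (toU qh (bigE F c)).
Proof. by rewrite toU_bigE; apply: khom_E. Qed.

Lemma toU_ad2 c d : toU qh (ad qh (bigE F c) (bigE F d)) =
  adE c (lpar d) (alpha d) (E d).
Proof. by rewrite (toU_ad c (khom_bigE d)) toU_bigE. Qed.

Lemma toU_ad3 b c d : toU qh (ad qh (bigE F b) (ad qh (bigE F c) (bigE F d))) =
  adE b (lpar c (+) lpar d) (alpha c + alpha d)
    (adE c (lpar d) (alpha d) (E d)).
Proof.
have h : khom (alpha c + alpha d) (lpar c (+) lpar d)
    (toU qh (ad qh (bigE F c) (bigE F d))).
  by rewrite toU_ad2; apply: khom_adE; apply: khom_E.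
by rewrite (toU_ad b h) toU_ad2.
Qed.

Lemma form_mm (m : 'I_k.-1) : form (alpha (inl m)) (alpha (inl m : label)) = -2.
Proof. by rewrite form_inl // eqxx. Qed.

Lemma E_comm (m : 'I_k.-1) c : form (alpha (inl m)) (alpha c) = 0 ->
  E (inl m) * E c = E c * E (inl m).
Proof.
move=> mc0; have nc : inl m != c.
  by apply/eqP => mc; move: mc0; rewrite -mc form_mm.
have := Urel (rel_serreE qh nc _); rewrite form_mm => /(_ isT).
rewrite /serre_exp mc0 form_mm [iter _ _ _]/= toU_ad2 adE_m mc0 (qpow0 qh0).
exact: scaled_comm.
Qed.

Lemma E_serre (m : 'I_k.-1) c v : form (alpha (inl m)) (alpha c) = 1 ->
  E (inl m) * (E (inl m) * (E c * v)) -
  (qpow qh 1 + (qpow qh 1)^-1) *: (E (inl m) * (E c * (E (inl m) * v))) +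
  E c * (E (inl m) * (E (inl m) * v)) = 0.
Proof.
move=> mc1; have nc : inl m != c.
  by apply/eqP => mc; move: mc1; rewrite -mc form_mm.
apply: cubic_serre; first exact: qpow_neq0.
have := Urel (rel_serreE qh nc _); rewrite form_mm => /(_ isT).
rewrite /serre_exp mc1 form_mm [iter _ _ _]/= toU_ad3 !adE_m formDr mc1 form_mm.
have -> : -2 + 1 = - 1 :> int by [].
rewrite (qpowN qh 1); exact: id.
Qed.

Lemma E_sq b : E (inr b) * E (inr b) = 0.
Proof.
have f0 : form (alpha (inr b)) (alpha (inr b : label)) = 0.
  by rewrite form_inr // eqxx.
have := toU_eqM (Urel (rel_EE qh f0)); rewrite [lpar _]/= => /sq_eq0_of_opp ee.
exact: mul_sq_eq0 ((khom_e (inr b)).2 (inr b)) ee.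
Qed.

Lemma E_extra (m : 'I_k.-1) v : m.+2 = k ->
  E (inl m) * (E lab_s * (E lab_t * v)) - E (inl m) * (E lab_t * (E lab_s * v)) +
  E lab_s * (E lab_t * (E (inl m) * v)) - E lab_t * (E lab_s * (E (inl m) * v)) -
  (qpow qh 1 + (qpow qh 1)^-1) *:
    (E lab_s * (E (inl m) * (E lab_t * v)) -
     E lab_t * (E (inl m) * (E lab_s * v))) = 0.
Proof.
move=> mk; have fst' : form (alpha lab_s) (alpha (lab_t : label)) = -2.
  by rewrite /lab_s /lab_t form_inr.
have fm b : form (alpha (inl m)) (alpha (inr b : label)) = 1.
  by rewrite form_inlr // mk eqxx.
have h := @morphBZ F {malg F[word k]} U (toU qh) toU_D toU_Z _ _ _ _ _
  (toU_ad3 (inl m) lab_s lab_t) (toU_ad3 lab_s (inl m) lab_t)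
  (Urel (rel_yamaneE (yamane1 qh mk))).
have st : (-1) ^+ (lpar (lab_s : label) && lpar (lab_t : label)) *
    qpow qh (form (alpha (lab_s : label)) (alpha lab_t)) =
    - ((qpow qh 1)^-1 / qpow qh 1).
  rewrite fst' expr1 mulN1r -invfM -(qpowD qh0) -(qpowN qh); congr (- _).
have mst : (-1) ^+ (lpar (inl m) && (lpar (lab_s : label) (+) lpar (lab_t : label))) *
    qpow qh (form (alpha (inl m)) (alpha (lab_s : label) + alpha lab_t)) =
    qpow qh 1 * qpow qh 1.
  by rewrite mul1r formDr !fm -(qpowD qh0).
have mt : (-1) ^+ (lpar (inl m) && lpar (lab_t : label)) *
    qpow qh (form (alpha (inl m)) (alpha lab_t)) = qpow qh 1.
  by rewrite mul1r fm.
have smt : (-1) ^+ (lpar (lab_s : label) && (lpar (inl m) (+) lpar (lab_t : label))) *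
    qpow qh (form (alpha (lab_s : label)) (alpha (inl m) + alpha lab_t)) =
    - (qpow qh 1)^-1.
  rewrite expr1 mulN1r formDr fst' [form (alpha (lab_s : label)) (alpha (inl m))]formC fm.
  by rewrite -(qpowN qh); congr (- _).
apply: extra_serre; first exact: qpow_neq0.
by move: h; rewrite /adE st mst mt smt (qpowN qh 1).
Qed.

Lemma serre_E : serre (qpow qh 1) (fun c (v : U) => E c * v).
Proof.
split=> [m c v mc|m c v mc|b v|m v mk].
- exact: comm_mul (E_comm mc).
- exact: E_serre.
- exact: sq_mul (E_sq b).
- exact: E_extra.
Qed.

End Quantum.

(** * From relations between elements to relations between operators *)

Section SerreElements.
Variables (k : nat) (F : numFieldType) (q : F).

Definition serre_elements (B : algType F) (x : label k -> B) : Prop :=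
  [/\ forall (m : 'I_k.-1) c, form (alpha (inl m)) (alpha c) = 0 ->
        x (inl m) * x c = x c * x (inl m),
      forall (m : 'I_k.-1) c, form (alpha (inl m)) (alpha c) = 1 ->
        x (inl m) * x (inl m) * x c - (q + q^-1) *: (x (inl m) * x c * x (inl m))
          + x c * x (inl m) * x (inl m) = 0,
      forall b, x (inr b) * x (inr b) = 0 &
      forall m : 'I_k.-1, m.+2 = k ->
        x (inl m) * x lab_s * x lab_t - x (inl m) * x lab_t * x lab_s
        + x lab_s * x lab_t * x (inl m) - x lab_t * x lab_s * x (inl m)
        - (q + q^-1) *: (x lab_s * x (inl m) * x lab_t -
                         x lab_t * x (inl m) * x lab_s) = 0].

Lemma serre_elements_of (B : algType F) (x : label k -> B) :
  serre q (fun c v => x c * v) -> serre_elements x.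
Proof.
case=> h1 h2 h3 h4; split=> [m c mc|m c mc|b|m mk].
- by have := h1 m c 1 mc; rewrite !mulr1.
- by have := h2 m c 1 mc; rewrite !mulr1 !mulrA.
- by have := h3 b 1; rewrite mulr1.
- by have := h4 m 1 mk; rewrite !mulr1 !mulrA.
Qed.

Section Transport.
Variables (B : algType F) (x : label k -> B) (M : lmodType F).
Variables (X : label k -> M -> M).
Variables (f2 : label k -> label k -> M -> B -> M).
Variables (f3 : label k -> label k -> label k -> M -> B -> M).
Hypothesis xserre : serre_elements x.
Hypothesis f2lin : forall a b v, linear (f2 a b v).
Hypothesis f3lin : forall a b c v, linear (f3 a b c v).
Hypothesis f2C : forall a b v y, f2 a b v y = f2 b a v y.
Hypothesis f3C : forall a b c v y, f3 a b c v y = f3 b a c v y.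
Hypothesis f3C' : forall a b c v y, f3 a b c v y = f3 a c b v y.

(** Every word in the operators is a linear function of the same word in the elements. The function
    may depend on the labels, but symmetrically, so all words in one relation share it and linearity
    carries the relation over. *)
Lemma serre_transport :
  (forall a b v, X a (X b v) = f2 a b v (x a * x b)) ->
  (forall a b c v, X a (X b (X c v)) = f3 a b c v (x a * x b * x c)) ->
  serre q X.
Proof.
have f3D a b c v := linearfD (f3lin a b c v).
have f3Z a b c v := linearfZ (f3lin a b c v).
have f30 a b c v := linearf0 (f3lin a b c v).
have f3B a b c v y y' : f3 a b c v (y - y') = f3 a b c v y - f3 a b c v y'.
  by rewrite f3D -[- y']scaleN1r f3Z scaleN1r.
move=> X2 X3; case: xserre => h1 h2 h3 h4; split=> [m c v mc|m c v mc|b v|m v mk].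
- by rewrite !X2 h1 // f2C.
- rewrite !X3 [f3 (inl m) c _ _ _]f3C' [f3 c _ _ _ _]f3C [f3 _ c _ _ _]f3C'.
  by rewrite -f3Z -f3B -f3D h2.
- by rewrite X2 h3 (linearf0 (f2lin _ _ _)).
- set s := lab_s; set t := lab_t.
  rewrite !X3 [f3 _ t s _ _]f3C' [f3 s t _ _ _]f3C' ![f3 s _ t _ _]f3C.
  rewrite [f3 t s _ _ _]f3C' ![f3 t _ s _ _]f3C ![f3 _ t s _ _]f3C'.
  by rewrite -!f3B -f3D -!f3B -f3Z -f3B h4.
Qed.

(** For right multiplications, which reverse words. Reversal preserves the quadratic and cubic
    relations and changes the sign of the extra one. *)
Lemma serre_transport_rev :
  (forall a b v, X a (X b v) = f2 a b v (x b * x a)) ->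
  (forall a b c v, X a (X b (X c v)) = f3 a b c v (x c * x b * x a)) ->
  serre q X.
Proof.
have f3D a b c v := linearfD (f3lin a b c v).
have f3Z a b c v := linearfZ (f3lin a b c v).
have f30 a b c v := linearf0 (f3lin a b c v).
have f3B a b c v y y' : f3 a b c v (y - y') = f3 a b c v y - f3 a b c v y'.
  by rewrite f3D -[- y']scaleN1r f3Z scaleN1r.
move=> X2 X3; case: xserre => h1 h2 h3 h4; split=> [m c v mc|m c v mc|b v|m v mk].
- by rewrite !X2 h1 // f2C.
- rewrite !X3 [f3 (inl m) c _ _ _]f3C' [f3 c _ _ _ _]f3C [f3 _ c _ _ _]f3C'.
  rewrite -f3Z -f3B -f3D -(f30 (inl m) (inl m) c v) -(h2 m c mc).
  by congr (f3 _ _ _ _ _); lmod F; ring.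
- by rewrite X2 h3 (linearf0 (f2lin _ _ _)).
- set s := lab_s; set t := lab_t.
  rewrite !X3 [f3 _ t s _ _]f3C' [f3 s t _ _ _]f3C' ![f3 s _ t _ _]f3C.
  rewrite [f3 t s _ _ _]f3C' ![f3 t _ s _ _]f3C ![f3 _ t s _ _]f3C'.
  rewrite -!f3B -f3D -!f3B -f3Z -f3B -(f30 (inl m) s t v) -oppr0 -(h4 m mk).
  by congr (f3 _ _ _ _ _); rewrite -/s -/t; lmod F; ring.
Qed.

End Transport.
End SerreElements.

(** * The Serre relations for the matrices of the raising generators *)

Section VectorRep.
Variables (k : nat) (F : numFieldType) (qh : F).
Hypothesis k_gt0 : (0 < k)%N.

Notation label := (label k).
Notation idx := (idx k).
Notation D a b := (delta_mx a b : 'M[F]_k.*2.+2).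
Implicit Types (c d : label) (a : idx).

Definition pie (c : label) : 'M[F]_k.*2.+2 := pi_gen qh (gE c).
Definition sgk (c : label) : F := if lpar c then (-1) ^+ k else 1.

Lemma pieE c :
  pie c = D (src c) (dst c) + sgk c *: D (bar (dst c)) (bar (src c)).
Proof.
rewrite /pie /sgk; case: c => [m|[]] /=; first by rewrite scale1r.
- by rewrite barK.
- by [].
Qed.

Lemma pie_mul c d : pie c * pie d =
  D (src c) (dst d) *+ (dst c == src d) +
  sgk d *: (D (src c) (bar (src d)) *+ (dst c == bar (dst d))) +
  sgk c *: (D (bar (dst c)) (dst d) *+ (bar (src c) == src d)) +
  (sgk c * sgk d) *:
    (D (bar (dst c)) (bar (src d)) *+ (bar (src c) == bar (dst d))).
Proof.
rewrite !pieE mulrDl !mulrDr -!scalerAl -!scalerAr.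
by rewrite -!mulmxE !mul_delta_mx_cond !scalerA !addrA.
Qed.

Lemma bar_src_neq c d : (bar (src c) == src d) = false.
Proof.
apply/eqP => /(congr1 (@nat_of_ord _)); rewrite val_bar !val_src //.
by case: c => [m|b]; case: d => [m'|b'];
  try have := ltn_ord m; try have := ltn_ord m'; lia.
Qed.

Lemma pie_mul0 c d :
  dst c != src d -> src c != dst d -> dst c != bar (dst d) ->
  pie c * pie d = 0.
Proof.
move=> cd dc cd'; rewrite pie_mul (negPf cd) (negPf cd') bar_src_neq.
by rewrite (inj_eq (@bar_inj k)) (negPf dc) !scaler0 !addr0.
Qed.

Lemma pie_mul_up c d :
  dst c = src d -> src c != dst d -> dst c != bar (dst d) ->
  pie c * pie d = D (src c) (dst d).
Proof.
move=> /eqP cd dc cd'; rewrite pie_mul cd (negPf cd') bar_src_neq.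
by rewrite (inj_eq (@bar_inj k)) (negPf dc) !scaler0 !addr0.
Qed.

Lemma pie_mul_down c d :
  dst c != src d -> src c = dst d -> dst c != bar (dst d) ->
  pie c * pie d = (sgk c * sgk d) *: D (bar (dst c)) (bar (src d)).
Proof.
move=> cd /eqP dc cd'; rewrite pie_mul (negPf cd) (negPf cd') bar_src_neq.
by rewrite (inj_eq (@bar_inj k)) dc !scaler0 !add0r.
Qed.

Lemma delta_pie0 (a b : idx) c :
  b != src c -> b != bar (dst c) -> D a b * pie c = 0.
Proof.
move=> b1 b2; rewrite pieE mulrDr -scalerAr -!mulmxE !mul_delta_mx_cond.
by rewrite (negPf b1) (negPf b2) scaler0 addr0.
Qed.

Ltac idx_neq :=
  apply/eqP => /(congr1 (@nat_of_ord _));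
  rewrite ?val_bar ?val_ev1 ?val_dst // ?val_src //=; lia.

Lemma pie_far (m : 'I_k.-1) c : form (alpha (inl m)) (alpha c) = 0 ->
  pie (inl m) * pie c = 0 /\ pie c * pie (inl m) = 0.
Proof.
have hm := ltn_ord m.
case: c => [m'|b].
  have hm' := ltn_ord m'; rewrite form_inl //.
  case: eqP => // nmm /eqP; rewrite pnatr_eq0 eqb0 negb_or => /andP[m1 m2].
  by split; apply: pie_mul0; idx_neq.
rewrite form_inlr // => /eqP; rewrite pnatr_eq0 eqb0 => mk.
by split; apply: pie_mul0; case: b; idx_neq.
Qed.

Lemma pie_mm (m : 'I_k.-1) : pie (inl m) * pie (inl m) = 0.
Proof. by have hm := ltn_ord m; apply: pie_mul0; idx_neq. Qed.

Lemma pie_bb b : pie (inr b) * pie (inr b) = 0.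
Proof. by have hk := k_gt0; apply: pie_mul0; case: b; idx_neq. Qed.

Ltac idx_eq :=
  apply: ord_inj;
  rewrite ?val_bar ?val_ev1 ?val_dst // ?val_src //=; lia.

Lemma pie_mcm (m : 'I_k.-1) c : form (alpha (inl m)) (alpha c) = 1 ->
  pie (inl m) * pie c * pie (inl m) = 0.
Proof.
have hm := ltn_ord m.
case: c => [m'|b].
  have hm' := ltn_ord m'; rewrite form_inl //.
  case: eqP => // nmm; case: orP => // -[/eqP mm|/eqP mm] _.
    rewrite pie_mul_up; [|idx_eq|idx_neq|idx_neq].
    by apply: delta_pie0; idx_neq.
  rewrite pie_mul_down; [|idx_neq|idx_eq|idx_neq].
  by rewrite -scalerAl delta_pie0 ?scaler0 //; idx_neq.
rewrite form_inlr //; case: eqP => // mk _.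
by rewrite pie_mul_up ?delta_pie0 //; case: b; first [idx_eq | idx_neq].
Qed.

Lemma pie_bmb (m : 'I_k.-1) b b' : m.+2 = k ->
  pie (inr b) * pie (inl m) * pie (inr b') = 0.
Proof.
move=> mk; rewrite pie_mul_down -?scalerAl ?delta_pie0 ?scaler0 //.
all: by case: b; case: b'; first [idx_eq | idx_neq].
Qed.

Lemma pie_st : pie lab_s * pie lab_t = pie lab_t * pie lab_s.
Proof.
have hk := k_gt0; rewrite !pie_mul !bar_src_neq.
have n1 (b b' : bool) : (dst (inr b) == src (inr b' : label)) = false.
  by apply/negbTE; case: b; case: b'; idx_neq.
have n2 (b b' : bool) : (bar (src (inr b)) == bar (dst (inr b' : label))) = false.
  by rewrite (inj_eq (@bar_inj k)) eq_sym n1.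
rewrite /lab_s /lab_t !n1 !n2 /= barK !eqxx.
by [].
Qed.

(** True for every [q]: the words of each relation either vanish one by one or cancel in pairs
    because the matrices of s and t commute. *)
Lemma serre_pie q : serre_elements q pie.
Proof.
split=> [m c mc|m c mc|b|m mk].
- by have [-> ->] := pie_far mc.
- by rewrite pie_mm pie_mcm // -mulrA pie_mm mul0r mulr0 scaler0 subrr addr0.
- exact: pie_bb.
- rewrite pie_st -[_ * _ * pie lab_t]mulrA pie_st mulrA subrr add0r subrr.
  by rewrite /lab_s /lab_t !pie_bmb // subrr scaler0 subrr.
Qed.

Lemma pie_weight c (a b : idx) : pie c a b != 0 -> eps a - eps b = alpha c.
Proof.
rewrite pieE !mxE.
have [/andP[/eqP-> /eqP->] _|] := boolP ((a == src c) && (b == dst c)).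
  by rewrite alphaE.
have [/andP[/eqP-> /eqP->] _ _|_ _] :=
  boolP ((a == bar (dst c)) && (b == bar (src c))).
  by rewrite alphaE !eps_bar opprK addrC.
by rewrite mulr0 addr0 eqxx.
Qed.

End VectorRep.

(** * The graph formed by the nonzero entries of the raising matrices *)

Section Edges.
Variables (k : nat) (F : numFieldType) (qh : F).
Hypothesis k_gt0 : (0 < k)%N.

Notation label := (label k).
Notation idx := (idx k).
Notation pie := (@pie k F qh).
Implicit Types (c d : label) (a b i j : idx).

Definition edge c a b :=
  ((a == src c) && (b == dst c)) || ((a == bar (dst c)) && (b == bar (src c))).

Lemma edgeP c a b : edge c a b ->
  (a = src c /\ b = dst c) \/ (a = bar (dst c) /\ b = bar (src c)).
Proof. by case/orP => /andP[/eqP-> /eqP->]; [left|right]. Qed.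

Lemma edge_src c : edge c (src c) (dst c).
Proof. by rewrite /edge !eqxx. Qed.

Lemma edge_bar c a b : edge c a b -> edge c (bar b) (bar a).
Proof. by case/edgeP => -[-> ->]; rewrite /edge ?barK !eqxx ?orbT. Qed.

Lemma edge_bar_dst c : edge c (bar (dst c)) (bar (src c)).
Proof. exact/edge_bar/edge_src. Qed.

(** The graph is a chain down to position [k.-1], then a square through [k] and [k.+1], which are
    not joined to each other, then a chain from [k.+2] on. *)
Lemma edge_cases c a b : edge c a b ->
  [\/ (a < k.-1)%N /\ b = a.+1 :> nat,
      a = k.-1 :> nat /\ (b = k :> nat \/ b = k.+1 :> nat),
      (a = k :> nat \/ a = k.+1 :> nat) /\ b = k.+2 :> nat |
      (k.+1 < a)%N /\ b = a.+1 :> nat].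
Proof.
case/edgeP => -[-> ->]; rewrite ?val_bar !val_src // !val_dst //.
  case: c => [m|[]]; first by have := ltn_ord m; constructor 1; split.
    by constructor 2; split=> //; right.
  by constructor 2; split=> //; left.
case: c => [m|[]]; first by have := ltn_ord m; constructor 4; split; lia.
  by constructor 3; split; lia.
by constructor 3; split; lia.
Qed.

Lemma edge_lt c a b : edge c a b -> (a < b)%N.
Proof. case/edge_cases; lia. Qed.

(** This keeps the matrix of rows triangular when a row is moved along an edge. *)
Lemma edge_mono c a b i j : edge c a b -> edge c i j -> (b < j)%N -> (a < i)%N.
Proof.
move=> /edgeP + /edgeP; case=> -[-> ->]; case=> -[-> ->].
- by rewrite ltnn.
- rewrite !val_bar !val_src // !val_dst //.
  by case: c => [m|[]]; try have := ltn_ord m; lia.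
- rewrite !val_bar !val_src // !val_dst //.
  by case: c => [m|[]]; try have := ltn_ord m; lia.
- by rewrite ltnn.
Qed.

Lemma edge_alpha c a b : edge c a b -> eps a - eps b = alpha c.
Proof.
by case/edgeP => -[-> ->]; rewrite ?eps_bar alphaE // opprK addrC.
Qed.

Lemma edge_par c a b : edge c a b -> par a (+) par b = lpar c.
Proof.
by case/edgeP => -[-> ->]; rewrite ?par_bar // par_src // par_dst //; case: lpar.
Qed.

Lemma edge_fun c a b b' : edge c a b -> edge c a b' -> b = b'.
Proof.
have sd : src c != bar (dst c).
  by rewrite -(inj_eq (@ord_inj _)) val_bar val_src // val_dst //;
    case: c => [m|[]]; try have := ltn_ord m; lia.
move=> /edgeP[] [-> ->] /edgeP[] [] // e _; first by rewrite e eqxx in sd.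
by rewrite -e eqxx in sd.
Qed.

Lemma edge_inj c a a' b : edge c a b -> edge c a' b -> a = a'.
Proof.
by move=> /edge_bar ab /edge_bar a'b; apply: bar_inj; apply: edge_fun ab a'b.
Qed.

Lemma pie_src c : pie c (src c) (dst c) = 1.
Proof.
rewrite pieE !mxE !eqxx /=; case: andP => [[/eqP /(congr1 (@nat_of_ord _)) + _]|_].
  rewrite val_bar val_src // val_dst //.
  by case: c => [m|[]]; try have := ltn_ord m; lia.
by rewrite mulr0 addr0.
Qed.

Lemma pie_bar_dst c : pie c (bar (dst c)) (bar (src c)) = sgk F c.
Proof.
rewrite pieE !mxE !eqxx /=; case: andP => [[/eqP /(congr1 (@nat_of_ord _)) + _]|_].
  rewrite val_bar val_src // val_dst //.
  by case: c => [m|[]]; try have := ltn_ord m; lia.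
by rewrite add0r mulr1.
Qed.

Lemma sgk_neq0 c : sgk F c != 0.
Proof. by rewrite /sgk; case: lpar; rewrite ?signr_eq0 ?oner_eq0. Qed.

Lemma edge_pie c a b : (pie c a b != 0) = edge c a b.
Proof.
apply/idP/idP => [|/edgeP[] [-> ->]]; last first.
- by rewrite pie_bar_dst sgk_neq0.
- by rewrite pie_src oner_eq0.
rewrite /edge pieE !mxE; case: (_ && _) => //=; rewrite add0r.
by case: (_ && _) => //=; rewrite mulr0 eqxx.
Qed.

Lemma pie_sum (V : lmodType F) c a b (f : idx -> V) : edge c a b ->
  \sum_j pie c a j *: f j = pie c a b *: f b.
Proof.
move=> ab; rewrite (bigD1 b) //= big1 ?addr0 // => j jb.
have [e|] := boolP (edge c a j); first by rewrite (edge_fun ab e) eqxx in jb.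
by rewrite -edge_pie negbK => /eqP->; rewrite scale0r.
Qed.

Lemma pie_sum0 (V : lmodType F) c a (f : idx -> V) :
  (forall b, ~~ edge c a b) -> \sum_j pie c a j *: f j = 0.
Proof.
move=> ab; rewrite big1 // => j _; have := ab j.
by rewrite -edge_pie negbK => /eqP->; rewrite scale0r.
Qed.

Lemma pie_sumr (V : lmodType F) c a b (f : idx -> V) : edge c a b ->
  \sum_j pie c j b *: f j = pie c a b *: f a.
Proof.
move=> ab; rewrite (bigD1 a) //= big1 ?addr0 // => j ja.
have [e|] := boolP (edge c j b); first by rewrite (edge_inj ab e) eqxx in ja.
by rewrite -edge_pie negbK => /eqP->; rewrite scale0r.
Qed.

Lemma pie_sumr0 (V : lmodType F) c b (f : idx -> V) :
  (forall a, ~~ edge c a b) -> \sum_j pie c j b *: f j = 0.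
Proof.
move=> ab; rewrite big1 // => j _; have := ab j.
by rewrite -edge_pie negbK => /eqP->; rewrite scale0r.
Qed.

Lemma edge_into a : a != 0%N :> nat -> exists c i, edge c i a.
Proof.
move=> a0; have ha := ltn_ord a; have hk := k_gt0.
have eqi (i j : idx) : i = j :> nat -> i = j by apply: ord_inj.
have [ak|ak] := ltnP a k.
  have [m mE] : exists m : 'I_k.-1, m = a.-1 :> nat.
    by have hm : (a.-1 < k.-1)%N; [lia | exists (Ordinal hm)].
  exists (inl m), (src (inl m)); rewrite (_ : a = dst (inl m)) ?edge_src //.
  by apply: eqi; rewrite val_dst //=; lia.
have [ak2|ak2] := leqP a k.+1.
  have [ak1|ak1] := eqVneq (a : nat) k.
    exists lab_s, (src lab_s); rewrite (_ : a = dst lab_s) ?edge_src //.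
    by apply: eqi; rewrite val_dst.
  exists lab_t, (src lab_t); rewrite (_ : a = dst lab_t) ?edge_src //.
  by apply: eqi; rewrite val_dst //=; lia.
have [ak3|ak3] := eqVneq (a : nat) k.+2.
  exists lab_s, (bar (dst lab_s)); rewrite (_ : a = bar (src lab_s)) ?edge_bar_dst //.
  by apply: eqi; rewrite val_bar val_src //=; lia.
have [m mE] : exists m : 'I_k.-1, m = (k.*2.+1 - a)%N :> nat.
  by have hm : (k.*2.+1 - a < k.-1)%N; [lia | exists (Ordinal hm)].
exists (inl m), (bar (dst (inl m))).
rewrite (_ : a = bar (src (inl m))) ?edge_bar_dst //.
by apply: eqi; rewrite val_bar val_src //=; lia.
Qed.

Lemma edge_ind (P : idx -> Prop) :
  (forall a, a = 0%N :> nat -> P a) ->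
  (forall c a b, edge c a b -> P a -> P b) -> forall a, P a.
Proof.
move=> P0 PS a; move: {2}(a : nat) (leqnn a) => n.
elim: n a => [|n IH] a an; first by apply: P0; lia.
have [a0|/edge_into[c [i ia]]] := eqVneq (a : nat) 0%N; first exact: P0.
by apply: (PS c i a ia); apply: IH; have := edge_lt ia; lia.
Qed.

End Edges.

Section EdgeGeometry.
Variable k : nat.
Hypothesis k_gt0 : (0 < k)%N.

Notation idx := (idx k).
Implicit Types (l : label k) (a b c : idx).

Lemma edge_two l a b a' b' : edge l a b -> edge l a' b' ->
  (a' = a /\ b' = b) \/ (a' = bar b /\ b' = bar a).
Proof.
by move=> /edgeP[] [-> ->] /edgeP[] [-> ->]; rewrite ?barK; auto.
Qed.

Lemma edge_bar_neq l a b : edge l a b -> a != bar b.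
Proof.
have sd : src l != bar (dst l).
  by rewrite -(inj_eq (@ord_inj _)) val_bar val_src // val_dst //;
    case: l => [m|[]]; try have := ltn_ord m; lia.
by case/edgeP => -[-> ->]; rewrite ?barK // eq_sym.
Qed.

Lemma edge_neq l a b : edge l a b -> a != b.
Proof. by move=> /(edge_lt k_gt0) ab; rewrite -(inj_eq (@ord_inj _)) ltn_eqF. Qed.

Lemma form_eps_self a : form (eps a) (eps a) = (-1) ^+ par a.
Proof.
rewrite form_eps // eqxx (_ : (a == bar a) = false) ?subr0 ?mulr1 //.
by apply/eqP => /(congr1 (@nat_of_ord _)); rewrite val_bar; lia.
Qed.

Lemma form_eps_other a b : a != b -> a != bar b -> form (eps a) (eps b) = 0.
Proof. by move=> ab ab'; rewrite form_eps // (negPf ab) (negPf ab') subr0 mulr0. Qed.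

Lemma form_edge l a b c : edge l a b -> form (alpha l) (eps c) = form (eps a) (eps c) - form (eps b) (eps c).
Proof. by move=> e; rewrite -(edge_alpha e) formDl formNl. Qed.

(** A label has only the two edges [a -> b] and [bar b -> bar a]. *)
Lemma no_pred l a b a' : edge l a b -> a' != b -> a' != bar a ->
  forall i, ~~ edge l i a'.
Proof.
move=> e n1 n2 i; apply/negP => /(edge_two e)[] [_ e']; first by rewrite e' eqxx in n1.
by rewrite e' eqxx in n2.
Qed.

Lemma no_succ l a b a' : edge l a b -> a' != a -> a' != bar b ->
  forall i, ~~ edge l a' i.
Proof.
move=> e n1 n2 i; apply/negP => /(edge_two e)[] [e' _]; first by rewrite e' eqxx in n1.
by rewrite e' eqxx in n2.
Qed.

Lemma self_bar_neq a : a != bar a.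
Proof. by apply/eqP => /(congr1 (@nat_of_ord _)); rewrite val_bar; lia. Qed.

Lemma neq_bar_sym a b : a != bar b -> b != bar a.
Proof. by rewrite eq_sym bar_eq. Qed.

Lemma edge_k a b : (a = k :> nat) \/ (a = k.+1 :> nat) -> b = k.+2 :> nat ->
  exists l, edge l a b.
Proof.
have eqi (i j : idx) : i = j :> nat -> i = j by apply: ord_inj.
move=> ha hb; have -> : b = bar (src lab_s) by apply: eqi; rewrite val_bar val_src //=; lia.
case: ha => ha.
  have -> : a = bar (dst lab_t) by apply: eqi; rewrite val_bar val_dst //=; lia.
  by exists lab_t; apply: edge_bar_dst.
have -> : a = bar (dst lab_s) by apply: eqi; rewrite val_bar val_dst //=; lia.
by exists lab_s; apply: edge_bar_dst.
Qed.

(** A step back from [a] can jump over [c] only inside the square. For [a = k.+1] the position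
    [c = k] is excluded as [bar a]; for [a = k.+2] both [k] and [k.+1] have an edge into [a]. *)
Lemma pred_above c a : (c < a)%N -> c != bar a ->
  (exists l, edge l c a) \/ exists l a', edge l a' a /\ (c < a')%N.
Proof.
move=> ca; rewrite -(inj_eq (@ord_inj _)) val_bar => ca'.
have [|l [a' e]] := @edge_into k k_gt0 a; first by lia.
have [eca|nca] := eqVneq c a'; first by left; exists l; rewrite eca.
have {}nca : c != a' :> nat by [].
case: (edge_cases k_gt0 e) => [[h1 h2]|[h1 [h2|h2]]|[h1 h2]|[h1 h2]].
- by right; exists l, a'; split=> //; lia.
- by right; exists l, a'; split=> //; lia.
- by right; exists l, a'; split=> //; lia.
- have [ck|ck] := ltnP c k; first by right; exists l, a'; split=> //; lia.
  by left; apply: (edge_k _ h2); lia.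
- by right; exists l, a'; split=> //; lia.
Qed.

Lemma succ_below b c : (b < c)%N -> c != bar b ->
  (exists l, edge l b c) \/ exists l b', edge l b b' /\ (b' < c)%N.
Proof.
have lt_bar (x y : idx) : (bar x < bar y)%N = (y < x)%N.
  by rewrite !val_bar; have := ltn_ord x; have := ltn_ord y; lia.
move=> bc cb; have [||[l e]|[l [b' [e h]]]] := @pred_above (bar c) (bar b).
- by rewrite lt_bar.
- by rewrite (inj_eq (@bar_inj _)).
- by left; exists l; rewrite -(barK b) -(barK c); apply: edge_bar.
right; exists l, (bar b'); split; first by rewrite -(barK b); apply: edge_bar.
by rewrite -lt_bar barK.
Qed.

End EdgeGeometry.

(** * The action on the rows of an intertwiner *)

Section Rows.
Variables (k : nat) (F : numFieldType) (qh : F) (A : algType F).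
Hypotheses (k_gt0 : (0 < k)%N) (qh0 : qh != 0).

Notation label := (label k).
Notation idx := (idx k).
Notation rows := {ffun idx -> A}.
Notation pie := (@pie k F qh).
Notation q := (qpow qh 1).
Notation g c b := (form (alpha c) (eps b)).
Notation braid := (@braid k F q).
Implicit Types (c d : label).

Variables (E : label -> A) (th : A -> A) (tau : label -> A -> A).
Hypothesis Eserre : serre_elements q E.
Hypotheses (thlin : linear th) (thM : {morph th : u v / u * v}).
Hypothesis thE : forall c, th (E c) = (-1) ^+ lpar c *: E c.
Hypotheses (taulin : forall c, linear (tau c)).
Hypothesis tauM : forall c, {morph tau c : u v / u * v}.
Hypothesis tauE : forall c d, tau c (E d) = braid c d *: E d.
Hypothesis tauC : forall c d u, tau c (tau d u) = tau d (tau c u).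
Hypothesis tau_th : forall c u, tau c (th u) = th (tau c u).

Definition thc (c : label) (u : A) : A := if lpar c then th u else u.

Lemma thc_lin c : linear (thc c).
Proof. by rewrite /thc; case: lpar => // a u v; apply: thlin. Qed.

Lemma thcM c u v : thc c (u * v) = thc c u * thc c v.
Proof. by rewrite /thc; case: lpar => //; apply: thM. Qed.

Lemma thcE c d : thc c (E d) = (-1) ^+ (lpar c && lpar d) *: E d.
Proof. by rewrite /thc; case: (lpar c); rewrite ?thE ?scale1r. Qed.

Lemma thcC c d u : thc c (thc d u) = thc d (thc c u).
Proof. by rewrite /thc; case: (lpar c); case: (lpar d). Qed.

Lemma tau_thc c d u : tau c (thc d u) = thc d (tau c u).
Proof. by rewrite /thc; case: lpar. Qed.

(* The intertwining relation for e_c says that opT c maps the row a of R to a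
   multiple of the row of eps_a - alpha_c.  Its three parts come from the right
   multiplication by e_c, the vector representation and the left multiplication
   by e_c. *)
Definition opP (c : label) (r : rows) : rows := [ffun b => qpow qh (g c b) *: (r b * E c)].
Definition opV (c : label) (r : rows) : rows :=
  [ffun b => hpow qh (g c b) *: \sum_j pie c j b *: thc c (r j)].
Definition opQ (c : label) (r : rows) : rows :=
  [ffun b => - qpow qh (- g c b) *: (E c * tau c (r b))].
Definition opT (c : label) (r : rows) : rows := opQ c r + opV c r + opP c r.

Lemma opP_lin c : linear (opP c).
Proof.
move=> a r s; apply/ffunP => b; rewrite !ffunE mulrDl -scalerAl.
by lmod F; ring.
Qed.

Lemma opQ_lin c : linear (opQ c).
Proof.
move=> a r s; apply/ffunP => b; rewrite !ffunE taulin mulrDr -scalerAr.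
by lmod F; ring.
Qed.

Lemma opV_lin c : linear (opV c).
Proof.
move=> a r s; apply/ffunP => b; rewrite !ffunE scalerA mulrC -scalerA -scalerDr.
congr (_ *: _); rewrite scaler_sumr -big_split /=; apply: eq_bigr => j _.
by rewrite !ffunE thc_lin; lmod F; ring.
Qed.

Lemma opT_lin c : linear (opT c).
Proof.
move=> a r s; rewrite /opT opP_lin opQ_lin opV_lin.
by lmod F; ring.
Qed.

Lemma pie_g c d j b : pie d j b != 0 -> g c j = g c b + form (alpha c) (alpha d).
Proof.
move=> /pie_weight <-; rewrite formDr formNr; ring.
Qed.

Lemma braidE c d : braid c d =
  (-1) ^+ (lpar c && lpar d) * qpow qh (form (alpha c) (alpha d)).
Proof. by rewrite /braid -qpow_exp. Qed.

#[local] Opaque Defs.form.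

(** Multiplications on opposite sides commute; the scalar comes from [tau c] passing over [E d]. *)
Lemma opQP c d r : opQ c (opP d r) = braid c d *: opP d (opQ c r).
Proof.
apply/ffunP => b; rewrite !ffunE (linearfZ (taulin c)) tauM tauE.
rewrite -!scalerAr -!scalerAl mulrA.
by lmod F; ring.
Qed.

(** The power of [q] in [opP d] is taken at column [j] on one side and at column [b] on the other;
    by [pie_g] the exponents differ by [(alpha_c, alpha_d)]. The sign comes from [thc c] on
    [E d]. *)
Lemma opVP c d r : opV c (opP d r) = braid c d *: opP d (opV c r).
Proof.
apply/ffunP => b; rewrite !ffunE -scalerAl !scalerA mulr_suml !scaler_sumr.
apply: eq_bigr => j _; rewrite !ffunE (linearfZ (thc_lin c)) thcM thcE.
rewrite -!scalerAr -!scalerAl !scalerA.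
have [->|nz] := eqVneq (pie c j b) 0; first by rewrite !(mulr0, mul0r).
congr (_ *: _); rewrite braidE (pie_g d nz) qpowD // [form (alpha d) (alpha c)]formC.
by case: (_ && _); rewrite ?expr0 ?expr1; ring.
Qed.

Lemma opQV c d r : opQ c (opV d r) = braid c d *: opV d (opQ c r).
Proof.
apply/ffunP => b; rewrite !ffunE (linearfZ (taulin c)) -scalerAr !scalerA.
rewrite (big_morph (tau c) (linearfD (taulin c)) (linearf0 (taulin c))).
rewrite mulr_sumr !scaler_sumr; apply: eq_bigr => j _.
rewrite !ffunE !(linearfZ (thc_lin d), linearfZ (taulin c)) thcM thcE tau_thc.
rewrite -!scalerAr -!scalerAl !scalerA.
have [->|nz] := eqVneq (pie d j b) 0; first by rewrite !(mulr0, mul0r).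
congr (_ *: _); rewrite braidE (pie_g c nz) (opprD (g c b)) (qpowD qh0 (- g c b)) (qpowN qh (form (alpha c) (alpha d))).
rewrite [(lpar d && _)]andbC; have := qpow_neq0 qh0 (form (alpha c) (alpha d)).
by case: (_ && _); rewrite ?expr0 ?expr1 => h; field.
Qed.

Let q0 : q != 0. Proof. exact: qpow_neq0. Qed.

Lemma serre_opQ : serre q opQ.
Proof.
pose f2 a b (v : rows) y : rows :=
  [ffun i => (braid a b * qpow qh (- g a i) * qpow qh (- g b i)) *:
     (y * tau a (tau b (v i)))].
pose f3 a b c (v : rows) y : rows :=
  [ffun i => - (braid a b * braid a c * braid b c * qpow qh (- g a i) *
                qpow qh (- g b i) * qpow qh (- g c i)) *:
     (y * tau a (tau b (tau c (v i))))].
apply: (serre_transport Eserre (f2 := f2) (f3 := f3)).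
- move=> a b v x y z; apply/ffunP => i; rewrite !ffunE mulrDl -scalerAl.
  by lmod F; ring.
- move=> a b c v x y z; apply/ffunP => i; rewrite !ffunE mulrDl -scalerAl.
  by lmod F; ring.
- move=> a b v y; apply/ffunP => i; rewrite !ffunE tauC braidC.
  by lmod F; ring.
- move=> a b c v y; apply/ffunP => i; rewrite !ffunE tauC [braid a b]braidC.
  by lmod F; ring.
- move=> a b c v y; apply/ffunP => i.
  rewrite !ffunE [tau b (tau c _)]tauC [braid b c]braidC.
  by lmod F; ring.
- move=> a b v; apply/ffunP => i; rewrite !ffunE (linearfZ (taulin a)) tauM tauE.
  by rewrite -!(scalerAl, scalerAr) mulrA; lmod F; ring.
- move=> a b c v; apply/ffunP => i.
  rewrite !ffunE !(linearfZ (taulin _)) !tauM !(linearfZ (taulin _)) !tauM !tauE.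
  rewrite -!(scalerAl, scalerAr) (linearfZ (taulin a)) tauE.
  rewrite -!(scalerAl, scalerAr) -[E a * E b * E c * _]mulrA.
  by rewrite -[E a * E b * _]mulrA; lmod F; ring.
Qed.

Lemma serre_opP : serre q opP.
Proof.
pose f2 a b (v : rows) y : rows :=
  [ffun i => (qpow qh (g a i) * qpow qh (g b i)) *: (v i * y)].
pose f3 a b c (v : rows) y : rows :=
  [ffun i => (qpow qh (g a i) * qpow qh (g b i) * qpow qh (g c i)) *: (v i * y)].
apply: (serre_transport_rev Eserre (f2 := f2) (f3 := f3)).
- move=> a b v x y z; apply/ffunP => i; rewrite !ffunE mulrDr -scalerAr.
  by lmod F; ring.
- move=> a b c v x y z; apply/ffunP => i; rewrite !ffunE mulrDr -scalerAr.
  by lmod F; ring.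
- by move=> a b v y; apply/ffunP => i; rewrite !ffunE; lmod F; ring.
- by move=> a b c v y; apply/ffunP => i; rewrite !ffunE; lmod F; ring.
- by move=> a b c v y; apply/ffunP => i; rewrite !ffunE; lmod F; ring.
- move=> a b v; apply/ffunP => i; rewrite !ffunE -!(scalerAl, scalerAr) !mulrA.
  by lmod F; ring.
- move=> a b c v; apply/ffunP => i; rewrite !ffunE -!(scalerAl, scalerAr) !mulrA.
  by lmod F; ring.
Qed.

Lemma mxmulE (X Y : 'M[F]_k.*2.+2) l i : (X * Y) l i = \sum_j X l j * Y j i.
Proof. by rewrite -mulmxE mxE. Qed.

(** Matrices act on rows from the right, so their product appears reversed. The term
    [(alpha_a, alpha_b)] is the shift of the column weight between the two actions. *)
Lemma opV2 a b (v : rows) i : opV a (opV b v) i =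
  hpow qh (g a i + g b i + form (alpha a) (alpha b)) *:
    \sum_l (pie b * pie a) l i *: thc a (thc b (v l)).
Proof.
rewrite !ffunE.
transitivity (hpow qh (g a i) *: \sum_j \sum_l
    (hpow qh (g b i + form (alpha a) (alpha b)) * (pie b l j * pie a j i)) *:
      thc a (thc b (v l))).
  congr (_ *: _); apply: eq_bigr => j _; rewrite !ffunE.
  have [->|nz] := eqVneq (pie a j i) 0.
    by rewrite scale0r big1 // => l _; rewrite !mulr0 scale0r.
  rewrite (linearfZ (thc_lin a)) scalerA.
  rewrite (big_morph (thc a) (linearfD (thc_lin a)) (linearf0 (thc_lin a))).
  rewrite scaler_sumr; apply: eq_bigr => l _; rewrite (linearfZ (thc_lin a)).
  rewrite (pie_g b nz) [form (alpha b) (alpha a)]formC scalerA.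
  by congr (_ *: _); ring.
rewrite exchange_big /= !scaler_sumr; apply: eq_bigr => l _.
rewrite -scaler_suml -mulr_sumr -mulmxE mxE !scalerA.
by rewrite mulrA -(hpowD qh0) addrA.
Qed.

Lemma opV3 a b c (v : rows) i : opV a (opV b (opV c v)) i =
  hpow qh (g a i + g b i + g c i + form (alpha a) (alpha b) +
           form (alpha a) (alpha c) + form (alpha b) (alpha c)) *:
    \sum_l (pie c * pie b * pie a) l i *: thc a (thc b (thc c (v l))).
Proof.
rewrite [LHS]ffunE.
transitivity (hpow qh (g a i) *: \sum_j \sum_l
    (hpow qh (g b i + form (alpha a) (alpha b) + g c i +
       form (alpha a) (alpha c) + form (alpha b) (alpha c)) *
     ((pie c * pie b) l j * pie a j i)) *: thc a (thc b (thc c (v l)))).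
  congr (_ *: _); apply: eq_bigr => j _; rewrite opV2.
  have [->|nz] := eqVneq (pie a j i) 0.
    by rewrite scale0r big1 // => l _; rewrite !mulr0 scale0r.
  rewrite (linearfZ (thc_lin a)) scalerA.
  rewrite (big_morph (thc a) (linearfD (thc_lin a)) (linearf0 (thc_lin a))).
  rewrite scaler_sumr; apply: eq_bigr => l _; rewrite (linearfZ (thc_lin a)).
  rewrite (pie_g b nz) (pie_g c nz) [form (alpha b) (alpha a)]formC.
  rewrite [form (alpha c) (alpha a)]formC !addrA scalerA.
  by congr (_ *: _); ring.
rewrite exchange_big /= !scaler_sumr; apply: eq_bigr => l _.
rewrite -scaler_suml -mulr_sumr [(pie c * pie b * pie a) l i]mxmulE !scalerA.
rewrite mulrA -(hpowD qh0); congr ((hpow qh _ * _) *: _); ring.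
Qed.

Lemma serre_opV : serre q opV.
Proof.
pose f2 a b (v : rows) (y : 'M[F]_k.*2.+2) : rows :=
  [ffun i => hpow qh (g a i + g b i + form (alpha a) (alpha b)) *:
    \sum_l y l i *: thc a (thc b (v l))].
pose f3 a b c (v : rows) (y : 'M[F]_k.*2.+2) : rows :=
  [ffun i => hpow qh (g a i + g b i + g c i + form (alpha a) (alpha b) +
           form (alpha a) (alpha c) + form (alpha b) (alpha c)) *:
    \sum_l y l i *: thc a (thc b (thc c (v l)))].
have lin (h : F) (w : idx -> A) i x (y z : 'M[F]_k.*2.+2) :
    h *: \sum_l (x *: y + z) l i *: w l =
    x *: (h *: \sum_l y l i *: w l) + h *: \sum_l z l i *: w l.
  rewrite scalerA mulrC -scalerA -scalerDr; congr (_ *: _).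
  rewrite scaler_sumr -big_split /=; apply: eq_bigr => l _.
  by rewrite !mxE scalerDl scalerA.
apply: (@serre_transport_rev k F q _ pie _ opV f2 f3 (@serre_pie k F qh k_gt0 q)).
- by move=> a b v x y z; apply/ffunP => i; rewrite !ffunE lin.
- by move=> a b c v x y z; apply/ffunP => i; rewrite !ffunE lin.
- move=> a b v y; apply/ffunP => i; rewrite !ffunE.
  rewrite [form (alpha a) (alpha b)]formC; congr (hpow qh _ *: _); first ring.
  by apply: eq_bigr => l _; rewrite thcC.
- move=> a b c v y; apply/ffunP => i; rewrite !ffunE.
  rewrite [form (alpha a) (alpha b)]formC; congr (hpow qh _ *: _); first ring.
  by apply: eq_bigr => l _; rewrite thcC.
- move=> a b c v y; apply/ffunP => i; rewrite !ffunE.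
  rewrite [form (alpha b) (alpha c)]formC; congr (hpow qh _ *: _); first ring.
  by apply: eq_bigr => l _; rewrite [thc b (thc c _)]thcC.
- by move=> a b v; apply/ffunP => i; rewrite opV2 ffunE.
- by move=> a b c v; apply/ffunP => i; rewrite opV3 ffunE.
Qed.

Lemma serre_opT : serre q opT.
Proof.
have QVlin c : linear (fun r => opQ c r + opV c r).
  by move=> a r s; rewrite opQ_lin opV_lin; lmod F; ring.
apply: (serre_sum k_gt0 q0 QVlin opP_lin _ serre_opP).
- apply: (serre_sum k_gt0 q0 opQ_lin opV_lin serre_opQ serre_opV) => // c d v.
  exact: opQV.
- by move=> c d v; rewrite opQP opVP (linearfD (opP_lin _)) scalerDr.
- by [].
Qed.

Hypotheses (th1 : th 1 = 1) (tau1 : forall c, tau c 1 = 1).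

Lemma opV_E c (r : rows) b : opV c r b = hpow qh (g c b) *:
  ((if b == dst c then thc c (r (src c)) else 0) +
   (if b == bar (src c) then sgk F c *: thc c (r (bar (dst c))) else 0)).
Proof.
rewrite ffunE; congr (_ *: _).
have pick (i : idx) (P : bool) (a : F) : \sum_j (a * ((j == i) && P)%:R) *:
    thc c (r j) = if P then a *: thc c (r i) else 0.
  rewrite (bigD1 i) //= eqxx big1 => [|j /negPf ji].
    by rewrite addr0; case: P; rewrite ?mulr1 // mulr0 scale0r.
  by rewrite ji mulr0 scale0r.
rewrite -[thc c (r (src c))]scale1r -!pick -big_split; apply: eq_bigr => j _.
by rewrite pieE !mxE mul1r scalerDl.
Qed.

Lemma opTE c (r : rows) b : opT c r b =
  - qpow qh (- g c b) *: (E c * tau c (r b)) +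
  hpow qh (g c b) *:
    ((if b == dst c then thc c (r (src c)) else 0) +
     (if b == bar (src c) then sgk F c *: thc c (r (bar (dst c))) else 0)) +
  qpow qh (g c b) *: (r b * E c).
Proof. by rewrite -opV_E ffunE [in LHS]ffunE [opQ c r b]ffunE [opP c r b]ffunE. Qed.

Definition first_row : rows := [ffun b : idx => ((b : nat) == 0%N)%:R].

(** At the only nonzero column [alpha c] is orthogonal to delta_1, so the left and right
    multiplications by [E c] cancel; the vector representation contributes nothing. *)
Lemma first_row_src c : src c != 0%N :> nat -> opT c first_row = 0.
Proof.
move=> c0; apply/ffunP => b; rewrite opTE !ffunE (negPf c0) /thc.
have t0 := linearf0 (taulin c); have th0 := linearf0 thlin.
have db : (bar (dst c) == 0%N :> nat) = false.
  by rewrite val_bar val_dst //; case: c {c0 t0} => [m|[]];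
    try have := ltn_ord m; lia.
rewrite db !th0 !if_same scaler0 if_same addr0 scaler0 addr0.
case: eqP => [b0|_]; last by rewrite t0 mulr0 mul0r !scaler0 addr0.
rewrite form_alpha_other //.
- by rewrite oppr0 qpow0 // tau1 mulr1 mul1r scaleN1r scale1r addNr.
- by apply: contraNneq c0 => <-; apply/eqP.
- apply/eqP => bd; move: b0; rewrite bd => b0.
  by have := src_lt_dst k_gt0 c; rewrite b0.
- apply/eqP => /(congr1 (@nat_of_ord _)); rewrite b0 val_bar val_src //.
  by case: c {c0 t0 db} => [m|[]]; try have := ltn_ord m; lia.
- by apply/eqP => bd; move: db; rewrite -bd b0.
Qed.

Definition second_row c : rows := [ffun b : idx =>
  if b == src c then (qpow qh (-1) - q) *: E c
  else if b == dst c then (hpow qh ((-1) ^+ lpar c))%:A else 0].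

Lemma first_row_step c : src c = 0%N :> nat -> opT c first_row = second_row c.
Proof.
move=> c0; apply/ffunP => b; rewrite opTE !ffunE c0 eqxx /thc.
have t0 := linearf0 (taulin c); have th0 := linearf0 thlin.
have -> : (bar (dst c) == 0%N :> nat) = false.
  by rewrite val_bar val_dst //; case: c {c0 t0} => [m|[]];
    try have := ltn_ord m; lia.
rewrite th0 if_same scaler0 if_same addr0 th1 if_same.
have -> : (b == src c) = (b == 0%N :> nat).
  by rewrite -(inj_eq (@ord_inj _)) c0.
case: eqP => [b0|nb0].
  have -> : b = src c by apply: ord_inj; rewrite b0 c0.
  have /negPf-> : src c != dst c.
    by rewrite -(inj_eq (@ord_inj _)) ltn_eqF // src_lt_dst.
  rewrite form_alpha_src // opprK tau1 mulr1 mul1r scaler0 addr0.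
  by rewrite scaleNr -scaleNr -scalerDl addrC.
rewrite t0 mulr0 mul0r !scaler0 addr0 add0r.
by case: eqP => [->|_]; rewrite ?scaler0 // form_alpha_dst.
Qed.

Lemma first_row_sq (m : 'I_k.-1) : m = 0%N :> nat ->
  opT (inl m) (opT (inl m) first_row) = 0.
Proof.
move=> m0; have hm := ltn_ord m; set c : label := inl m.
have c0 : src c = 0%N :> nat by rewrite val_src.
have d1 : dst c = 1%N :> nat by rewrite val_dst //= m0.
have bd : bar (dst c) = k.*2 :> nat by rewrite val_bar d1; lia.
have t0 := linearf0 (taulin c).
have neq (x y : idx) : x != y :> nat -> (x == y) = false.
  by rewrite -(inj_eq (@ord_inj _)) => /negPf.
have sd : (src c == dst c) = false by rewrite neq // c0 d1.
have ds : (dst c == src c) = false by rewrite neq // c0 d1.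
rewrite first_row_step //; apply/ffunP => b; rewrite opTE !ffunE.
rewrite [bar (dst c) == src c]neq ?bd ?c0; last lia.
rewrite [bar (dst c) == dst c]neq ?bd ?d1; last lia.
have lc : lpar c = false by [].
rewrite /thc lc scaler0 if_same addr0 eqxx.
have [->|_] := eqVneq b (src c).
  rewrite sd form_alpha_src // opprK (linearfZ (taulin c)) tauE.
  have -> : braid c c = qpow qh (-1) * qpow qh (-1).
    by rewrite braidE -qpowD // form_inl // eqxx mul1r.
  rewrite -scalerAr -!scalerAl -scalerAr.
  have := qpow_neq0 qh0 1; rewrite (qpowN qh 1) => hq.
  by lmod F; field.
have [->|_] := eqVneq b (dst c).
  rewrite form_alpha_dst // (linearfZ (taulin c)) tau1 -scalerAr -scalerAl.
  rewrite mulr1 mul1r lc expr0 (qpowN qh 1) hpow1.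
  have := qpow_neq0 qh0 1; rewrite qpow1 // => hq.
  by lmod F; field.
by rewrite t0 mulr0 mul0r !scaler0 !addr0.
Qed.

Lemma last_index (b : idx) (o : bool) : k = 1%N ->
  b != 0%N :> nat -> b != o.+1 :> nat -> b != (~~ o).+1 :> nat -> b = 3%N :> nat.
Proof.
move: (ltn_ord b); move: (b : nat) => n {b} + k1; rewrite {}k1.
by case: o; case: n => [|[|[|[|n]]]].
Qed.

(** For [k = 1] there are four columns, and the result is symmetric under exchange of [c] and [d].
    This symmetry is the commuting square needed in [first_row_st]. *)
Lemma second_row_step (o : bool) :
  let c : label := inr o in let d : label := inr (~~ o) in
  k = 1%N -> opT d (second_row c) = [ffun b =>
    if b == src c then (q^-1 * (q^-1 - q)) *: (E c * E d + E d * E c)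
    else if b == dst c then (qh^-1 * (q - q^-1)) *: E d
    else if b == dst d then (qh^-1 * (q - q^-1)) *: E c
    else ((-1) ^+ k)%:A].
Proof.
move=> c d k1; apply/ffunP => b; rewrite opTE !ffunE.
have hq := qpow_neq0 qh0 1; have t0 := linearf0 (taulin d).
have th0 := linearf0 thlin.
have neq (x y : idx) : x != y :> nat -> (x == y) = false.
  by rewrite -(inj_eq (@ord_inj _)) => /negPf.
have eq (x y : idx) : x = y :> nat -> x = y by apply: ord_inj.
have s0 (e : label) : src e = 0%N :> nat.
  rewrite val_src //; case: e => [m|_]; last by rewrite k1.
  by have := ltn_ord m; lia.
have vd e : dst (inr e : label) = e.+1 :> nat by rewrite val_dst // k1; case: e.
have sdE : src d = src c by apply: eq; rewrite !s0.
have bdE : bar (dst d) = dst c.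
  by apply: eq; rewrite val_bar !vd k1 /c; case: (o).
have bs : bar (src c) = 3%N :> nat by rewrite val_bar s0 k1.
have lc : lpar c by []. have ld : lpar d by [].
have cs : (dst c == src c) = false by rewrite neq // vd s0.
have ds : (dst d == src c) = false by rewrite neq // vd s0.
have dc : (dst d == dst c) = false by rewrite neq // !vd; case: (o).
have cd : (dst c == dst d) = false by rewrite eq_sym.
have sc : (src c == dst c) = false by rewrite eq_sym.
have sd : (src c == dst d) = false by rewrite eq_sym.
have cb : (dst c == bar (src c)) = false.
  by rewrite neq // bs vd; case: (o).
have db : (dst d == bar (src c)) = false.
  by rewrite neq // bs vd; case: (o).
have sb : (src c == bar (src c)) = false by rewrite neq // bs s0.
rewrite /thc ld sdE bdE cs !eqxx lc expr1 hpowN hpow1.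
have [->|bs'] := eqVneq b (src c).
  rewrite sd sb -[in form (alpha d) _]sdE form_alpha_src // opprK.
  have oN : (~~ o == o) = false by case: (o).
  rewrite (linearfZ (taulin d)) tauE braidE ld lc form_inr // oN.
  have -> : qpow qh (-2) = q^-1 * q^-1 by rewrite -qpowN -qpowD.
  rewrite addr0 scaler0 addr0 (qpowN qh 1) expr1 -scalerAl -!scalerAr.
  by lmod F; field.
have [->|bc] := eqVneq b (dst c).
  rewrite cd cb -bdE form_eps_bar form_alpha_dst // ld opprK expr1.
  rewrite (linearfZ (taulin d)) tau1 -scalerAr mulr1 -scalerAl mul1r.
  by rewrite (qpowN qh 1) opprK !addr0 scaler0 addr0; lmod F; field; apply/andP.
rewrite t0 mulr0 mul0r !scaler0 add0r addr0.
have [->|bd] := eqVneq b (dst d).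
  rewrite db addr0 form_alpha_dst // ld expr1 hpowN hpow1 (linearfZ thlin) thE lc.
  by rewrite (qpowN qh 1) expr1; lmod F; ring.
have -> : b = bar (src c).
  move: bs' bc bd; rewrite -!(inj_eq (@ord_inj _)) s0 !vd => b0 b1 b2.
  by apply: eq; rewrite bs; apply: (last_index k1 b0 b1 b2).
rewrite eqxx add0r -[in form (alpha d) _]sdE form_eps_bar form_alpha_src //.
rewrite opprK hpow1 (linearfZ thlin) th1 /sgk ld.
by lmod F; field.
Qed.

Lemma first_row_st : k = 1%N ->
  opT lab_s (opT lab_t first_row) = opT lab_t (opT lab_s first_row).
Proof.
move=> k1; have c0 (b : bool) : src (inr b : label) = 0%N :> nat.
  by rewrite val_src // k1.
rewrite (first_row_step (c0 false)) (first_row_step (c0 true)).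
rewrite (second_row_step true k1) (second_row_step false k1).
apply/ffunP => b; rewrite !ffunE.
have -> : src (inr true : label) = src (inr false) by [].
have ts : (dst (inr true : label) == dst (inr false)) = false.
  by rewrite -(inj_eq (@ord_inj _)) !val_dst // eqn_leq ltnn.
case: eqP => _; first by rewrite [E _ * _ + _]addrC.
by have [->|nb] := eqVneq b (dst (inr true)); rewrite ?ts.
Qed.

Hypothesis q2 : q + q^-1 != 0.

(** * The matrix entries of the intertwiner *)

Definition Nrow (a : idx) : rows := pathrow opT qh ((-1) ^+ k) first_row a.

(** The sum has one term if [c] has an edge out of [a]; otherwise it is empty and the content is
    that [opT c] kills the row. *)
Lemma opT_Nrow c a :
  opT c (Nrow a) = \sum_j pie c a j *: (hpow qh (g c j) *: Nrow j).
Proof.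
have Tlin := opT_lin; have zz : (-1) ^+ k * (-1) ^+ k = 1 :> F.
  by rewrite -expr2 sqrr_sign.
have [->|a_src] := eqVneq a (src c).
  rewrite (pie_sum qh k_gt0 _ (edge_src c)) pie_src // scale1r.
  rewrite (pathrow_src k_gt0 q0 q2 _ qh0 first_row_st) form_alpha_dst //.
  by congr (_ *: _); case: lpar; rewrite ?expr1 ?hpowN hpow1.
have [->|a_dst] := eqVneq a (bar (dst c)).
  rewrite (pie_sum qh k_gt0 _ (edge_bar_dst c)) pie_bar_dst // scalerA.
  rewrite (pathrow_bar k_gt0 q0 Tlin serre_opT q2 qh0 zz first_row_src
             first_row_sq first_row_st).
  by rewrite form_eps_bar form_alpha_src // opprK hpow1.
rewrite (pie_sum0 qh k_gt0) => [|j]; last by rewrite /edge (negPf a_src) (negPf a_dst).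
exact: (pathrow_kill k_gt0 q0 Tlin serre_opT q2 _ qh0 first_row_src
             first_row_sq first_row_st).
Qed.

Lemma Nrow0 (a : idx) : a = 0%N :> nat -> Nrow a = first_row.
Proof. by move=> a0; rewrite /Nrow /pathrow a0 k_gt0. Qed.

Lemma Nrow_edge c a j b : edge c a j ->
  (pie c a j * hpow qh (g c j)) *: Nrow j b = opT c (Nrow a) b.
Proof.
by move=> e; rewrite opT_Nrow (pie_sum qh k_gt0 _ e) scalerA ffunE.
Qed.

Lemma edge_coef_neq0 c a j : edge c a j -> pie c a j * hpow qh (g c j) != 0.
Proof. by move=> e; rewrite mulf_neq0 ?edge_pie ?hpow_neq0. Qed.

Lemma opT_entry c r b : opT c r b =
  - qpow qh (- g c b) *: (E c * tau c (r b)) +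
  hpow qh (g c b) *: (\sum_j pie c j b *: thc c (r j)) +
  qpow qh (g c b) *: (r b * E c).
Proof. by rewrite ffunE [in LHS]ffunE [opQ c r b]ffunE [opP c r b]ffunE [opV c r b]ffunE. Qed.

(** From the diagonal of the new row on, the old row is zero, so both multiplications drop out and
    only the vector representation contributes; [edge_mono] controls which old entry it reads. *)
Lemma Nrow_triangular (a : idx) :
  Nrow a a = 1 /\ (forall b : idx, (a < b)%N -> Nrow a b = 0).
Proof.
elim/(edge_ind k_gt0): a => [a a0|c a j e [Naa Nab]].
  rewrite Nrow0 //; split=> [|b ab]; first by rewrite ffunE a0.
  by rewrite ffunE; case: eqP => // b0; rewrite b0 in ab.
have t0 := linearf0 (taulin c); have th0 := linearf0 (thc_lin c).
have aj := edge_lt k_gt0 e; have nz := edge_coef_neq0 e.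
split=> [|b jb].
  apply: (scalerI nz); rewrite Nrow_edge // opT_entry Nab // t0 mulr0 mul0r.
  rewrite !scaler0 add0r addr0 (pie_sumr qh k_gt0 _ e) Naa /thc th1 if_same.
  by rewrite scalerA mulrC.
apply: (scalerI nz); rewrite Nrow_edge // opT_entry Nab; last exact: ltn_trans jb.
rewrite t0 mulr0 mul0r !scaler0 add0r addr0 big1 ?scaler0 // => i _.
have [ei|] := boolP (edge c i b).
  by rewrite Nab ?th0 ?scaler0 //; apply: (edge_mono k_gt0 e ei).
by rewrite -(edge_pie qh k_gt0) negbK => /eqP->; rewrite scale0r.
Qed.

Section Homogeneous.
Variable hom : wgt k -> bool -> A -> Prop.
Hypothesis hom1 : hom 0 false 1.
Hypothesis hom0 : forall lam p, hom lam p 0.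
Hypothesis homD : forall lam p u v, hom lam p u -> hom lam p v -> hom lam p (u + v).
Hypothesis homZ : forall lam p x u, hom lam p u -> hom lam p (x *: u).
Hypothesis homEr : forall lam p c u,
  hom lam p u -> hom (lam + alpha c) (p (+) lpar c) (u * E c).
Hypothesis homEl : forall lam p c u,
  hom lam p u -> hom (lam + alpha c) (p (+) lpar c) (E c * u).
Hypothesis hom_th : forall lam p u, hom lam p u -> th u = (-1) ^+ p *: u.
Hypothesis hom_tau : forall lam p c u, hom lam p u ->
  tau c u = ((-1) ^+ (lpar c && p) * qpow qh (form (alpha c) lam)) *: u.

Lemma hom_thc lam p c u : hom lam p u -> thc c u = (-1) ^+ (lpar c && p) *: u.
Proof. by move/hom_th => h; rewrite /thc; case: lpar; rewrite ?h ?scale1r. Qed.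

(** The predicate [hom] stays abstract because one induction is to yield membership in the
    subalgebra, the parity, and the weight for both kinds of Cartan generators. *)
Lemma Nrow_hom a b : hom (eps b - eps a) (par a (+) par b) (Nrow a b).
Proof.
elim/(edge_ind k_gt0): a b => [a a0 b|c a j e IH b].
  rewrite Nrow0 // ffunE; case: eqP => b0; last exact: hom0.
  have -> : b = a by apply: ord_inj; rewrite a0 b0.
  by rewrite subrr addbb.
have -> : Nrow j b = (pie c a j * hpow qh (g c j))^-1 *: opT c (Nrow a) b.
  by rewrite -(Nrow_edge b e) scalerK // edge_coef_neq0.
have lamE : eps b - eps j = eps b - eps a + alpha c.
  by rewrite -(edge_alpha e) addrA subrK.
have parE : par j (+) par b = par a (+) par b (+) lpar c.
  by rewrite -(edge_par k_gt0 e); case: (par a); case: (par b); case: (par j).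
apply: homZ; rewrite opT_entry lamE parE; apply: homD; first apply: homD.
- by apply: homZ; rewrite (hom_tau c (IH b)) -scalerAr; apply: homZ; apply: homEl.
- apply: homZ; rewrite -lamE -parE; apply: (big_ind (hom _ _)) => [||i _]; [exact: hom0|exact: homD|].
  have [ei|] := boolP (edge c i b); last first.
    by rewrite -(edge_pie qh k_gt0) negbK => /eqP->; rewrite scale0r; apply: hom0.
  rewrite (hom_thc c (IH i)); do 2!apply: homZ.
  have -> : eps b - eps j = eps i - eps a.
    by rewrite lamE -(edge_alpha ei) addrC addrA subrK.
  have -> // : par j (+) par b = par a (+) par i.
  rewrite parE -(edge_par k_gt0 ei).
  by case: (par a); case: (par b); case: (par i).
- by apply: homZ; apply: homEr.
Qed.

(** The entry has weight [eps b - eps a], so the scalar of [tau c] turns the power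
    [q^(-(alpha_c, eps b))] of [opQ] into [q^(-(alpha_c, eps a))]. Here [tau] and [th] disappear
    from the relation. *)
Lemma Nrow_relation c a b :
  qpow qh (g c b) *: (Nrow a b * E c) -
  ((-1) ^+ (lpar c && (par a (+) par b)) * qpow qh (- g c a)) *:
    (E c * Nrow a b) +
  hpow qh (g c b) *: \sum_i pie c i b *:
    ((-1) ^+ (lpar c && (par a (+) par i)) *: Nrow a i) =
  \sum_j pie c a j *: (hpow qh (g c j) *: Nrow j b).
Proof.
have -> : \sum_j pie c a j *: (hpow qh (g c j) *: Nrow j b) = opT c (Nrow a) b.
  by rewrite opT_Nrow sum_ffunE; apply: eq_bigr => j _; rewrite !ffunE.
rewrite opT_entry (hom_tau c (Nrow_hom a b)).
have -> : \sum_i pie c i b *: ((-1) ^+ (lpar c && (par a (+) par i)) *: Nrow a i) =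
    \sum_i pie c i b *: thc c (Nrow a i).
  by apply: eq_bigr => i _; rewrite (hom_thc c (Nrow_hom a i)).
rewrite formDr formNr [g c b - g c a]addrC (qpowD qh0 (- g c a)) -scalerAr.
have := qpow_neq0 qh0 (g c b); rewrite (qpowN qh (g c b)) => nz.
by lmod F; field.
Qed.

End Homogeneous.

End Rows.

(** * The induction relations *)

Section InductionAlgebra.
Variables (F : numFieldType) (A : algType F).
Implicit Types (E u v w x y : A).

Ltac alg_expand :=
  do 4!rewrite ?(mulrDl, mulrDr, mulrN, mulNr) -?(scalerAl, scalerAr).

Lemma solve_scaled (c : F) u v : c != 0 -> c *: u = v -> u = c^-1 *: v.
Proof. by move=> c0 <-; rewrite scalerA mulVf // scale1r. Qed.

(** For an edge [c -> a], with [x], [w], [y] the entries [N c b], [N a c], [N a b]. The generator is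
    a multiple of [w], and [y] is a q-commutator of [x] with the generator. *)
Lemma alg_base_low (E x w y : A) (ph qb qc s n kap : F) :
  ph != 0 -> kap = n * (qc - qc^-1) ->
  qb *: (x * E) - (s * qc^-1) *: (E * x) = ph *: y ->
  (qc - qc^-1) *: E = ph *: w ->
  kap *: y = n *: (qb *: (x * w) - (qc^-1 * s) *: (w * x)).
Proof.
move=> ph0 -> /esym/(solve_scaled ph0)-> /esym/(solve_scaled ph0)->.
rewrite -!(scalerAl, scalerAr); move: (qc^-1) => qi.
by lmod F; field.
Qed.

(** For an edge [b -> c], with [v], [w], [y] the entries [N c b], [N a c], [N a b]; now the
    generator is a multiple of [v]. *)
Lemma alg_base_high (E v w y : A) (P qa qc n kap : F) (bs bt : bool) :
  P != 0 -> qa != 0 -> n * kap = qc^-1 - qc -> n * n = 1 ->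
  qc *: (w * E) - ((-1) ^+ bs * qa^-1) *: (E * w) +
    (P * (-1) ^+ bt) *: y = 0 ->
  (qc - qc^-1) *: E + (P * (-1) ^+ (bs (+) bt)) *: v = 0 ->
  kap *: y = n *: (qa^-1 *: (v * w) - ((-1) ^+ bs * qc) *: (w * v)).
Proof.
move=> P0 qa0 kapE nn h1 h2.
have sgn0 b : P * (-1) ^+ b != 0 by rewrite mulf_neq0 ?signr_eq0.
have kapn : kap = n * (qc^-1 - qc) by rewrite -kapE mulrA nn mul1r.
move: h1 => /eqP; rewrite addrC addr_eq0 => /eqP/(solve_scaled (sgn0 _))->.
move: h2 => /eqP; rewrite addrC addr_eq0 => /eqP/(solve_scaled (sgn0 _))->.
rewrite kapn; move: (qc^-1) => qi.
case: bs; case: bt => /=; rewrite ?expr0 ?expr1.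
all: by alg_expand; lmod F; field; rewrite ?P0 ?qa0.
Qed.

(** For an edge [a' -> a]: [u], [v], [w] are [N a' b], [N c b], [N a' c], and [y], [w'] are [N a b],
    [N a c]. The terms [y2], [v2] lie in column [bar a]; their coefficients [e1], [e3] are nonzero
    only for [b = bar a']. *)
Lemma alg_step_low (E u v w y w' y2 v2 : A) (ph qa qb e1 e3 X Y X2 Y2 n kap : F)
    (b2 b3 : bool) :
  ph != 0 -> qa != 0 -> qb != 0 -> kap != 0 ->
  kap *: u = n *: (X *: (v * w) - Y *: (w * v)) ->
  qb *: (u * E) - ((-1) ^+ (b2 (+) b3) * qa^-1) *: (E * u) + e1 *: y2 = ph *: y ->
  w * E - ((-1) ^+ b2 * qa^-1) *: (E * w) = ph *: w' ->
  qb *: (v * E) - (-1) ^+ b3 *: (E * v) + e3 *: v2 = 0 ->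
  e1 *: (kap *: y2) = e1 *: (n *: (X2 *: (v2 * w) - Y2 *: (w * v2))) ->
  e1 * X2 = X * (-1) ^+ b2 * e3 * qa^-1 -> e1 * Y2 = Y * e3 ->
  kap *: y = n *: ((X * qb) *: (v * w') - (Y * (-1) ^+ b3) *: (w' * v)).
Proof.
move=> ph0 qa0 qb0 kap0 /(solve_scaled kap0) uE.
move=> /esym/(solve_scaled ph0) yE /esym/(solve_scaled ph0)->.
rewrite -addrA => /eqP; rewrite addr_eq0 => /eqP/(solve_scaled qb0) vE h4 eX eY.
have vEz z : v * (E * z) = qb^-1 *: - ((- ((-1) ^+ b3 *: (E * v)) + e3 *: v2) * z).
  by rewrite mulrA vE -scalerAl mulNr.
have -> : kap *: y = (kap / ph) *: (qb *: (u * E) -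
    ((-1) ^+ (b2 (+) b3) * qa^-1) *: (E * u)) + ph^-1 *: (e1 *: (kap *: y2)).
  by rewrite yE; lmod F; field; rewrite ?ph0 ?qa0.
have {}h4 : e1 *: (kap *: y2) = (n * (e1 * X2)) *: (v2 * w) -
    (n * (e1 * Y2)) *: (w * v2).
  by rewrite h4; lmod F; ring.
rewrite h4 eX eY uE; clear - vE vEz ph0 qa0 qb0 kap0.
alg_expand.
rewrite -!mulrA vE !vEz.
alg_expand; rewrite -!mulrA; rewrite signr_addb.
clear vE vEz; case: b2; case: b3; rewrite ?expr0 ?expr1.
all: by lmod F; field; rewrite ?ph0 ?qa0 ?qb0 ?kap0.
Qed.

(** For an edge [b -> b']: [u], [v], [w] are [N a b'], [N c b'], [N a c], and [y], [v'] are [N a b],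
    [N c b]. The terms [y2], [w2] lie in row [bar b], with coefficient [e] nonzero only for
    [a = bar b']. *)
Lemma alg_step_high (E u v w y v' y2 w2 : A) (P qa qb e X Y X2 Y2 n kap : F)
    (b1 b2 b3 : bool) :
  P != 0 -> qa != 0 -> qb != 0 -> kap != 0 ->
  kap *: u = n *: (X *: (v * w) - Y *: (w * v)) ->
  qb *: (u * E) - ((-1) ^+ (b2 (+) b3) * qa^-1) *: (E * u) +
    (P * (-1) ^+ b1) *: y = e *: y2 ->
  w * E - ((-1) ^+ b2 * qa^-1) *: (E * w) = e *: w2 ->
  qb *: (v * E) - (-1) ^+ b3 *: (E * v) + (P * (-1) ^+ (b1 (+) b2)) *: v' = 0 ->
  e *: (kap *: y2) = e *: (n *: (X2 *: (v * w2) - Y2 *: (w2 * v))) ->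
  e * X2 = e * X * qb -> e * Y2 = e * Y * (-1) ^+ b3 ->
  kap *: y = n *: ((X * qa^-1) *: (v' * w) - (Y * (-1) ^+ b2) *: (w * v')).
Proof.
move=> P0 qa0 qb0 kap0 /(solve_scaled kap0) uE h1 h2 h3 h4 eX eY.
have sgn0 b : P * (-1) ^+ b != 0 by rewrite mulf_neq0 ?signr_eq0.
have yE : (P * (-1) ^+ b1) *: y = e *: y2 - (qb *: (u * E) -
    ((-1) ^+ (b2 (+) b3) * qa^-1) *: (E * u)).
  by rewrite -h1 addrC addKr.
have {}yE : kap *: y = (P * (-1) ^+ b1)^-1 *: (e *: (kap *: y2) -
    kap *: (qb *: (u * E) - ((-1) ^+ (b2 (+) b3) * qa^-1) *: (E * u))).
  rewrite (solve_scaled (sgn0 b1) yE); move: (_^-1) => Pi.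
  by lmod F; ring.
have v'E := h3; move: v'E => /eqP; rewrite addrC addr_eq0 => /eqP.
move=> /(solve_scaled (sgn0 _)) v'E.
have vE : v * E = qb^-1 *: ((-1) ^+ b3 *: (E * v) -
    (P * (-1) ^+ (b1 (+) b2)) *: v').
  by apply: solve_scaled => //; rewrite v'E scalerA mulfV // scale1r opprK addrCA subrr addr0.
have wE : w * E = ((-1) ^+ b2 * qa^-1) *: (E * w) + e *: w2.
  by rewrite -h2 addrC subrK.
have vEz z : v * (E * z) = qb^-1 *: ((-1) ^+ b3 *: (E * v) -
    (P * (-1) ^+ (b1 (+) b2)) *: v') * z.
  by rewrite mulrA vE.
have wEz z : w * (E * z) = (((-1) ^+ b2 * qa^-1) *: (E * w) + e *: w2) * z.
  by rewrite mulrA wE.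
have {}h4 : e *: (kap *: y2) = (n * (e * X2)) *: (v * w2) -
    (n * (e * Y2)) *: (w2 * v).
  by rewrite h4; lmod F; ring.
rewrite yE h4 eX eY uE; clear - vE vEz wE wEz P0 qa0 qb0 kap0.
alg_expand.
rewrite -?mulrA vE wE.
alg_expand.
rewrite -?mulrA !vEz !wEz.
alg_expand.
rewrite -?mulrA !signr_addb.
clear vE vEz wE wEz; case: b1; case: b2; case: b3; rewrite ?expr0 ?expr1.
all: by lmod F; field; rewrite ?P0 ?qa0 ?qb0 ?kap0.
Qed.

End InductionAlgebra.

Section InductionRelations.
Variables (k : nat) (F : numFieldType) (qh : F) (A : algType F).
Hypotheses (k_gt0 : (0 < k)%N) (qh0 : qh != 0).

Notation label := (label k).
Notation idx := (idx k).
Notation pie := (@pie k F qh).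
Notation g c b := (form (alpha c) (eps b)).
Notation f a b := (form (eps a) (eps b)).
Notation kap := (qpow qh 1 - qpow qh (-1)).
Implicit Types (l : label) (a b c : idx).
Hypothesis kap0 : kap != 0.

Variables (E : label -> A) (N : idx -> idx -> A).
Hypothesis N1 : forall a, N a a = 1.
Hypothesis Nrel : forall l a b,
  qpow qh (g l b) *: (N a b * E l) -
  ((-1) ^+ (lpar l && (par a (+) par b)) * qpow qh (- g l a)) *:
    (E l * N a b) +
  hpow qh (g l b) *: (\sum_i pie l i b *:
    ((-1) ^+ (lpar l && (par a (+) par i)) *: N a i)) =
  \sum_j pie l a j *: (hpow qh (g l j) *: N j b).

#[local] Opaque Defs.form.

Lemma kap_sign (b : bool) : kap = (-1) ^+ b * (qpow qh ((-1) ^+ b) - (qpow qh ((-1) ^+ b))^-1).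
Proof. by rewrite -(qpowN qh); case: b; rewrite ?expr1 ?expr0 ?opprK; ring. Qed.

(** The induction relation multiplied by [kap ^+ 2 * (-1) ^+ par b], so that it speaks of entries of
    [N]; the leading sign offsets the one in [N a c]. *)
Definition induction_at b c a : Prop :=
  kap *: N a b = (-1) ^+ par c *:
    (qpow qh (- f b a) *: (N c b * N a c) -
     (qpow qh (- f c c) * (-1) ^+ ((par b (+) par c) && (par a (+) par c))) *:
       (N a c * N c b)).

Lemma edge_coef0 l a b : edge l a b -> pie l a b * hpow qh (g l b) != 0.
Proof. by move=> e; rewrite mulf_neq0 ?edge_pie ?hpow_neq0. Qed.

(** At the diagonal entry [N a a = 1] the q-commutator degenerates to a multiple of the
    generator. *)
Lemma Nrel_diag l a : (forall i, ~~ edge l i a) -> forall b, edge l a b ->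
  (qpow qh (g l a) - (qpow qh (g l a))^-1) *: E l =
  (pie l a b * hpow qh (g l b)) *: N b a.
Proof.
move=> np b e; have := Nrel l a a.
rewrite (pie_sumr0 qh k_gt0 _ np) (pie_sum qh k_gt0 _ e) N1 addbb andbF.
rewrite mulr1 mul1r (qpowN qh) mul1r scaler0 addr0 -scalerBl => ->.
by rewrite scalerA.
Qed.

Lemma induction_base_low l a b c : edge l c a ->
  b != c -> b != bar c -> b != a -> induction_at b c a.
Proof.
move=> e bc bc' ba; have ph0 := edge_coef0 e.
have np := no_pred e ba bc'.
have npc := no_pred e (edge_neq k_gt0 e) (self_bar_neq k_gt0 c).
have H2 := Nrel_diag npc e.
have := Nrel l c b; rewrite (pie_sumr0 qh k_gt0 _ np) (pie_sum qh k_gt0 _ e).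
rewrite scaler0 addr0 scalerA (qpowN qh) => H1.
have gc : g l c = (-1) ^+ par c.
  have ac : a != c by rewrite eq_sym (edge_neq k_gt0 e).
  by rewrite (form_edge c e) (form_eps_self k_gt0) (form_eps_other k_gt0 ac (neq_bar_sym (edge_bar_neq k_gt0 e))) subr0.
have gb : g l b = - f b a.
  by rewrite (form_edge b e) formC (form_eps_other k_gt0 bc bc') sub0r formC.
have kapE : kap = (-1) ^+ par c * (qpow qh (g l c) - (qpow qh (g l c))^-1).
  by rewrite gc -kap_sign.
have := alg_base_low ph0 kapE H1 H2.
rewrite gb -(qpowN qh (g l c)) gc -(form_eps_self k_gt0).
rewrite -(edge_par k_gt0 e) /induction_at [par c (+) par a]addbC.
by rewrite [par c (+) par b]addbC andbC.
Qed.

Lemma induction_base_high l a b c : edge l b c ->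
  a != c -> a != bar c -> a != b -> induction_at b c a.
Proof.
move=> e ac ac' ab.
have ns := no_succ e ab ac'.
have nsc : forall i, ~~ edge l c i.
  by apply: (no_succ e) (self_bar_neq k_gt0 c); rewrite eq_sym (edge_neq k_gt0 e).
have P0 := edge_coef0 e.
have := Nrel l c c; rewrite (pie_sum0 qh k_gt0 _ nsc) (pie_sumr qh k_gt0 _ e).
rewrite N1 addbb andbF mulr1 mul1r mul1r (qpowN qh) -scalerBl !scalerA.
rewrite [hpow _ _ * pie _ _ _]mulrC => H2.
have := Nrel l a c; rewrite (pie_sum0 qh k_gt0 _ ns) (pie_sumr qh k_gt0 _ e) !scalerA.
rewrite [hpow _ _ * pie _ _ _]mulrC (qpowN qh) => H1.
have gc : g l c = - (-1) ^+ par c.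
  by rewrite (form_edge c e) (form_eps_self k_gt0) (form_eps_other k_gt0 (edge_neq k_gt0 e) (edge_bar_neq k_gt0 e)) sub0r.
have ga : g l a = f b a.
  by rewrite (form_edge a e) (formC (eps c)) (form_eps_other k_gt0 ac ac') subr0.
have kapE : (-1) ^+ par c * kap = (qpow qh (g l c))^-1 - qpow qh (g l c).
  rewrite (kap_sign (par c)) mulrA -signr_addb addbb mul1r gc (qpowN qh).
  by rewrite invrK.
have nn : (-1) ^+ par c * (-1) ^+ par c = 1 :> F by rewrite -signr_addb addbb.
rewrite (_ : lpar l && (par c (+) par b) =
  (lpar l && (par a (+) par c)) (+) (lpar l && (par a (+) par b))) in H2; last first.
  by case: lpar => //; do 3!case: par.
have := alg_base_high P0 (qpow_neq0 qh0 _) kapE nn H1 H2.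
rewrite ga -(qpowN qh (f b a)) gc -(form_eps_self k_gt0) -(edge_par k_gt0 e) /induction_at.
by rewrite [qpow _ _ * _]mulrC.
Qed.

(** The label does not move [c], so [N c b] q-commutes with the generator up to a term in column
    [bar a]. That term occurs when [b = bar a'], where the same label has the edge [bar a -> b], and
    accounts for the last hypothesis. *)
Lemma induction_step_low l a a' b c : edge l a' a ->
  c != a' -> c != a -> c != bar a -> c != bar a' -> b != a' -> b != a ->
  induction_at b c a' -> (b = bar a' -> induction_at (bar a) c a') ->
  induction_at b c a.
Proof.
move=> e ca' ca cba cba' ba' ba Q Q'.
have ph0 := edge_coef0 e.
have npc := no_pred e ca cba'.
have nsc := no_succ e ca' cba.
have gc : g l c = 0.
  rewrite (form_edge c e) formC (form_eps_other k_gt0 ca' cba').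
  by rewrite formC (form_eps_other k_gt0 ca cba) subr0.
pose e1 := if b == bar a' then
  hpow qh (g l b) * pie l (bar a) b * (-1) ^+ (lpar l && (par a' (+) par (bar a))) else 0 : F.
pose e3 := if b == bar a' then
  hpow qh (g l b) * pie l (bar a) b * (-1) ^+ (lpar l && (par c (+) par (bar a))) else 0 : F.
have sumE (h : idx -> A) (s : idx -> F): 
    hpow qh (g l b) *: (\sum_i pie l i b *: (s i *: h i)) =
    (if b == bar a' then hpow qh (g l b) * pie l (bar a) b * s (bar a) else 0)
      *: h (bar a) :> A.
  have [->|nb] := eqVneq b (bar a').
    by rewrite (pie_sumr qh k_gt0 _ (edge_bar e)) !scalerA.
  by rewrite (pie_sumr0 qh k_gt0 _ (no_pred e ba nb)) scaler0 scale0r.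
have b23 : (lpar l && (par a' (+) par c)) (+) (lpar l && (par c (+) par b)) =
    lpar l && (par a' (+) par b).
  by case: lpar => //; do 3!case: par.
have := Nrel l a' b; rewrite (pie_sum qh k_gt0 _ e) sumE scalerA (qpowN qh) -b23.
move=> H1.
have := Nrel l a' c; rewrite (pie_sum qh k_gt0 _ e) (pie_sumr0 qh k_gt0 _ npc).
rewrite scaler0 addr0 scalerA gc (qpow0 qh0) scale1r (qpowN qh) => H2.
have := Nrel l c b; rewrite (pie_sum0 qh k_gt0 _ nsc) sumE gc oppr0 (qpow0 qh0) mulr1.
move=> H3.
have H4 : e1 *: (kap *: N a' (bar a)) = e1 *: ((-1) ^+ par c *:
    (qpow qh (- f (bar a) a') *: (N c (bar a) * N a' c) -
     (qpow qh (- f c c) *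
       (-1) ^+ ((par (bar a) (+) par c) && (par a' (+) par c))) *:
       (N a' c * N c (bar a)))).
  rewrite /e1; case: eqP => [bE|_]; last by rewrite !scale0r.
  by rewrite (Q' bE).
have faa' : f (bar a) a' = 0.
  have aa' : a != a' by rewrite eq_sym (edge_neq k_gt0 e).
  rewrite formC form_eps_bar formC (form_eps_other k_gt0 aa') ?oppr0 //.
  exact: neq_bar_sym (edge_bar_neq k_gt0 e).
have lE := edge_par k_gt0 e.
have eX : e1 * qpow qh (- f (bar a) a') =
    qpow qh (- f b a') * (-1) ^+ (lpar l && (par a' (+) par c)) * e3 *
    (qpow qh (g l a'))^-1.
  rewrite /e1 /e3; case: eqP => [->|_]; last by rewrite mulr0 !mul0r.
  rewrite faa' oppr0 (qpow0 qh0) mulr1 (formC (eps (bar a'))) (form_eps_bar (eps a') a') opprK.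
  have -> : g l a' = f a' a'.
    have aa' : a != a' by rewrite eq_sym (edge_neq k_gt0 e).
    by rewrite (form_edge a' e) (form_eps_other k_gt0 aa' (neq_bar_sym (edge_bar_neq k_gt0 e))) subr0.
  rewrite (par_bar k_gt0).
  have -> : lpar l && (par a' (+) par a) =
     (lpar l && (par a' (+) par c)) (+) (lpar l && (par c (+) par a)).
    by case: lpar => //; do 3!case: par.
  by rewrite signr_addb; field; rewrite (qpow_neq0 qh0).
have eY : e1 * (qpow qh (- f c c) *
       (-1) ^+ ((par (bar a) (+) par c) && (par a' (+) par c))) =
    qpow qh (- f c c) * (-1) ^+ ((par b (+) par c) && (par a' (+) par c)) * e3.
  rewrite /e1 /e3; case: eqP => [->|_]; last by rewrite mulr0 !mul0r.
  rewrite !(par_bar k_gt0) -lE.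
  by do 3!case: par => /=; rewrite ?expr0 ?expr1; ring.
have := alg_step_low ph0 (qpow_neq0 qh0 _) (qpow_neq0 qh0 _) kap0 Q H1 H2 H3 H4 eX eY.
rewrite -(qpowD qh0) -mulrA -signr_addb /induction_at => ->.
congr (_ *: _); congr (qpow _ _ *: _ - (_ * (-1) ^+ _) *: _).
  by rewrite (form_edge b e) (formC (eps b) (eps a')) (formC (eps b)) addKr.
by rewrite -lE; do 4!case: par.
Qed.

Lemma induction_step_high l a b b' c : edge l b b' ->
  c != b -> c != b' -> c != bar b -> c != bar b' -> a != b -> a != b' ->
  induction_at b' c a -> (a = bar b' -> induction_at b' c (bar b)) ->
  induction_at b c a.
Proof.
move=> e cb cb' cbb cbb' ab ab' Q Q'.
have P0 := edge_coef0 e.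
have npc := no_pred e cb' cbb.
have nsc := no_succ e cb cbb'.
have gc : g l c = 0.
  rewrite (form_edge c e) formC (form_eps_other k_gt0 cb cbb).
  by rewrite formC (form_eps_other k_gt0 cb' cbb') subr0.
pose ee := if a == bar b' then pie l a (bar b) * hpow qh (g l (bar b)) else 0 : F.
have sumE (h : idx -> A) :
    \sum_j pie l a j *: (hpow qh (g l j) *: h j) = ee *: h (bar b).
  rewrite /ee; case: eqP => [->|/eqP na].
    by rewrite (pie_sum qh k_gt0 _ (edge_bar e)) !scalerA.
  by rewrite (pie_sum0 qh k_gt0 _ (no_succ e ab na)) scale0r.
have b23 : (lpar l && (par a (+) par c)) (+) (lpar l && (par c (+) par b')) =
    lpar l && (par a (+) par b').
  by case: lpar => //; do 3!case: par.
have := Nrel l a b'; rewrite sumE (pie_sumr qh k_gt0 _ e) !scalerA (qpowN qh) -b23.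
rewrite [hpow _ _ * pie _ _ _]mulrC => H1.
have := Nrel l a c; rewrite sumE (pie_sumr0 qh k_gt0 _ npc).
rewrite scaler0 addr0 gc (qpow0 qh0) scale1r (qpowN qh) => H2.
have := Nrel l c b'; rewrite (pie_sum0 qh k_gt0 _ nsc) (pie_sumr qh k_gt0 _ e) !scalerA.
rewrite gc oppr0 (qpow0 qh0) mulr1 [hpow _ _ * pie _ _ _]mulrC.
rewrite (_ : lpar l && (par c (+) par b) =
  (lpar l && (par a (+) par b)) (+) (lpar l && (par a (+) par c))); last first.
  by case: lpar => //; do 3!case: par.
move=> H3.
have H4 : ee *: (kap *: N (bar b) b') = ee *: ((-1) ^+ par c *:
    (qpow qh (- f b' (bar b)) *: (N c b' * N (bar b) c) -
     (qpow qh (- f c c) *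
       (-1) ^+ ((par b' (+) par c) && (par (bar b) (+) par c))) *:
       (N (bar b) c * N c b'))).
  rewrite /ee; case: eqP => [aE|_]; last by rewrite !scale0r.
  by rewrite (Q' aE).
have lE := edge_par k_gt0 e.
have fbb' : f b b' = 0 := form_eps_other k_gt0 (edge_neq k_gt0 e) (edge_bar_neq k_gt0 e).
have eX : ee * qpow qh (- f b' (bar b)) =
    ee * qpow qh (- f b' a) * qpow qh (g l b').
  rewrite /ee; case: eqP => [->|_]; last by rewrite !mul0r.
  rewrite (form_eps_bar (eps b') b) (form_eps_bar (eps b') b') (formC (eps b') (eps b)) fbb' !oppr0 opprK (qpow0 qh0) -[RHS]mulrA -(qpowD qh0).
  by rewrite (form_edge b' e) fbb' sub0r subrr (qpow0 qh0).
have eY : ee * (qpow qh (- f c c) *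
       (-1) ^+ ((par b' (+) par c) && (par (bar b) (+) par c))) =
    ee * (qpow qh (- f c c) * (-1) ^+ ((par b' (+) par c) && (par a (+) par c)))
      * (-1) ^+ (lpar l && (par c (+) par b')).
  rewrite /ee; case: eqP => [->|_]; last by rewrite !mul0r.
  rewrite !(par_bar k_gt0) -lE.
  by do 3!case: par => /=; rewrite ?expr0 ?expr1; ring.
have := alg_step_high P0 (qpow_neq0 qh0 _) (qpow_neq0 qh0 _) kap0 Q H1 H2 H3 H4 eX eY.
rewrite -(qpowN qh) -(qpowD qh0) -mulrA -signr_addb /induction_at => ->.
congr (_ *: _); congr (qpow _ _ *: _ - (_ * (-1) ^+ _) *: _).
  by rewrite (form_edge a e) (formC (eps b')) opprB addrCA; ring.
by rewrite -lE; do 4!case: par.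
Qed.

Lemma induction_all b c a : (b < c)%N -> (c < a)%N -> c != bar b -> c != bar a ->
  induction_at b c a.
Proof.
have neq (x y : idx) : (x < y)%N -> (x != y) * (y != x).
  by move=> xy; split; rewrite -(inj_eq (@ord_inj _)); lia.
move: {2}(a - b)%N (leqnn (a - b)) => n.
elim: n a b => [|n IH] a b; first by lia.
move=> abn bc ca cb' ca'.
have ba : (b < a)%N by apply: ltn_trans bc ca.
have ne0 := (neq _ _ bc, neq _ _ ca, neq _ _ ba).
have [[l e]|[l [a' [e ca1]]]] := pred_above k_gt0 ca ca'.
  by apply: (induction_base_low e); rewrite ?ne0 //; apply: neq_bar_sym.
have [[m em]|[m [b' [em bc1]]]] := succ_below k_gt0 bc cb'.
  by apply: (induction_base_high em); rewrite ?ne0 //; apply: neq_bar_sym.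
have a'a := edge_lt k_gt0 e; have bb' := edge_lt k_gt0 em.
have ba' := ltn_trans bc ca1; have b'a := ltn_trans bc1 ca.
have ne := (ne0, neq _ _ a'a, neq _ _ bb', neq _ _ ba', neq _ _ b'a,
  neq _ _ ca1, neq _ _ bc1).
have abar : a != bar a' by apply/neq_bar_sym/(edge_bar_neq k_gt0 e).
have bbar : b != bar b' := edge_bar_neq k_gt0 em.
have low : c != bar a' -> (b = bar a' -> induction_at (bar a) c a') ->
    induction_at b c a.
  move=> h1 h2; apply: (induction_step_low e); rewrite ?ne //.
  by apply: IH; rewrite // -ltnS (leq_trans _ abn) // ltn_sub2r.
have high : c != bar b' -> (a = bar b' -> induction_at b' c (bar b)) ->
    induction_at b c a.
  move=> h1 h2; apply: (induction_step_high em); rewrite ?ne //.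
  by apply: IH; rewrite // -ltnS (leq_trans _ abn) // ltn_sub2l.
(* The step at [a] needs [c != bar a'], the step at [b] needs [c != bar b']; at most one of these
   fails, since [b' < c < a']. *)
have [c1|c1] := eqVneq c (bar a'); last first.
  have [b1|b1] := eqVneq b (bar a'); last by apply: low => // /eqP; rewrite (negPf b1).
  (* With [b = bar a'] and [c = bar b'], the mirror image of [b -> b'] is an edge [c -> a'], so the
     additional instance is a base case. *)
  have [c2|c2] := eqVneq c (bar b').
    have e2 : edge m c a' by rewrite c2 -(barK a') -b1; apply: edge_bar.
    apply: low => // _; apply: (induction_base_low e2).
    - by rewrite eq_sym.
    - by rewrite (inj_eq (@bar_inj _)) ne.
    by rewrite bar_eq.
  (* The equality [a = bar b'] would give [b' = bar a < bar a' = b]. *)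
  apply: high => // a2.
  by have := edge_lt k_gt0 (edge_bar e); rewrite -b1 a2 barK ltnNge ltnW.
apply: high => [|a1].
  by rewrite c1 (inj_eq (@bar_inj _)) (neq _ _ (ltn_trans bc1 ca1)).
(* With [a = bar b'] and [c = bar a'], this is the mirror image of [a' -> a]; the additional
   instance is again a base case. *)
have e2 : edge l b' c by rewrite c1 -(barK b') -a1; apply: edge_bar.
apply: (induction_base_high e2).
- by rewrite eq_sym.
- by rewrite (inj_eq (@bar_inj _)) ne.
by rewrite bar_eq.
Qed.

End InductionRelations.

(** * The operators sigma_ba *)

Section SimpleOperators.
Variables (k : nat) (F : numFieldType) (qh : F) (A : algType F).
Hypotheses (k_gt0 : (0 < k)%N) (qh0 : qh != 0).

Notation label := (label k).
Notation idx := (idx k).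
Notation pie := (@pie k F qh).
Notation g c b := (form (alpha c) (eps b)).
Notation f a b := (form (eps a) (eps b)).
Notation kap := (qpow qh 1 - qpow qh (-1)).
Implicit Types (l : label) (a b c : idx).
Hypothesis kap0 : kap != 0.

Variables (E : label -> A) (N sg : idx -> idx -> A).
Hypothesis N1 : forall a, N a a = 1.
Hypothesis N0 : forall a b, (a < b)%N -> N a b = 0.
Hypothesis Nrel : forall l a b,
  qpow qh (g l b) *: (N a b * E l) -
  ((-1) ^+ (lpar l && (par a (+) par b)) * qpow qh (- g l a)) *:
    (E l * N a b) +
  hpow qh (g l b) *: (\sum_i pie l i b *:
    ((-1) ^+ (lpar l && (par a (+) par i)) *: N a i)) =
  \sum_j pie l a j *: (hpow qh (g l j) *: N j b).
Hypothesis Nsg : forall b a, (b < a)%N -> N a b = (kap * (-1) ^+ par b) *: sg b a.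

#[local] Opaque Defs.form.

(** Both edges of a label give multiples of the same generator, which is why the simple operators
    come in proportional pairs. *)
Lemma edge_sigma l a b : edge l a b ->
  E l = (pie l a b * hpow qh (- (-1) ^+ par b)) *: sg a b.
Proof.
move=> e; have ab := edge_neq k_gt0 e; have ab' := edge_bar_neq k_gt0 e.
have np := no_pred e ab (self_bar_neq k_gt0 a).
have := Nrel_diag k_gt0 N1 Nrel np e; rewrite (Nsg (edge_lt k_gt0 e)) !(form_edge _ e).
rewrite (form_eps_self k_gt0) (form_eps_other k_gt0 ab ab') (formC (eps b)) (form_eps_other k_gt0 ab ab') subr0 sub0r.
rewrite (form_eps_self k_gt0) => h.
have kp0 : kap * (-1) ^+ par a != 0 by rewrite mulf_neq0 ?signr_eq0.
have kapE : kap * (-1) ^+ par a = qpow qh ((-1) ^+ par a) - (qpow qh ((-1) ^+ par a))^-1.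
  by rewrite (kap_sign qh (par a)) mulrC mulrA -signr_addb addbb mul1r.
apply: (scalerI kp0); rewrite {1}kapE h !scalerA; congr (_ *: _).
exact: mulrC.
Qed.

Lemma sigma_src l :
  sg (src l) (dst l) = hpow qh (if lpar l then 1 else -1) *: E l.
Proof.
rewrite (edge_sigma (edge_src l)) (pie_src _ k_gt0) mul1r scalerA -(hpowD qh0).
rewrite par_dst //; case: lpar => /=; rewrite ?expr0 ?expr1.
  by rewrite subrr hpow0 scale1r.
by rewrite opprK addNr hpow0 scale1r.
Qed.

Lemma sigma_bar l :
  (sgk F l * qpow qh 1) *: sg (bar (dst l)) (bar (src l)) = hpow qh 1 *: E l.
Proof.
rewrite (edge_sigma (edge_bar_dst l)) (pie_bar_dst _ k_gt0) scalerA.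
rewrite (par_bar k_gt0) par_src // expr1 opprK qpow_hpow //; congr (_ *: _).
by ring.
Qed.

(** Take the relation for t in the row of delta_k and the column of epsilon_1. The entry of [N]
    there lies above the diagonal, and t has no edge into that column, so the row of -epsilon_1
    vanishes in it. *)
Lemma sigma_ev : sg (ev 1) (bar (ev 1)) = 0.
Proof.
have e : edge (lab_t : label) (src lab_t) (bar (ev 1)) := edge_src lab_t.
have lt1 : (src (lab_t : label) < (ev 1 : idx))%N by rewrite val_src // val_ev1 /=; lia.
have lt2 : ((ev 1 : idx) < bar (ev 1 : idx))%N by rewrite val_bar // val_ev1; lia.
have np i : ~~ edge (lab_t : label) i (ev 1).
  apply/negP => /edgeP[] [_] /(congr1 (@nat_of_ord _)).
    by rewrite /dst val_bar // val_ev1; lia.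
  by rewrite val_bar val_ev1 val_src //=; lia.
have := Nrel lab_t (src lab_t) (ev 1).
rewrite (pie_sum qh k_gt0 _ e) (pie_sumr0 qh k_gt0 _ np) N0 // mul0r mulr0 !scaler0.
rewrite subr0 addr0 scalerA (Nsg lt2) scalerA => /esym/eqP.
rewrite scaler_eq0 !mulf_eq0 signr_eq0 (negPf kap0) !orbF.
by rewrite (negPf (hpow_neq0 qh0 _)) (pie_src _ k_gt0) oner_eq0 => /eqP.
Qed.

(** The two weight conditions rule out edges of [l] out of [a] and into [b], so both sums in the
    relation for [N] are empty. *)
Lemma sigma_qcomm l b a : (b < a)%N ->
  (forall x, eps a - alpha l != eps x) -> (forall x, eps b + alpha l != eps x) ->
  qpow qh (g l b) *: (sg b a * E l) -
  ((-1) ^+ ((par a (+) par b) && lpar l) * qpow qh (- g l a)) *: (E l * sg b a) = 0.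
Proof.
move=> ba ha hb.
have ns i : ~~ edge l a i.
  by apply/negP => e; have := ha i; rewrite -(edge_alpha e) opprB addrC subrK eqxx.
have np i : ~~ edge l i b.
  by apply/negP => e; have := hb i; rewrite -(edge_alpha e) addrC subrK eqxx.
have := Nrel l a b.
rewrite (pie_sum0 qh k_gt0 _ ns) (pie_sumr0 qh k_gt0 _ np) scaler0 addr0 (Nsg ba) andbC.
have kp0 : kap * (-1) ^+ par b != 0 by rewrite mulf_neq0 ?signr_eq0.
move=> h; apply: (scalerI kp0); rewrite scaler0 -h -scalerAl -scalerAr scalerBr.
by rewrite !scalerA; congr (_ *: _ - _ *: _); rewrite mulrC.
Qed.

Lemma sigma_induction b c a : (b < c)%N -> (c < a)%N -> c != bar b -> c != bar a ->
  sg b a = qpow qh (- f b a) *: (sg b c * sg c a) -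
    (qpow qh (- f c c) * (-1) ^+ ((par b (+) par c) && (par a (+) par c))) *:
      (sg c a * sg b c).
Proof.
move=> bc ca cb ca'; have ba := ltn_trans bc ca.
have := induction_all k_gt0 qh0 kap0 N1 Nrel bc ca cb ca'.
rewrite /induction_at !Nsg // -!scalerAl -!scalerAr !scalerA.
have kp0 : kap * kap * (-1) ^+ par b != 0.
  by rewrite !mulf_neq0 ?signr_eq0.
rewrite mulrA => h; apply: (scalerI kp0); rewrite h.
rewrite !scalerBr !scalerA; congr (_ *: _ - _ *: _);
  by case: (par c); rewrite /= ?expr0 ?expr1; ring.
Qed.

End SimpleOperators.

(** * The simple values and the induction relations determine the family *)

Section Determination.
Variables (k : nat) (F : numFieldType) (qh : F) (A : algType F).
Hypothesis k_gt0 : (0 < k)%N.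

Notation idx := (idx k).
Notation f a b := (form (eps a) (eps b)).

Definition inductive_family (sg : idx -> idx -> A) : Prop :=
  forall b c a : idx, (b < c)%N -> (c < a)%N -> c != bar b -> c != bar a ->
  sg b a = qpow qh (- f b a) *: (sg b c * sg c a) -
    (qpow qh (- f c c) * (-1) ^+ ((par b (+) par c) && (par a (+) par c))) *:
      (sg c a * sg b c).

Lemma inductive_family_unique (sg tg : idx -> idx -> A) :
  inductive_family sg -> inductive_family tg ->
  (forall l (a b : idx), edge l a b -> sg a b = tg a b) ->
  sg (ev 1) (bar (ev 1)) = tg (ev 1) (bar (ev 1)) ->
  forall b a : idx, (b < a)%N -> sg b a = tg b a.
Proof.
move=> Is It edge_eq ev_eq b a.
move: {2}(a - b)%N (leqnn (a - b)) => n.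
elim: n a b => [|n IH] a b; first by lia.
move=> abn ba.
have split (c : idx) : (b < c)%N -> (c < a)%N -> c != bar b -> c != bar a -> sg b a = tg b a.
  move=> bc ca cb' ca'; rewrite (Is b c a) // (It b c a) //.
  by rewrite (IH a c) ?(IH c b) //; lia.
(* For a pair of opposite weights any [c] strictly between is admissible; [ev 1] is one unless the
   pair is [ev 1], [bar (ev 1)] itself. *)
have [ab|nab] := eqVneq b (bar a).
  have av : b = (k.*2.+1 - a)%N :> nat by rewrite ab val_bar.
  have [bk|bk] := ltnP b k; last first.
    have -> : b = ev 1 by apply: ord_inj; rewrite val_ev1; lia.
    by have -> : a = bar (ev 1) by apply: ord_inj; rewrite val_bar val_ev1; lia.
  have ha := ltn_ord a.
  by apply: (split (ev 1)); rewrite -?(inj_eq (@ord_inj _)) ?val_bar ?val_ev1; lia.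
have [[l e]|[l [a' [e ba']]]] := pred_above k_gt0 ba nab.
  exact: edge_eq e.
have a'a := edge_lt k_gt0 e.
(* The predecessor [a'] of [a] is inadmissible only as [bar b]; then the successor [b'] of [b]
   serves, as [b' = bar a] would force [a < a']. *)
have [a'b|] := eqVneq a' (bar b); last first.
  by move=> h; apply: (split a') => //; apply: edge_bar_neq e.
have nab' : a != bar b by apply: neq_bar_sym.
have [[m em]|[m [b' [em b'a]]]] := succ_below k_gt0 ba nab'.
  exact: edge_eq em.
apply: (split b') => //; first exact: edge_lt em.
  exact/neq_bar_sym/(edge_bar_neq k_gt0 em).
apply/eqP => b'E; have := edge_lt k_gt0 (edge_bar em).
by rewrite b'E barK -a'b ltnNge ltnW.
Qed.

End Determination.

(** * The Cartan factor *)

Section HalfCoefficients.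
Variable k : nat.
Hypothesis k_gt0 : (0 < k)%N.

Notation label := (label k).
Implicit Types (c d : label) (lam mu : wgt k).

Lemma halfcoefD lam mu c : halfcoef (lam + mu) c = halfcoef lam c + halfcoef mu c.
Proof.
have D (P : pred 'I_k.+1) : \sum_(j < k.+1 | P j) (lam + mu) 0 j =
    \sum_(j < k.+1 | P j) lam 0 j + \sum_(j < k.+1 | P j) mu 0 j.
  by rewrite -big_split; apply: eq_bigr => j _; rewrite mxE.
by case: c => [m|[]]; rewrite /= D ?mxE; ring.
Qed.

Lemma halfcoef_alpha c d : halfcoef (alpha c) d = (c == d)%:R * 2.
Proof.
have S (P : pred 'I_k.+1) (i : nat) : (i <= k)%N ->
    \sum_(j < k.+1 | P j) (delta_mx 0 (inord i) : wgt k) 0 j = (P (inord i))%:R.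
  move=> ik; rewrite big_mkcond (bigD1 (inord i)) //= mxE !eqxx big1 ?addr0.
    by case: (P _).
  by move=> j ji; rewrite mxE (negPf ji) andbF; case: (P j).
have B (P : pred 'I_k.+1) (u v : wgt k) : \sum_(j < k.+1 | P j) (u - v) 0 j =
    \sum_(j < k.+1 | P j) u 0 j - \sum_(j < k.+1 | P j) v 0 j.
  by rewrite -sumrB; apply: eq_bigr => j _; rewrite !mxE.
have C (P : pred 'I_k.+1) (u v : wgt k) : \sum_(j < k.+1 | P j) (u + v) 0 j =
    \sum_(j < k.+1 | P j) u 0 j + \sum_(j < k.+1 | P j) v 0 j.
  by rewrite -big_split; apply: eq_bigr => j _; rewrite !mxE.
have omax i : (i <= k)%N -> (ord_max == inord i :> 'I_k.+1) = (i == k).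
  by move=> ik; rewrite -(inj_eq (@ord_inj _)) /= inordK // eq_sym.
case: c => [m|b].
  have hm := ltn_ord m.
  rewrite [alpha _]/= !eps_od; try lia.
  case: d => [m'|[]]; rewrite [halfcoef _ _]/= ?B !S ?mxE ?inordK ?omax //=; try lia.
    by have hm' := ltn_ord m'; rewrite (inj_eq (@inl_inj _ _)) -(inj_eq (@ord_inj _)); lia.
case: b; rewrite [alpha _]/= !eps_od ?eps_ev1; try lia.
all: by case: d => [m'|[]]; rewrite [halfcoef _ _]/= ?B ?C !S ?mxE ?inordK ?omax //=;
  try lia; have hm' := ltn_ord m'; lia.
Qed.

End HalfCoefficients.

Section CartanElements.
Variables (k : nat) (F : numFieldType) (A : algType F).
Hypothesis k_gt0 : (0 < k)%N.
Notation label := (label k).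
Implicit Types (c d : label) (lam mu : wgt k) (u : A).

Variables (K Ki : label -> A) (th : A -> A).
Hypotheses (K_Ki : forall c, K c * Ki c = 1) (Ki_K : forall c, Ki c * K c = 1).
Hypothesis K_comm : forall c d, K c * K d = K d * K c.
Hypotheses (th1 : th 1 = 1) (thM : {morph th : u v / u * v}).
Hypotheses (thK : forall c, th (K c) = K c) (thKi : forall c, th (Ki c) = Ki c).

(** [UKpow] over an abstract algebra; at [Uq] the two are convertible, and likewise [Kwgt] and
    [Uqh]. *)
Definition Kpow c (m : int) : A :=
  match m with Posz p => K c ^+ p | Negz p => Ki c ^+ p.+1 end.
Definition Kwgt lam : A := \prod_(c : label) Kpow c (halfcoef lam c).

Lemma KpowS c m : Kpow c (m + 1) = Kpow c m * K c.
Proof.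
case: m => [p|[|p]].
- by rewrite (_ : Posz p + 1 = p.+1) /= ?exprSr //; lia.
- by rewrite /= expr1 Ki_K.
rewrite (_ : Negz p.+1 + 1 = Negz p) /=; last by lia.
by rewrite [in RHS]exprSr -mulrA Ki_K mulr1.
Qed.

Lemma KpowB c m : Kpow c (m - 1) = Kpow c m * Ki c.
Proof. by rewrite -{2}(subrK 1 m) KpowS -mulrA K_Ki mulr1. Qed.

Lemma KpowD c m n : Kpow c (m + n) = Kpow c m * Kpow c n.
Proof.
elim: n => [|n IH|n IH]; first by rewrite addr0 mulr1.
  by rewrite -addn1 PoszD addrA !KpowS IH mulrA.
rewrite -addn1 PoszD opprD addrA !KpowB IH mulrA; congr (_ * _).
Qed.

Lemma Ki_comm c u (a : F) : a != 0 -> K c * u = a *: (u * K c) ->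
  Ki c * u = a^-1 *: (u * Ki c).
Proof.
move=> a0 h; rewrite -[u in LHS]mulr1 -(K_Ki c) [u * _]mulrA.
have -> : u * K c = a^-1 *: (K c * u) by rewrite h scalerK.
by rewrite -scalerAl -scalerAr !mulrA Ki_K mul1r.
Qed.

Lemma Kpow_comm c u (a : F) m : a != 0 -> K c * u = a *: (u * K c) ->
  Kpow c m * u = a ^ m *: (u * Kpow c m).
Proof.
move=> a0 h; have h' := Ki_comm a0 h.
elim: m => [|n IH|n IH]; first by rewrite mul1r mulr1 scale1r.
  rewrite -addn1 PoszD KpowS -mulrA h -scalerAr [_ * (u * K c)]mulrA IH -scalerAl scalerA.
  by rewrite expfzDr // expr1z mulrC mulrA.
rewrite -addn1 PoszD opprD KpowB -mulrA h' -scalerAr [_ * (u * Ki c)]mulrA IH -scalerAl scalerA.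
by rewrite expfzDr // exprN1 mulrC mulrA.
Qed.

Lemma Kpow_Kpow c d m n : Kpow c m * Kpow d n = Kpow d n * Kpow c m.
Proof.
have h e : K e * Kpow d n = Kpow d n * K e.
  have := @Kpow_comm d (K e) 1 n (oner_neq0 F); rewrite K_comm scale1r exp1rz scale1r.
  by move=> ->.
have := @Kpow_comm c (Kpow d n) 1 m (oner_neq0 F).
by rewrite h !scale1r exp1rz scale1r; apply.
Qed.

Lemma KwgtD lam mu : Kwgt (lam + mu) = Kwgt lam * Kwgt mu.
Proof.
rewrite /Kwgt; elim: (index_enum _) => [|c s IH]; first by rewrite !big_nil mulr1.
rewrite !big_cons IH halfcoefD KpowD -!mulrA; congr (_ * _); rewrite !mulrA.
congr (_ * _); elim: s {IH} => [|d s IH]; first by rewrite !big_nil mulr1 mul1r.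
by rewrite !big_cons mulrA Kpow_Kpow -!mulrA IH.
Qed.

Lemma Kwgt_alpha c : Kwgt (alpha c) = K c * K c.
Proof.
transitivity (\prod_(d | d == c) Kpow d 2); last by rewrite big_pred1_eq.
rewrite [RHS]big_mkcond; apply: eq_bigr => d _.
by rewrite (halfcoef_alpha k_gt0) eq_sym; case: eqP => [->|_]; rewrite ?mul1r ?mul0r.
Qed.

Lemma Kwgt0 : Kwgt 0 = 1.
Proof.
rewrite /Kwgt big1 // => c _.
have /eqP := halfcoefD 0 0 c; rewrite addr0 -subr_eq0 opprD addrA subrr sub0r oppr_eq0.
by move=> /eqP->.
Qed.

Lemma Kwgt_inv lam : Kwgt (- lam) * Kwgt lam = 1.
Proof. by rewrite -KwgtD addNr Kwgt0. Qed.

Lemma Kwgt_edge c (a b : idx k) : edge c a b ->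
  Kwgt (eps a) = Kwgt (eps b) * (K c * K c).
Proof.
by move=> e; rewrite -Kwgt_alpha -KwgtD -(edge_alpha e) addrC subrK.
Qed.

Lemma th_Kwgt lam : th (Kwgt lam) = Kwgt lam.
Proof.
have thX u n : th u = u -> th (u ^+ n) = u ^+ n.
  by move=> tu; elim: n => [|n IH]; rewrite ?expr0 // !exprS thM tu IH.
rewrite /Kwgt (big_morph th thM th1); apply: eq_bigr => c _.
by case: halfcoef => p /=; apply: thX.
Qed.

Variable qh : F.
Hypothesis qh0 : qh != 0.

Lemma Kwgt_comm lam beta u :
  (forall c, K c * u = hpow qh (form (alpha c) beta) *: (u * K c)) ->
  Kwgt lam * u = qpow qh (form lam beta) *: (u * Kwgt lam).
Proof.
move=> h.
(* [halfcoefP] paired with [beta]; the factor [2] turns powers of [q^(1/2)] into powers of [q]. *)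
have fsum : (\sum_c halfcoef lam c * form (alpha c) beta)%R = 2 * form lam beta.
  transitivity (form (lam *+ 2) beta); last by rewrite mulr2n formDl; ring.
  rewrite -(halfcoefP _ k_gt0).
  rewrite (big_morph (fun w => form w beta) (fun v w => formDl v w beta) (form0l beta)).
  by apply: eq_bigr => c _; rewrite formZl.
rewrite /qpow -fsum -/(hpow qh _) /Kwgt.
elim: (index_enum _) => [|c s IH]; first by rewrite !big_nil mul1r mulr1 hpow0 scale1r.
rewrite !big_cons -mulrA IH -scalerAr [_ * (u * _)]mulrA (Kpow_comm _ (hpow_neq0 qh0 _) (h c)).
rewrite -scalerAl scalerA -[u * _ * _]mulrA; congr (_ *: _).
rewrite [in RHS](hpowD qh0) mulrC; congr (_ * _).
by rewrite /hpow exprz_exp mulrC.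
Qed.

Lemma K_Kwgt c lam : K c * Kwgt lam = Kwgt lam * K c.
Proof.
have h d : K d * K c = hpow qh (form (alpha d) 0) *: (K c * K d).
  by rewrite formC form0l hpow0 scale1r K_comm.
by rewrite (Kwgt_comm lam h) formC form0l qpow0 // scale1r.
Qed.

End CartanElements.

(** * The intertwining property in terms of the unitriangular matrix *)

Section Intertwining.
Variables (k : nat) (F : numFieldType) (qh : F) (A : algType F).
Hypotheses (k_gt0 : (0 < k)%N) (qh0 : qh != 0).
Notation label := (label k).
Notation idx := (idx k).
Notation pie := (@pie k F qh).
Notation g c b := (form (alpha c) (eps b)).
Implicit Types (c : label) (a b d j : idx) (x y : idx -> idx -> A).

Variables (th : A -> A) (K Ki e : label -> A).
Hypotheses (K_Ki : forall c, K c * Ki c = 1) (Ki_K : forall c, Ki c * K c = 1).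
Hypotheses (thlin : linear th) (thM : {morph th : u v / u * v}).
Hypotheses (thK : forall c, th (K c) = K c) (thKi : forall c, th (Ki c) = Ki c).
Hypothesis the : forall c, th (e c) = (-1) ^+ lpar c *: e c.

Definition graded_product x y a d : A :=
  \sum_b (if par b (+) par d then th (x a b) else x a b) * y b d.
Definition pi_Delta c b d : A :=
  pi_gen qh (gK c) b d *: e c + pie c b d *: Ki c.
Definition pi_DeltaT c a b : A :=
  pie c a b *: K c + pi_gen qh (gKi c) a b *: e c.

Lemma pi_cartan (h : int -> int) c a b :
  (\sum_i hpow qh (h (g c i)) *: (delta_mx i i : 'M[F]_k.*2.+2)) a b =
  (a == b)%:R * hpow qh (h (g c a)).
Proof.
rewrite summxE (bigD1 a) //= !mxE eqxx big1 ?addr0 => [|i ia].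
  by rewrite eq_sym mulrC.
by rewrite !mxE eq_sym (negPf ia) mulr0.
Qed.

Lemma pi_K c a b : pi_gen qh (gK c) a b = (a == b)%:R * hpow qh (g c a).
Proof. exact: (pi_cartan id). Qed.

Lemma pi_Ki c a b : pi_gen qh (gKi c) a b = (a == b)%:R * hpow qh (- g c a).
Proof. exact: (pi_cartan -%R). Qed.

Lemma graded_product_DeltaT c y a d : graded_product (pi_DeltaT c) y a d =
  \sum_b pie c a b *: (K c * y b d) +
  ((-1) ^+ (lpar c && (par a (+) par d)) * hpow qh (- g c a)) *: (e c * y a d).
Proof.
rewrite /graded_product (eq_bigr (fun b => pie c a b *: (K c * y b d) +
  (if b == a then ((-1) ^+ (lpar c && (par a (+) par d)) * hpow qh (- g c a)) *:
    (e c * y a d) else 0))); last first.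
  move=> b _; rewrite /pi_DeltaT (linearfD thlin) !(linearfZ thlin) thK the pi_Ki.
  rewrite eq_sym; case: eqP => [->|_]; last first.
    by rewrite mul0r !scale0r !addr0 if_same -scalerAl.
  rewrite mul1r scalerA; case: (_ (+) _); rewrite ?andbT ?andbF mulrDl -!scalerAl.
    by rewrite [hpow _ _ * _]mulrC.
  by rewrite mul1r.
by rewrite big_split /= -big_mkcond big_pred1_eq.
Qed.

(** In row [a] of the equation the row [j] enters only through a nonzero entry of pi(e_c) times the
    invertible [K c], so it can be solved for. *)
Lemma row_determined c x y a j :
  graded_product x (pi_Delta c) a =1 graded_product (pi_DeltaT c) x a ->
  graded_product y (pi_Delta c) a =1 graded_product (pi_DeltaT c) y a ->
  edge c a j -> x a =1 y a -> x j =1 y j.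
Proof.
move=> hx hy e_ xy d; have := hx d.
have -> : graded_product x (pi_Delta c) a d = graded_product y (pi_Delta c) a d.
  by apply: eq_bigr => b _; rewrite xy.
rewrite hy !graded_product_DeltaT xy => /addIr.
rewrite !(pie_sum qh k_gt0 _ e_); rewrite -(edge_pie qh k_gt0) in e_.
by move/(scalerI e_)/(congr1 ( *%R (Ki c))); rewrite !mulrA Ki_K !mul1r => ->.
Qed.

Variables (kk : idx -> A) (N : idx -> idx -> A).
Hypothesis kk_edge : forall c a b, edge c a b -> kk a = kk b * (K c * K c).
Hypothesis K_kk : forall c a, K c * kk a = kk a * K c.
Hypothesis e_kk : forall c a, e c * kk a = qpow qh (- g c a) *: (kk a * e c).
Hypothesis th_kk : forall a, th (kk a) = kk a.
Hypothesis thN : forall a b, th (N a b) = (-1) ^+ (par a (+) par b) *: N a b.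
Hypothesis KN : forall c a b,
  K c * N a b = hpow qh (form (alpha c) (eps b - eps a)) *: (N a b * K c).
Hypothesis Nrel : forall c a b,
  qpow qh (g c b) *: (N a b * (e c * K c)) -
  ((-1) ^+ (lpar c && (par a (+) par b)) * qpow qh (- g c a)) *:
    (e c * K c * N a b) +
  hpow qh (g c b) *: (\sum_i pie c i b *:
    ((-1) ^+ (lpar c && (par a (+) par i)) *: N a i)) =
  \sum_j pie c a j *: (hpow qh (g c j) *: N j b).

Let R a b := kk a * N a b.

Lemma graded_product_Delta c a d : graded_product R (pi_Delta c) a d =
  hpow qh (g c d) *: (R a d * e c) +
  \sum_b pie c b d *: ((-1) ^+ (lpar c && (par a (+) par b)) *: (R a b * Ki c)).
Proof.
rewrite /graded_product (eq_bigr (fun b =>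
  (if b == d then hpow qh (g c d) *: (R a d * e c) else 0) +
  pie c b d *: ((-1) ^+ (lpar c && (par a (+) par b)) *: (R a b * Ki c)))).
  by rewrite big_split /= -big_mkcond big_pred1_eq.
move=> b _; have thR : th (R a b) = (-1) ^+ (par a (+) par b) *: R a b.
  by rewrite /R thM th_kk thN scalerAr.
rewrite /pi_Delta pi_K mulrDr; congr (_ + _).
  case: eqP => [->|_]; last by rewrite mul0r scale0r mulr0.
  by rewrite addbb mul1r scalerAr.
have [e_|] := boolP (edge c b d); last first.
  by rewrite -(edge_pie qh k_gt0) negbK => /eqP->; rewrite !scale0r mulr0.
rewrite (edge_par k_gt0 e_) -scalerAr thR; congr (_ *: _).
by case: (lpar c); rewrite /= ?expr0 ?scale1r // -scalerAl.
Qed.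

Lemma intertwining a c d :
  graded_product R (pi_Delta c) a d = graded_product (pi_DeltaT c) R a d.
Proof.
rewrite graded_product_Delta graded_product_DeltaT /R.
have KiN b : Ki c * N b d = hpow qh (g c b - g c d) *: (N b d * Ki c).
  rewrite (Ki_comm K_Ki Ki_K (hpow_neq0 qh0 _) (KN c b d)) -hpowN.
  by rewrite formDr formNr opprB.
have eE : e c = e c * K c * Ki c by rewrite -mulrA K_Ki mulr1.
have -> : \sum_b pie c a b *: (K c * (kk b * N b d)) =
    \sum_b pie c a b *: (hpow qh (g c b - g c d) *: (kk a * (N b d * Ki c))).
  apply: eq_bigr => b _; have [e_|] := boolP (edge c a b); last first.
    by rewrite -(edge_pie qh k_gt0) negbK => /eqP->; rewrite !scale0r.
  congr (_ *: _); rewrite (kk_edge e_) scalerAr -KiN mulrA K_kk -!mulrA.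
  by rewrite (mulrA (K c) (Ki c)) K_Ki mul1r.
have -> : e c * (kk a * N a d) = (qpow qh (- g c a) * hpow qh (g c a - g c d)) *:
    (kk a * (e c * K c * N a d * Ki c)).
  rewrite mulrA e_kk -scalerAl -scalerA; congr (_ *: _).
  by rewrite scalerAr -!mulrA scalerAr scalerAr -KiN (mulrA (K c)) K_Ki mul1r.
(* Multiplying by the Cartan factor on the left and by [Ki c] on the right turns [E_c] back into
   [e_c]; the power of [q^(1/2)] removes the one met when [Ki c] passes over entries of [N]. *)
have := congr1 (fun u => hpow qh (- g c d) *: (kk a * (u * Ki c))) (Nrel c a d).
have nz : hpow qh (g c d) != 0 := hpow_neq0 qh0 _.
set X := kk a * (N a d * (e c * K c) * Ki c).
set Y := kk a * (e c * K c * N a d * Ki c).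
set S1 := \sum_b pie c b d *: ((-1) ^+ (lpar c && (par a (+) par b)) *:
  (kk a * N a b * Ki c)).
set S2 := \sum_b pie c a b *: (hpow qh (g c b) *: (kk a * (N b d * Ki c))).
have -> : kk a * N a d * e c = X by rewrite {1}eE /X -!mulrA.
have -> : \sum_b pie c a b *:
    (hpow qh (g c b - g c d) *: (kk a * (N b d * Ki c))) = hpow qh (- g c d) *: S2.
  rewrite /S2 scaler_sumr; apply: eq_bigr => b _.
  by rewrite (hpowD qh0 (g c b) (- g c d)) !scalerA; congr (_ *: _); ring.
rewrite mulrDl mulrBl mulrDr mulrBr -!scalerAl -!scalerAr -/X -/Y.
have -> : kk a * ((\sum_i pie c i d *:
    ((-1) ^+ (lpar c && (par a (+) par i)) *: N a i)) * Ki c) = S1.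
  rewrite mulr_suml mulr_sumr; apply: eq_bigr => b _.
  by rewrite -!scalerAl -!scalerAr mulrA.
have -> : kk a * ((\sum_j pie c a j *: (hpow qh (g c j) *: N j d)) * Ki c) = S2.
  rewrite mulr_suml mulr_sumr; apply: eq_bigr => b _.
  by rewrite -!scalerAl -!scalerAr.
have nzP := hpow_neq0 qh0 (g c d); have nzQ := hpow_neq0 qh0 (g c a).
move=> <-; rewrite (hpowD qh0 (g c a) (- g c d)) !(qpowN qh) !(qpow_hpow qh0) !hpowN.
by lmod F; field; rewrite ?nzP ?nzQ.
Qed.

End Intertwining.

(** * Existence *)

Section Existence.
Variables (k : nat) (F : numFieldType) (qh : F) (A : algType F).
Hypotheses (k_gt0 : (0 < k)%N) (qh0 : qh != 0).
Hypothesis q2 : qpow qh 1 + (qpow qh 1)^-1 != 0.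

Notation label := (label k).
Notation idx := (idx k).
Notation pie := (@pie k F qh).
Notation g c b := (form (alpha c) (eps b)).
Implicit Types (c d : label) (a b : idx) (u v : A).

Variables (th : A -> A) (K Ki e h : label -> A).
Notation khom := (@khom k F qh A K th).
Hypotheses (K_Ki : forall c, K c * Ki c = 1) (Ki_K : forall c, Ki c * K c = 1).
Hypothesis K_comm : forall c d, K c * K d = K d * K c.
Hypotheses (thlin : linear th) (thM : {morph th : u v / u * v}).
Hypothesis th1 : th 1 = 1.
Hypotheses (thK : forall c, th (K c) = K c) (thKi : forall c, th (Ki c) = Ki c).
Hypothesis e_khom : forall c, khom (alpha c) (lpar c) (e c).
Hypothesis e_serre : serre (qpow qh 1) (fun c u => e c * K c * u).

(* The scalar picked up when E_c moves past a homogeneous element, extended to a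
   linear map so that it makes sense on all rows. *)
Definition conjK c u : A :=
  K c * K c * (if lpar c then th u else u) * (Ki c * Ki c).

Lemma conjK_lin c : linear (conjK c).
Proof.
move=> a u v; rewrite /conjK scalerAl scalerAr -mulrDl -mulrDr.
by case: lpar; rewrite // thlin.
Qed.

Lemma K2_Ki2 c : K c * K c * (Ki c * Ki c) = 1.
Proof. by rewrite -mulrA (mulrA _ (Ki c)) K_Ki mul1r K_Ki. Qed.

Lemma Ki2_K2 c : Ki c * Ki c * (K c * K c) = 1.
Proof. by rewrite -mulrA (mulrA _ (K c)) Ki_K mul1r Ki_K. Qed.

Lemma conjK_M c : {morph conjK c : u v / u * v}.
Proof.
have sandwich x y u v : y * x = 1 -> x * (u * v) * y = x * u * y * (x * v * y).
  by move=> yx; rewrite -[u in LHS]mulr1 -yx !mulrA.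
by move=> u v; rewrite /conjK -(sandwich _ _ _ _ (Ki2_K2 c)); case: lpar; rewrite ?thM.
Qed.

Lemma conjK_1 c : conjK c 1 = 1.
Proof. by rewrite /conjK th1 if_same mulr1 K2_Ki2. Qed.

Lemma conjK_khom c lam p u : khom lam p u ->
  conjK c u = ((-1) ^+ (lpar c && p) * qpow qh (form (alpha c) lam)) *: u.
Proof.
move=> [up uK]; rewrite /conjK.
have -> : (if lpar c then th u else u) = (-1) ^+ (lpar c && p) *: u.
  by rewrite up; case: lpar; rewrite /= ?expr0 ?scale1r.
rewrite -scalerAr -scalerAl.
have -> : K c * K c * u = qpow qh (form (alpha c) lam) *: (u * (K c * K c)).
  rewrite -mulrA uK -scalerAr [_ * (u * _)]mulrA uK -scalerAl scalerA -(qpow_hpow qh0).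
  by rewrite -mulrA.
by rewrite -scalerAl -mulrA K2_Ki2 mulr1 scalerA.
Qed.

Lemma th_conjK c u : conjK c (th u) = th (conjK c u).
Proof. by rewrite /conjK !thM !thK !thKi; case: lpar. Qed.

Lemma conjK_C c d u : conjK c (conjK d u) = conjK d (conjK c u).
Proof.
have comm x y : K x * y = y * K x -> Ki x * y = y * Ki x.
  move=> xy; have := @Ki_comm k F A K Ki K_Ki Ki_K x y 1 (oner_neq0 F).
  by rewrite invr1 !scale1r; apply.
have KKi : K c * Ki d = Ki d * K c by rewrite (comm d).
have KiK : Ki c * K d = K d * Ki c by apply: comm.
have KiKi : Ki c * Ki d = Ki d * Ki c by apply: comm.
have comm2 (x y : A) : x * y = y * x -> x * x * (y * y) = y * y * (x * x).
  by move=> xy; apply: commrM; apply/commr_sym/commrM; apply/commr_sym.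
have tE v (b : bool) (x y : A) : th x = x -> th y = y ->
    (if b then th (x * v * y) else x * v * y) = x * (if b then th v else v) * y.
  by move=> tx ty; case: b; rewrite ?thM ?tx ?ty.
have K2 c' : th (K c' * K c') = K c' * K c' by rewrite thM thK.
have Ki2 c' : th (Ki c' * Ki c') = Ki c' * Ki c' by rewrite thM thKi.
rewrite /conjK !tE //.
have -> : (if lpar c then th (if lpar d then th u else u) else if lpar d then th u else u) =
  (if lpar d then th (if lpar c then th u else u) else if lpar c then th u else u).
  by case: (lpar c); case: (lpar d).
have swap (x y z t w : A) : x * y = y * x -> z * t = t * z ->
    x * (y * w * z) * t = y * (x * w * t) * z.
  by move=> xy zt; rewrite !mulrA xy -!mulrA zt.
by apply: swap; apply: comm2.
Qed.

Variable P : A -> Prop.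
Hypotheses (PK : forall c, P (K c)) (Pe : forall c, P (e c)) (P1 : P 1).
Hypotheses (PD : forall u v, P u -> P v -> P (u + v)).
Hypotheses (PM : forall u v, P u -> P v -> P (u * v)).
Hypotheses (PZ : forall (a : F) u, P u -> P (a *: u)).
Hypothesis h_e : forall c d,
  h c * e d - e d * h c = (form (alpha c) (alpha d))%:~R *: e d.
Hypothesis h_K : forall c d, h c * K d = K d * h c.

(** Both kinds of weight are recorded because [h c] and [K c] are separate generators: conjugation
    by [K c] drives the computations, the commutator with [h c] is what [admissible] asks for. *)
Definition hom lam p u : Prop :=
  [/\ P u, khom lam p u &
      forall c, h c * u - u * h c = (form (alpha c) lam)%:~R *: u].

Lemma homM lam mu p p' u v :
  hom lam p u -> hom mu p' v -> hom (lam + mu) (p (+) p') (u * v).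
Proof.
move=> [Pu ku hu] [Pv kv hv]; split=> [||c]; first exact: PM.
  exact: khomM ku kv.
have -> : h c * (u * v) - u * v * h c =
    (h c * u - u * h c) * v + u * (h c * v - v * h c).
  by rewrite mulrBl mulrBr !mulrA addrA subrK.
by rewrite hu hv formDr intrD scalerDl -scalerAl -scalerAr.
Qed.

Lemma homD lam p u v : hom lam p u -> hom lam p v -> hom lam p (u + v).
Proof.
move=> [Pu ku hu] [Pv kv hv]; split=> [||c]; first exact: PD.
  exact: khomD ku kv.
by rewrite mulrDr mulrDl opprD addrACA hu hv scalerDr.
Qed.

Lemma homZ lam p (a : F) u : hom lam p u -> hom lam p (a *: u).
Proof.
move=> [Pu ku hu]; split=> [||c]; [exact: PZ | exact: khomZ |].
by rewrite -scalerAr -scalerAl -scalerBr hu !scalerA mulrC.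
Qed.

Lemma hom1 : hom 0 false 1.
Proof.
split=> [||c]; rewrite ?th1 // ?mulr1 ?mul1r.
  by split=> [|c]; rewrite ?th1 ?scale1r // formC form0l hpow0 scale1r mulr1 mul1r.
by rewrite subrr formC form0l scale0r.
Qed.

Lemma hom0 lam p : hom lam p 0.
Proof.
split=> [||c]; first by rewrite -(scale0r 1); apply: PZ.
  split=> [|c]; first by rewrite (linearf0 thlin) scaler0.
  by rewrite mulr0 mul0r scaler0.
by rewrite mulr0 mul0r subr0 scaler0.
Qed.

Lemma hom_E c : hom (alpha c) (lpar c) (e c * K c).
Proof.
rewrite -[alpha c]addr0 -[lpar c]addbF; apply: homM.
  by split=> [||d]; [exact: Pe | exact: e_khom | rewrite h_e].
split=> [||d]; first exact: PK.
  by split=> [|d]; rewrite ?thK ?scale1r // formC form0l hpow0 scale1r K_comm.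
by rewrite h_K subrr formC form0l scale0r.
Qed.

Theorem intertwining_relation_solvable : exists N : idx -> idx -> A,
  [/\ forall a, N a a = 1,
      forall a b, (a < b)%N -> N a b = 0,
      forall a b, hom (eps b - eps a) (par a (+) par b) (N a b) &
      forall c a b,
        qpow qh (g c b) *: (N a b * (e c * K c)) -
        ((-1) ^+ (lpar c && (par a (+) par b)) * qpow qh (- g c a)) *:
          (e c * K c * N a b) +
        hpow qh (g c b) *: (\sum_i pie c i b *:
          ((-1) ^+ (lpar c && (par a (+) par i)) *: N a i)) =
        \sum_j pie c a j *: (hpow qh (g c j) *: N j b)].
Proof.
pose E c := e c * K c.
have Ehom c : khom (alpha c) (lpar c) (E c) by have [] := hom_E c.
have Eser := serre_elements_of e_serre : serre_elements (qpow qh 1) E.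
have thE c : th (E c) = (-1) ^+ lpar c *: E c by have [] := Ehom c.
have tauE c d : conjK c (E d) = braid (qpow qh 1) c d *: E d.
  by rewrite (conjK_khom c (Ehom d)) /braid -qpow_exp.
have homEr lam p c u : hom lam p u -> hom (lam + alpha c) (p (+) lpar c) (u * E c).
  by move=> hu; apply: homM hu (hom_E c).
have homEl lam p c u : hom lam p u -> hom (lam + alpha c) (p (+) lpar c) (E c * u).
  by move=> hu; rewrite addrC addbC; apply: homM (hom_E c) hu.
have hth lam p u : hom lam p u -> th u = (-1) ^+ p *: u by case=> _ [].
have htau lam p c u : hom lam p u ->
    conjK c u = ((-1) ^+ (lpar c && p) * qpow qh (form (alpha c) lam)) *: u.
  by case=> _ ku _; apply: conjK_khom ku.
exists (Nrow qh E th conjK).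
split=> [a|a b ab|a b|c a b].
- exact: (Nrow_triangular k_gt0 qh0 Eser thlin thM thE conjK_lin conjK_M tauE
    conjK_C th_conjK th1 conjK_1 q2 a).1.
- exact: (Nrow_triangular k_gt0 qh0 Eser thlin thM thE conjK_lin conjK_M tauE
    conjK_C th_conjK th1 conjK_1 q2 a).2.
- exact: (Nrow_hom k_gt0 qh0 Eser thlin thM thE conjK_lin conjK_M tauE
    conjK_C th_conjK th1 conjK_1 q2 hom1 hom0 homD homZ homEr homEl hth htau).
exact: (Nrow_relation k_gt0 qh0 Eser thlin thM thE conjK_lin conjK_M tauE
    conjK_C th_conjK th1 conjK_1 q2 hom1 hom0 homD homZ homEr homEl hth htau).
Qed.

End Existence.

(** * The intertwiner over U_q[osp(2|n)] *)

Section MorphismCommutators.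
Variables (F : numFieldType) (B : lalgType F) (A : algType F) (f : B -> A).
Hypotheses (fD : forall x y, f (x + y) = f x + f y).
Hypotheses (fM : forall x y, f (x * y) = f x * f y).
Hypotheses (fZ : forall a x, f (a *: x) = a *: f x).

Lemma morph_commutator (x y z : B) (a : F) :
  f (x * y - (1 : F) *: (y * x) - a *: z) = 0 -> f x * f y - f y * f x = a *: f z.
Proof.
rewrite (morphB fD fZ) (morphB fD fZ) !fZ !fM scale1r => /eqP.
by rewrite subr_eq0 => /eqP.
Qed.

End MorphismCommutators.

Section SingleEntry.
Variables (k : nat) (F : numFieldType) (A : algType F).
Notation idx := (idx k).
Implicit Types (a b d i j : idx).

Lemma graded_product_diag (th : A -> A) (kk : idx -> A) (x y : idx -> idx -> A) a d :
  th 0 = 0 -> (forall i, th (kk i) = kk i) ->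
  (forall i j, x i j = if i == j then kk i else 0) ->
  graded_product th x y a d = kk a * y a d.
Proof.
move=> th0 thk xE; rewrite /graded_product (bigD1 a) //= big1 ?addr0 => [|i ia].
  by rewrite xE eqxx thk if_same.
by rewrite xE eq_sym (negPf ia) th0 if_same mul0r.
Qed.

Lemma strict_lower_entry (s : idx -> F) (sg : idx -> idx -> A) i j :
  \sum_b \sum_(a | wgt_gt b a)
    (s b *: (delta_mx a b : 'M[F]_k.*2.+2)) i j *: sg b a =
  if (j < i)%N then s j *: sg j i else 0.
Proof.
rewrite (bigD1 j) //= [X in _ + X]big1 ?addr0 => [|b bj]; last first.
  rewrite big1 // => a _; rewrite !mxE [j == b]eq_sym (negPf bj) andbF mulr0.
  exact: scale0r.
rewrite big_mkcond (bigD1 i) //= big1 ?addr0 => [|a ai].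
  by rewrite /wgt_gt !mxE !eqxx mulr1.
by case: ifP => // _; rewrite !mxE [i == a]eq_sym (negPf ai) mulr0 scale0r.
Qed.

Lemma diag_entry (kk : idx -> A) i j :
  \sum_a (delta_mx a a : 'M[F]_k.*2.+2) i j *: kk a = if i == j then kk i else 0.
Proof.
rewrite (bigD1 i) //= big1 ?addr0 => [|a ai].
  by rewrite mxE eqxx [j == i]eq_sym; case: eqP; rewrite ?scale1r ?scale0r.
by rewrite mxE [i == a]eq_sym (negPf ai) scale0r.
Qed.

Definition unitriangular (s : idx -> F) (sg : idx -> idx -> A) a d : A :=
  if a == d then 1 else if (d < a)%N then s d *: sg d a else 0.

Lemma unitriangular_row0 s sg sg' a d : a = 0%N :> nat ->
  unitriangular s sg a d = unitriangular s sg' a d.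
Proof. by move=> a0; rewrite /unitriangular a0. Qed.

End SingleEntry.

Section Intertwiner.
Variables (k : nat) (F : numFieldType) (qh : F).
Hypotheses (k_gt0 : (0 < k)%N) (qh0 : qh != 0).

Notation label := (label k).
Notation idx := (idx k).
Notation U := (Uq k qh).
Notation K := (@UK k F qh).
Notation Ki := (@UKi k F qh).
Notation e := (@Ue k F qh).
Notation h := (@Uh k F qh).
Notation theta := (@theta k F qh).
Notation kap := (qpow qh 1 - qpow qh (-1)).
Implicit Types (a b d : idx) (c : label) (sigma : idx -> idx -> U).

Lemma Uh_e c (d : label) : h c * e d - e d * h c = (form (alpha c) (alpha d))%:~R *: e d.
Proof.
exact: (@morph_commutator F {malg F[word k]} U (toU qh) (@toU_D _ _ _) (@toU_M _ _ _)
  (@toU_Z _ _ _) _ _ _ _ (Urel (rel_HE qh c d))).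
Qed.

Lemma Uh_K c (d : label) : h c * K d = K d * h c.
Proof.
apply/esym; apply: (@scaled_comm F U).
exact: (@morphBZ F {malg F[word k]} U (toU qh) (@toU_D _ _ _)
  (@toU_Z _ _ _) _ _ _ _ _ (@toU_M _ _ _ _ _) (@toU_M _ _ _ _ _) (Urel (rel_KH qh d c))).
Qed.

Lemma theta_1 : theta 1 = 1.
Proof. exact: (@theta_is_morph k F qh).1. Qed.

Lemma Uplus_solution : qpow qh 1 + (qpow qh 1)^-1 != 0 ->
  exists N : idx -> idx -> U,
  [/\ forall a, N a a = 1,
      forall a b, (a < b)%N -> N a b = 0,
      forall a b, hom qh theta K h (@Uplus k F qh)
        (eps b - eps a) (par a (+) par b) (N a b) &
      forall c a b,
        qpow qh (form (alpha c) (eps b)) *: (N a b * (e c * K c)) -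
        ((-1) ^+ (lpar c && (par a (+) par b)) *
           qpow qh (- form (alpha c) (eps a))) *: (e c * K c * N a b) +
        hpow qh (form (alpha c) (eps b)) *: (\sum_i pie qh c i b *:
          ((-1) ^+ (lpar c && (par a (+) par i)) *: N a i)) =
        \sum_j pie qh c a j *: (hpow qh (form (alpha c) (eps j)) *: N j b)].
Proof.
move=> q2.
exact: (@intertwining_relation_solvable k F qh U k_gt0 qh0 q2 theta K Ki e h
  (@UK_Ki k F qh) (@UKi_K k F qh) (@UK_comm k F qh) (@theta_lin k F qh)
  (@theta_mul k F qh) theta_1 (@theta_K k F qh) (@theta_Ki k F qh)
  (@khom_e k F qh) (@serre_E k F qh k_gt0 qh0) (@Uplus k F qh)
  (@Uplus_K k F qh) (@Uplus_e k F qh) (@Uplus1 k F qh) (@UplusD k F qh)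
  (@UplusM k F qh) (@UplusZ k F qh) Uh_e Uh_K).
Qed.

Definition unitriangular_part sigma : idx -> idx -> U :=
  unitriangular (fun b => kap * (-1) ^+ par b) sigma.

Lemma gmulE (X Y : 'M[U]_k.*2.+2) a d : gmul X Y a d = graded_product theta X Y a d.
Proof. by rewrite mxE. Qed.

Lemma theta_Uqh (lam : wgt k) : theta (Uqh qh lam) = Uqh qh lam.
Proof.
exact: (@th_Kwgt k F U K Ki theta theta_1 (@theta_mul k F qh) (@theta_K k F qh)
  (@theta_Ki k F qh)).
Qed.

Lemma Rmx_entry sigma a d : Rmx sigma a d = Uqh qh (eps a) * unitriangular_part sigma a d.
Proof.
rewrite gmulE (@graded_product_diag k F U theta (fun i => Uqh qh (eps i))).
- congr (_ * _); rewrite [LHS]mxE.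
  rewrite (_ : gtens _ _ a d = if a == d then 1 else 0); last first.
    by rewrite !mxE; case: eqP; rewrite ?scale1r ?scale0r.
  rewrite summxE (eq_bigr (fun b => \sum_(i | wgt_gt b i)
    ((kap * (-1) ^+ par b) *: (delta_mx i b : 'M[F]_k.*2.+2)) a d *: sigma b i)).
    rewrite (@strict_lower_entry k F U) /unitriangular_part /unitriangular.
    by case: eqP => [->|_]; rewrite ?ltnn ?addr0 ?add0r.
  by move=> b _; rewrite summxE; apply: eq_bigr => i _; rewrite mxE.
- exact: linear0.
- by move=> i; apply: theta_Uqh.
move=> i j; rewrite summxE.
apply: etrans (@diag_entry k F U (fun i => Uqh qh (eps i)) i j).
by apply: eq_bigr => b _; rewrite mxE.
Qed.

Lemma intertwinesE (R : 'M[U]_k.*2.+2) : intertwines R <->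
  forall c a d, graded_product theta R (pi_Delta qh Ki e c) a d =
                graded_product theta (pi_DeltaT qh K e c) R a d.
Proof.
have gtens_entry (M M' : 'M[F]_k.*2.+2) (u u' : U) b d :
    (gtens M u + gtens M' u') b d = M b d *: u + M' b d *: u'.
  by apply: etrans (mxE _ _ _ _) _; congr (_ + _); apply: mxE.
pose D c := pi_id qh (Delta (fgen F (gE c))).
pose DT c := pi_id qh (twist (Delta (fgen F (gE c)))).
have DE c b d : D c b d = pi_Delta qh Ki e c b d.
  apply: etrans (congr1 (fun M : 'M[U]_k.*2.+2 => M b d) (pi_id_Delta qh c)) _.
  exact: gtens_entry.
have DTE c b d : DT c b d = pi_DeltaT qh K e c b d.
  apply: etrans (congr1 (fun M : 'M[U]_k.*2.+2 => M b d) (pi_id_DeltaT qh c)) _.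
  exact: gtens_entry.
have entries c a d :
    (gmul R (D c) a d = graded_product theta R (pi_Delta qh Ki e c) a d) *
    (gmul (DT c) R a d = graded_product theta (pi_DeltaT qh K e c) R a d).
  split; apply: etrans (gmulE _ _ a d) _; apply: eq_bigr => b _.
    by rewrite DE.
  by rewrite DTE.
split=> [hR c a d|hR c].
  have := congr1 (fun M : 'M[U]_k.*2.+2 => M a d) (hR c).
  exact: (fun h' => etrans (esym (entries c a d).1) (etrans h' (entries c a d).2)).
apply/matrixP => a d.
exact: etrans (entries c a d).1 (etrans (hR c a d) (esym (entries c a d).2)).
Qed.

(** The Cartan factor and the scalar [kap] can be cancelled in each entry below the diagonal. *)
Lemma Rmx_inj sigma sigma' : kap != 0 -> Rmx sigma = Rmx sigma' ->
  forall b a, (b < a)%N -> sigma b a = sigma' b a.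
Proof.
move=> kap0 eR b a ba.
have Kinv := @Kwgt_inv k F U k_gt0 K Ki (@UK_Ki k F qh) (@UKi_K k F qh) (@UK_comm k F qh).
have cancel (x u v : U) : x * Uqh qh (eps a) = 1 ->
    Uqh qh (eps a) * u = Uqh qh (eps a) * v -> u = v.
  by move=> xk h'; rewrite -[u]mul1r -xk -mulrA h' mulrA xk mul1r.
have : unitriangular_part sigma a b = unitriangular_part sigma' a b.
  apply: (cancel (Uqh qh (- eps a))); first exact: Kinv.
  exact: etrans (esym (Rmx_entry sigma a b))
    (etrans (congr1 (fun M : 'M[U]_k.*2.+2 => M a b) eR) (Rmx_entry sigma' a b)).
have ab : a != b by rewrite eq_sym -(inj_eq (@ord_inj _)) ltn_eqF.
rewrite /unitriangular_part /unitriangular (negPf ab) ba; apply: scalerI.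
by rewrite mulf_neq0 ?signr_eq0.
Qed.

Lemma intertwiner_unique sigma sigma' :
  intertwines (Rmx sigma) -> intertwines (Rmx sigma') -> Rmx sigma = Rmx sigma'.
Proof.
move=> /intertwinesE h1 /intertwinesE h2; apply/matrixP => a.
elim/(edge_ind k_gt0): a => [a a0 d|c a b e_ IH].
  apply: etrans (Rmx_entry _ _ _) (etrans _ (esym (Rmx_entry _ _ _))).
  exact: (congr1 (fun u : U => Uqh qh (eps a) * u)
    (unitriangular_row0 (fun b => kap * (-1) ^+ par b) sigma sigma' d a0)).
exact: (row_determined k_gt0 (@UKi_K k F qh) (@theta_lin k F qh)
  (@theta_K k F qh) (@theta_e k F qh) (h1 c a) (h2 c a) e_ IH).
Qed.

Lemma simple_values_edge sigma sigma' : simple_values sigma -> simple_values sigma' ->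
  forall c a b, edge c a b -> sigma a b = sigma' a b.
Proof.
move=> [m1 s1 t1 _] [m2 s2 t2 _].
have z0 : (-1) ^+ k * qpow qh 1 != 0 :> F by rewrite mulf_neq0 ?signr_eq0 ?qpow_neq0.
case=> [m|[]] a b /edgeP[] [-> ->].
- by rewrite /= (m1 m).1 (m2 m).1.
- by rewrite /= (m1 m).2 (m2 m).2.
- by rewrite /= t1.1 t2.1.
- by rewrite /dst barK; apply: (scalerI z0); rewrite t1.2 t2.2.
- by rewrite /= s1.1 s2.1.
by apply: (scalerI z0); rewrite s1.2 s2.2.
Qed.

Lemma simple_values_unique sigma sigma' :
  simple_values sigma -> induction_relations sigma ->
  simple_values sigma' -> induction_relations sigma' ->
  forall b a, (b < a)%N -> sigma b a = sigma' b a.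
Proof.
move=> v1 i1 v2 i2.
apply: (@inductive_family_unique k F qh U k_gt0 sigma sigma' i1 i2 (simple_values_edge v1 v2)).
by case: v1 v2 => [_ _ _ ->] [_ _ _ ->].
Qed.

Section Values.
Variables (N : idx -> idx -> U) (sigma : idx -> idx -> U).
Hypothesis kap0 : kap != 0.
Hypothesis N1 : forall a, N a a = 1.
Hypothesis N0 : forall a b, (a < b)%N -> N a b = 0.
Hypothesis Nrel : forall c a b,
  qpow qh (form (alpha c) (eps b)) *: (N a b * (e c * K c)) -
  ((-1) ^+ (lpar c && (par a (+) par b)) *
     qpow qh (- form (alpha c) (eps a))) *: (e c * K c * N a b) +
  hpow qh (form (alpha c) (eps b)) *: (\sum_i pie qh c i b *:
    ((-1) ^+ (lpar c && (par a (+) par i)) *: N a i)) =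
  \sum_j pie qh c a j *: (hpow qh (form (alpha c) (eps j)) *: N j b).
Hypothesis Nsg : forall b a, (b < a)%N -> N a b = (kap * (-1) ^+ par b) *: sigma b a.

Let E c : U := e c * K c.

Lemma sigma_simple_values : simple_values sigma.
Proof.
have src_val c := @sigma_src k F qh U k_gt0 qh0 kap0 E N sigma N1 Nrel Nsg c.
have bar_val c := @sigma_bar k F qh U k_gt0 qh0 kap0 E N sigma N1 Nrel Nsg c.
split=> [m|||].
- split; first exact: (src_val (inl m)).
  have z0 : qpow qh 1 != 0 by rewrite qpow_neq0.
  have qE : qpow qh 1 * hpow qh (-1) = hpow qh 1.
    by rewrite qpow_hpow // -mulrA -(hpowD qh0) hpow0 mulr1.
  apply: (scalerI z0); have := bar_val (inl m); rewrite /sgk mul1r => ->.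
  by rewrite scalerA qE; reflexivity.
- by split; [exact: (src_val lab_s) | exact: (bar_val lab_s)].
- split; first exact: (src_val lab_t).
  by have := bar_val lab_t; rewrite /dst barK.
exact: (@sigma_ev k F qh U k_gt0 qh0 kap0 E N sigma N0 Nrel Nsg).
Qed.

Lemma sigma_q_commutation : q_commutation sigma.
Proof.
move=> b a c ba ha hb.
have := @sigma_qcomm k F qh U k_gt0 kap0 E N sigma Nrel Nsg c b a ba ha hb.
by rewrite /E (mulrA (sigma b a)).
Qed.

Lemma sigma_induction_relations : induction_relations sigma.
Proof. exact: (@sigma_induction k F qh U k_gt0 qh0 kap0 E N sigma N1 Nrel Nsg). Qed.

End Values.

Lemma Rmx_intertwines sigma (N : idx -> idx -> U) :
  (forall a b, unitriangular_part sigma a b = N a b) ->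
  (forall a b, hom qh theta K h (@Uplus k F qh)
     (eps b - eps a) (par a (+) par b) (N a b)) ->
  (forall c a b,
    qpow qh (form (alpha c) (eps b)) *: (N a b * (e c * K c)) -
    ((-1) ^+ (lpar c && (par a (+) par b)) *
       qpow qh (- form (alpha c) (eps a))) *: (e c * K c * N a b) +
    hpow qh (form (alpha c) (eps b)) *: (\sum_i pie qh c i b *:
      ((-1) ^+ (lpar c && (par a (+) par i)) *: N a i)) =
    \sum_j pie qh c a j *: (hpow qh (form (alpha c) (eps j)) *: N j b)) ->
  intertwines (Rmx sigma).
Proof.
move=> NE Nhom Nrel; apply/intertwinesE => c a d.
pose kk a := Uqh qh (eps a); pose R a b : U := kk a * N a b.
have RE a' b' : Rmx sigma a' b' = R a' b'.
  by apply: etrans (Rmx_entry _ _ _) _; rewrite NE.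
have kk_edge c' a' b' : edge c' a' b' -> kk a' = kk b' * (K c' * K c').
  exact: (@Kwgt_edge k F U k_gt0 K Ki (@UK_Ki k F qh) (@UKi_K k F qh) (@UK_comm k F qh)).
have K_kk c' a' : K c' * kk a' = kk a' * K c'.
  exact: (@K_Kwgt k F U k_gt0 K Ki (@UK_Ki k F qh) (@UKi_K k F qh) (@UK_comm k F qh) qh qh0).
have kk_e c' a' : kk a' * e c' = qpow qh (form (eps a') (alpha c')) *: (e c' * kk a').
  exact: (@Kwgt_comm k F U k_gt0 K Ki (@UK_Ki k F qh) (@UKi_K k F qh) qh qh0
    (eps a') (alpha c') (e c') (khom_e qh c').2).
have e_kk c' a' : e c' * kk a' = qpow qh (- form (alpha c') (eps a')) *: (kk a' * e c').
  by rewrite kk_e formC scalerA -(qpowD qh0) addNr qpow0 ?scale1r.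
have thN a' b' : theta (N a' b') = (-1) ^+ (par a' (+) par b') *: N a' b'.
  have [_ [thN _] _] := Nhom a' b'; exact: thN.
have KN c' a' b' : K c' * N a' b' =
    hpow qh (form (alpha c') (eps b' - eps a')) *: (N a' b' * K c').
  have [_ [_ KN] _] := Nhom a' b'; exact: KN.
have thkk a' : theta (kk a') = kk a' by apply: theta_Uqh.
have := @intertwining k F qh U k_gt0 qh0 theta K Ki e (@UK_Ki k F qh) (@UKi_K k F qh)
  (@theta_lin k F qh) (@theta_mul k F qh) (@theta_K k F qh) (@theta_e k F qh)
  kk N kk_edge K_kk e_kk thkk thN KN Nrel a c d.
move=> eq; transitivity (graded_product theta R (pi_Delta qh Ki e c) a d).
  by apply: eq_bigr => b _; rewrite RE.
by apply: etrans eq _; apply: eq_bigr => b _; rewrite RE.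
Qed.

End Intertwiner.

Theorem proposition3p1 (F : numFieldType) (qh : F) (k : nat)
    (qh_gt0 : 0 < qh) (q_neq1 : qh ^+ 2 != 1) (k_gt0 : (0 < k)%N) :
  exists R : 'M[Uq k qh]_k.*2.+2,
    [/\ has_form R,
        intertwines R,
        forall R' : 'M[Uq k qh]_k.*2.+2,
          has_form R' -> intertwines R' -> R' = R &
        forall sigma : idx k -> idx k -> Uq k qh,
          admissible sigma -> R = Rmx sigma ->
          [/\ simple_values sigma,
              q_commutation sigma,
              induction_relations sigma &
              forall tau : idx k -> idx k -> Uq k qh,
                simple_values tau -> q_commutation tau ->
                induction_relations tau ->
                forall b a : idx k, wgt_gt b a -> tau b a = sigma b a]].
Proof.
have qh0 : qh != 0 by rewrite lt0r_neq0.
have q_gt0 : 0 < qpow qh 1 by rewrite qpow1 // mulr_gt0.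
have q2 : qpow qh 1 + (qpow qh 1)^-1 != 0.
  by rewrite lt0r_neq0 // addr_gt0 // invr_gt0.
have kap0 : qpow qh 1 - qpow qh (-1) != 0.
  (* From [q = q^-1] follows [(q - 1) * (q + 1) = 0], and [q + 1] is positive. *)
  apply: contra q_neq1; rewrite subr_eq0 (qpowN qh) => /eqP qq.
  have xx : qpow qh 1 * qpow qh 1 = 1 by rewrite {2}qq mulfV // lt0r_neq0.
  have /eqP := subr_sqr_1 (qpow qh 1); rewrite expr2 xx subrr eq_sym mulf_eq0.
  rewrite subr_eq0 (negPf (lt0r_neq0 (addr_gt0 q_gt0 ltr01))) orbF.
  by rewrite qpow1 // -expr2.
have [N [N1 N0 Nhom Nrel]] := Uplus_solution k_gt0 qh0 q2.
have c0 (b : idx k) : (qpow qh 1 - qpow qh (-1)) * (-1) ^+ par b != 0 :> F.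
  by rewrite mulf_neq0 ?signr_eq0.
pose sigma0 (b a : idx k) : Uq k qh :=
  ((qpow qh 1 - qpow qh (-1)) * (-1) ^+ par b)^-1 *: N a b.
have N_sigma0 b a : N a b = ((qpow qh 1 - qpow qh (-1)) * (-1) ^+ par b) *: sigma0 b a.
  by rewrite /sigma0 scalerA mulfV ?scale1r.
have part_eq a b : unitriangular_part sigma0 a b = N a b.
  rewrite /unitriangular_part /unitriangular; have [->|ab] := eqVneq a b; first by rewrite N1.
  case: ltnP => [_|]; first by rewrite N_sigma0.
  rewrite leq_eqVlt (inj_eq (@ord_inj _)) (negPf ab) => /N0->//.
have adm0 : admissible sigma0.
  move=> b a ba; have [] := homZ (@theta_lin k F qh) (@UplusZ k F qh)
    ((qpow qh 1 - qpow qh (-1)) * (-1) ^+ par b)^-1 (Nhom a b).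
  by move=> h1 [h2 _] h3.
have int0 := Rmx_intertwines k_gt0 qh0 part_eq Nhom Nrel.
exists (Rmx sigma0); split; [by exists sigma0 | exact: int0 | |].
  by move=> R' [sigma' _ ->] int'; apply: (intertwiner_unique k_gt0 int' int0).
(* A family presenting [R] is determined only on pairs [b < a], so the values are derived for an
   arbitrary one through its agreement with [sigma0] there. *)
move=> sigma _ eR; have sE := Rmx_inj k_gt0 kap0 eR.
have Nsg (b a : idx k) : (b < a)%N ->
    N a b = ((qpow qh 1 - qpow qh (-1)) * (-1) ^+ par b) *: sigma b a.
  by move=> ba; rewrite N_sigma0 (sE b a ba).
have sv := sigma_simple_values k_gt0 qh0 kap0 N1 N0 Nrel Nsg.
have ir := sigma_induction_relations k_gt0 qh0 kap0 N1 Nrel Nsg.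
split; [exact: sv | exact: (sigma_q_commutation k_gt0 kap0 Nrel Nsg) | exact: ir |].
by move=> tau svt _ irt; apply: (simple_values_unique k_gt0 qh0 svt irt sv ir).
Qed.
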